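(* Let $G$ be a Zariski-dense subgroup of $\mathrm{SL}(2,\mathbb{H})$. (1) Let $f$ be a $2$-rotatory elliptic element of $\mathrm{SL}(2,\mathbb{H})$ such that $0<\mathrm{argtr}(f)<\frac{\pi}{3}$. If the two-generator subgroup $\langle f,g\rangle$ is discrete for every hyperbolic element $g$ in $G$, then $G$ is discrete. (2) Let $f$ be a hyperbolic element of $\mathrm{SL}(2,\mathbb{H})$ such that $$\tfrac{1}{2}\left(\mathrm{abstr}(f)^2-3\right)<\cos(\mathrm{argtr}(f)).$$ If the two-generator subgroup $\langle f,g\rangle$ is discrete for every hyperbolic element $g$ in $G$, then $G$ is discrete. (3) Let $f$ be a parabolic element of $\mathrm{SL}(2,\mathbb{H})$ such that, up to conjugacy, $$f=\begin{pmatrix}1&\mu\\0&1\end{pmatrix},\qquad |\mu|\le 1.$$ If the two-generator subgroup $\langle f,g\rangle$ is discrete for every hyperbolic element $g$ in $G$, then $G$ is discrete.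
   Context: $\mathbb{H}$ is the division ring of real quaternions; $\mathbb{C}\subset\mathbb{H}$ is the subfield $\mathbb{R}+\mathbb{R}i$. $\mathrm{SL}(2,\mathbb{H})$ is the group of $2\times 2$ quaternionic matrices $\begin{pmatrix}a&b\\c&d\end{pmatrix}$ with quaternionic determinant $|ad-aca^{-1}b|=1$ (read as $|bc|=1$ when $a=0$), with the topology induced from the space of $2\times2$ quaternionic matrices; ''discrete'' means discrete as a subgroup of this topological group. It acts on $\widehat{\mathbb{H}}=\mathbb{H}\cup\{\infty\}$ (identified with $\mathbb{S}^4=\partial\mathbf{H}^5$, the conformal boundary of real hyperbolic $5$-space $\mathbf{H}^5$) by $Z\mapsto (aZ+b)(cZ+d)^{-1}$, and by Poincaré extension it acts on $\mathbf{H}^5$ by orientation-preserving isometries; the full group of orientation-preserving isometries of $\mathbf{H}^5$ is $\mathrm{SL}(2,\mathbb{H})/\{\pm I\}$. A subgroup $G$ of $\mathrm{SL}(2,\mathbb{H})$ is Zariski-dense if it has no global fixed point in $\overline{\mathbf{H}}^5=\mathbf{H}^5\cup\partial\mathbf{H}^5$ and does not preserve any proper totally geodesic subspace of $\mathbf{H}^5$. Elements of $\mathrm{SL}(2,\mathbb{H})$ are classified as elliptic, parabolic or hyperbolic (loxodromic) according to their action on $\overline{\mathbf{H}}^5$. A parabolic element is conjugate to $\begin{pmatrix}\lambda&1\\0&\lambda\end{pmatrix}$ with $\lambda\in\mathbb{C}$, $|\lambda|=1$. Up to conjugacy, an elliptic or hyperbolic element is $A=\begin{pmatrix}\lambda&0\\0&\mu\end{pmatrix}$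 with $\lambda,\mu\in\mathbb{C}$ (so $|\lambda||\mu|=1$); it is hyperbolic if and only if $|\lambda|\ne1\ne|\mu|$. If $|\lambda|=|\mu|=1$ and $\lambda$ is not similar to $\mu$, then $A$ is called $2$-rotatory elliptic. Here two quaternions $a,b$ are similar if $b=c^{-1}ac$ for some nonzero $c\in\mathbb{H}$. If a quaternion $a$ is similar to $re^{i\theta}$ with $r=|a|$ and $\theta\in(-\pi,\pi]$, its argument is $\arg(a)=|\theta|$. For an elliptic or hyperbolic element $A$, conjugate to $\begin{pmatrix}\lambda&0\\0&\mu\end{pmatrix}$ with $\lambda,\mu\in\mathbb{C}$ and $|\lambda||\mu|=1$, the argument trace is $\mathrm{argtr}(A)=\arg(\lambda)+\arg(\mu)$ and the absolute trace is $\mathrm{abstr}(A)=|\lambda|+|\mu|$. *)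

(* Defs.v *)
From HB Require Import structures.
From mathcomp Require Import all_boot all_order all_algebra.
From mathcomp Require Import all_classical all_reals all_analysis.
From mathcomp Require Import ring lra.

Set Implicit Arguments.
Unset Strict Implicit.
Unset Printing Implicit Defensive.

Import Order.TTheory GRing.Theory Num.Theory.
Import numFieldNormedType.Exports.

Local Open Scope classical_set_scope.
Local Open Scope ring_scope.

(* Quat a b c d is a + b i + c j + d k *)
Record quat (R : Type) : Type := Quat { qre : R; qi : R; qj : R; qk : R }.

Definition quat_prod (R : Type) (q : quat R) : R * R * R * R :=
  (qre q, qi q, qj q, qk q).
Definition prod_quat (R : Type) (p : R * R * R * R) : quat R :=
  Quat p.1.1.1 p.1.1.2 p.1.2 p.2.

Lemma quat_prodK (R : Type) : cancel (@quat_prod R) (@prod_quat R).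
Proof. by case. Qed.

HB.instance Definition _ (R : choiceType) :=
  Choice.copy (quat R) (can_type (@quat_prodK R)).

Section QuatStructures.
Variable R : realType.
Implicit Types (p q r : quat R) (a b : R).

Definition qzero : quat R := Quat 0 0 0 0.
Definition qone : quat R := Quat 1 0 0 0.
Definition qopp q := Quat (- qre q) (- qi q) (- qj q) (- qk q).
Definition qadd p q :=
  Quat (qre p + qre q) (qi p + qi q) (qj p + qj q) (qk p + qk q).
Definition qmul p q :=
  Quat (qre p * qre q - qi p * qi q - qj p * qj q - qk p * qk q)
       (qre p * qi q + qi p * qre q + qj p * qk q - qk p * qj q)
       (qre p * qj q - qi p * qk q + qj p * qre q + qk p * qi q)
       (qre p * qk q + qi p * qj q - qj p * qi q + qk p * qre q).
Definition qscale a q := Quat (a * qre q) (a * qi q) (a * qj q) (a * qk q).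
Definition qconj q := Quat (qre q) (- qi q) (- qj q) (- qk q).
Definition qnormsq q := qre q ^+ 2 + qi q ^+ 2 + qj q ^+ 2 + qk q ^+ 2.
Definition qnorm q : R := Num.sqrt (qnormsq q).
Definition qinv q := qscale (qnormsq q)^-1 (qconj q).

Lemma qaddA : associative qadd.
Proof. by move=> p q r; congr Quat; rewrite /= addrA. Qed.
Lemma qaddC : commutative qadd.
Proof. by move=> p q; congr Quat; rewrite /= addrC. Qed.
Lemma qadd0 : left_id qzero qadd.
Proof. by case=> a b c d; congr Quat; rewrite /= add0r. Qed.
Lemma qaddN : left_inverse qzero qopp qadd.
Proof. by move=> p; congr Quat; rewrite /= addNr. Qed.

HB.instance Definition _ :=
  GRing.isZmodule.Build (quat R) qaddA qaddC qadd0 qaddN.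

Lemma qmulA : associative qmul.
Proof. by move=> p q r; congr Quat => /=; ring. Qed.
Lemma qmul1l : left_id qone qmul.
Proof. by case=> a b c d; congr Quat => /=; ring. Qed.
Lemma qmul1r : right_id qone qmul.
Proof. by case=> a b c d; congr Quat => /=; ring. Qed.
Lemma qmulDl : left_distributive qmul +%R.
Proof. by move=> p q r; congr Quat => /=; ring. Qed.
Lemma qmulDr : right_distributive qmul +%R.
Proof. by move=> p q r; congr Quat => /=; ring. Qed.
Lemma qone_neq0 : qone != 0.
Proof. by apply/eqP => -[] /eqP; rewrite oner_eq0. Qed.

HB.instance Definition _ := GRing.Zmodule_isNzRing.Build (quat R)
  qmulA qmul1l qmul1r qmulDl qmulDr qone_neq0.

Lemma qscaleA a b q : qscale a (qscale b q) = qscale (a * b) q.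
Proof. by congr Quat => /=; ring. Qed.
Lemma qscale1 : left_id 1 qscale.
Proof. by case=> a b c d; congr Quat => /=; ring. Qed.
Lemma qscaleDr : right_distributive qscale +%R.
Proof. by move=> a p q; congr Quat => /=; ring. Qed.
Lemma qscaleDl q : {morph qscale^~ q : a b / a + b}.
Proof. by move=> a b; congr Quat => /=; ring. Qed.

HB.instance Definition _ := GRing.Zmodule_isLmodule.Build R (quat R)
  qscaleA qscale1 qscaleDr qscaleDl.

Lemma qscaleAl a p q : a *: (p * q) = (a *: p) * q.
Proof. by congr Quat => /=; ring. Qed.
Lemma qscaleAr a p q : a *: (p * q) = p * (a *: q).
Proof. by congr Quat => /=; ring. Qed.

HB.instance Definition _ := GRing.Lmodule_isLalgebra.Build R (quat R) qscaleAl.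
HB.instance Definition _ := GRing.Lalgebra_isAlgebra.Build R (quat R) qscaleAr.

Lemma qnormsq_ge0 q : 0 <= qnormsq q.
Proof. by rewrite !addr_ge0 ?sqr_ge0. Qed.

Lemma qnormsq_eq0 q : (qnormsq q == 0) = (q == 0).
Proof.
apply/eqP/eqP => [|->]; last by rewrite /qnormsq /=; ring.
case: q => a b c d; rewrite /qnormsq /= => /eqP.
rewrite !paddr_eq0 ?addr_ge0 ?sqr_ge0 // !sqrf_eq0.
by move=> /andP[/andP[/andP[/eqP-> /eqP->] /eqP->] /eqP->].
Qed.

Lemma qmulVq : {in [pred q : quat R | q != 0], left_inverse 1 qinv *%R}.
Proof.
move=> q; rewrite inE -qnormsq_eq0 => q0.
by congr Quat; rewrite /= /qnormsq in q0 *; field.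
Qed.
Lemma qmulqV : {in [pred q : quat R | q != 0], right_inverse 1 qinv *%R}.
Proof.
move=> q; rewrite inE -qnormsq_eq0 => q0.
by congr Quat; rewrite /= /qnormsq in q0 *; field.
Qed.
Lemma qunitP p q : q * p = 1 /\ p * q = 1 -> p != 0.
Proof.
move=> [qp1 _]; apply/eqP => p0; move: qp1; rewrite p0 mulr0 => /eqP.
by rewrite eq_sym oner_eq0.
Qed.
Lemma qinv_out : {in [predC [pred q : quat R | q != 0]], qinv =1 id}.
Proof.
move=> q; rewrite !inE negbK => /eqP ->.
by congr Quat; rewrite /= ?oppr0 mulr0.
Qed.

HB.instance Definition _ := GRing.NzRing_hasMulInverse.Build (quat R)
  qmulVq qmulqV qunitP qinv_out.

Lemma qnormD p q : qnorm (p + q) <= qnorm p + qnorm q.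
Proof.
have p0 := qnormsq_ge0 p; have q0 := qnormsq_ge0 q.
rewrite -(@ler_pXn2r _ 2) ?nnegrE ?addr_ge0 ?sqrtr_ge0 //.
rewrite sqrrD !sqr_sqrtr ?qnormsq_ge0 // -sqrtrM //.
pose s := qre p * qre q + qi p * qi q + qj p * qj q + qk p * qk q.
have -> : qnormsq (p + q) = qnormsq p + s *+ 2 + qnormsq q.
  by rewrite /qnormsq /s /=; ring.
rewrite lerD2r lerD2l lerMn2r /= (le_trans (ler_norm s)) // -sqrtr_sqr.
rewrite ler_wsqrtr // -subr_ge0.
have -> : qnormsq p * qnormsq q - s ^+ 2 =
    (qre p * qi q - qi p * qre q) ^+ 2 + (qre p * qj q - qj p * qre q) ^+ 2 +
    (qre p * qk q - qk p * qre q) ^+ 2 + (qi p * qj q - qj p * qi q) ^+ 2 +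
    (qi p * qk q - qk p * qi q) ^+ 2 + (qj p * qk q - qk p * qj q) ^+ 2.
  by rewrite /qnormsq /s; ring.
by rewrite !addr_ge0 ?sqr_ge0.
Qed.
Lemma qnormZ a q : qnorm (a *: q) = `|a| * qnorm q.
Proof.
rewrite /qnorm -sqrtr_sqr -sqrtrM ?sqr_ge0 //; congr Num.sqrt.
by rewrite /qnormsq /=; ring.
Qed.
Lemma qnorm0_eq0 q : qnorm q = 0 -> q = 0.
Proof.
move=> /eqP; rewrite sqrtr_eq0 => q0; apply/eqP; rewrite -qnormsq_eq0.
by rewrite eq_le q0 qnormsq_ge0.
Qed.

(* `|q| is now the Euclidean norm, and 'M[quat R]_2 gets the product topology *)
HB.instance Definition _ :=
  Lmodule_isNormed.Build R (quat R) qnormD qnormZ qnorm0_eq0.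

End QuatStructures.

Section Hyperbolic5.
Variable R : realType.

Definition complexq (q : quat R) : Prop := qj q = 0 /\ qk q = 0.

Definition qexpi (t : R) : quat R := Quat (cos t) (sin t) 0 0.

Definition similar (a b : quat R) : Prop :=
  exists2 c : quat R, c != 0 & b = c^-1 * a * c.

Definition mx2 (a b c d : quat R) : 'M[quat R]_2 :=
  \matrix_(i, j) if i == 0 then (if j == 0 then a else b)
                 else (if j == 0 then c else d).

Definition qdet (A : 'M[quat R]_2) : R :=
  let a := A 0 0 in let b := A 0 1 in let c := A 1 0 in let d := A 1 1 in
  if a == 0 then `|b * c| else `|a * d - a * c * a^-1 * b|.

Definition SL2H : set 'M[quat R]_2 := [set A | qdet A = 1].

(* Matrix inverses are not available over noncommutative rings, hence the
   relational form. *)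
Definition mx_inverse (A B : 'M[quat R]_2) : Prop := A * B = 1 /\ B * A = 1.

Definition subgroup_SL2H (G : set 'M[quat R]_2) : Prop :=
  [/\ G `<=` SL2H, G 1, (forall A B, G A -> G B -> G (A * B)) &
      forall A, G A -> exists2 B, G B & mx_inverse A B].

Definition generated2 (f g : 'M[quat R]_2) : set 'M[quat R]_2 :=
  \bigcap_(H in [set H | [/\ subgroup_SL2H H, H f & H g]]) H.

Definition discrete_subset (G : set 'M[quat R]_2) : Prop := G `<=` isolated G.

Definition conjugate_SL2H (A B : 'M[quat R]_2) : Prop :=
  exists P Q, [/\ SL2H P, SL2H Q, mx_inverse P Q & A = P * B * Q].

(* H with a point at infinity: None is infinity *)
Definition mobius (A : 'M[quat R]_2) (z : option (quat R)) :
    option (quat R) :=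
  let a := A 0 0 in let b := A 0 1 in let c := A 1 0 in let d := A 1 1 in
  match z with
  | None => if c == 0 then None else Some (a * c^-1)
  | Some z => if c * z + d == 0 then None
              else Some ((a * z + b) * (c * z + d)^-1)
  end.

(* The upper half-space model: the points (z, t) of H x R with t > 0 *)
Definition H5 : set (quat R * R) := [set p | 0 < p.2].

(* The Poincare extension of mobius A. At height t = 0 it specializes to
   (a z + b) (c z + d)^-1, because q^-1 = conj q / |q|^2. *)
Definition poincare (A : 'M[quat R]_2) (p : quat R * R) : quat R * R :=
  let a := A 0 0 in let b := A 0 1 in let c := A 1 0 in let d := A 1 1 in
  let z := p.1 in let t := p.2 in
  let N := `|c * z + d| ^+ 2 + `|c| ^+ 2 * t ^+ 2 in
  (N^-1 *: ((a * z + b) * qconj (c * z + d) + t ^+ 2 *: (a * qconj c)),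
   N^-1 * t).

(* Distance: cosh d = 1 + (|z - w|^2 + (t - s)^2) / (2 t s) *)
Definition arcosh (x : R) : R := ln (x + Num.sqrt (x ^+ 2 - 1)).

Definition hdist (p q : quat R * R) : R :=
  arcosh (1 + (`|p.1 - q.1| ^+ 2 + (p.2 - q.2) ^+ 2) / (2 * p.2 * q.2)).

Definition geodesic_line (gamma : R -> quat R * R) : Prop :=
  range gamma `<=` H5 /\ forall s t, hdist (gamma s) (gamma t) = `|s - t|.

Definition totally_geodesic (S : set (quat R * R)) : Prop :=
  [/\ S !=set0, S `<=` H5 &
      forall p q gamma, S p -> S q -> p != q -> geodesic_line gamma ->
        range gamma p -> range gamma q -> range gamma `<=` S].

Definition zariski_dense (G : set 'M[quat R]_2) : Prop :=
  [/\ ~ (exists2 p, H5 p & forall A, G A -> poincare A p = p),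
      ~ (exists z, forall A, G A -> mobius A z = z) &
      ~ (exists S, [/\ totally_geodesic S, S <> H5 &
                       forall A, G A -> poincare A @` S = S])].

Definition elliptic (A : 'M[quat R]_2) : Prop :=
  SL2H A /\ exists2 p, H5 p & poincare A p = p.

Definition parabolic (A : 'M[quat R]_2) : Prop :=
  [/\ SL2H A, ~ (exists2 p, H5 p & poincare A p = p) &
      exists z, [set w | mobius A w = w] = [set z]].

Definition hyperbolic (A : 'M[quat R]_2) : Prop :=
  [/\ SL2H A, ~ (exists2 p, H5 p & poincare A p = p) &
      exists z1 z2, z1 <> z2 /\ [set w | mobius A w = w] = [set z1; z2]].

Definition diagonal_form (A : 'M[quat R]_2) (l m : quat R) : Prop :=
  [/\ complexq l, complexq m, `|l| * `|m| = 1 &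
      conjugate_SL2H A (mx2 l 0 0 m)].

Definition rotatory2_elliptic (A : 'M[quat R]_2) : Prop :=
  elliptic A /\ exists l m, [/\ diagonal_form A l m, `|l| = 1, `|m| = 1 &
                                ~ similar l m].

(* The defining set is a singleton for a <> 0; the argument of 0 is
   irrelevant. *)
Definition qarg (a : quat R) : R :=
  xget 0 [set x | exists t, [/\ - pi < t, t <= pi,
                                similar a (`|a| *: qexpi t) & x = `|t|]].

(* For elliptic and hyperbolic A the sets below are singletons: l and m are
   determined by A up to order and complex conjugation. *)
Definition argtr (A : 'M[quat R]_2) : R :=
  xget 0 [set x | exists l m, diagonal_form A l m /\ x = qarg l + qarg m].

Definition abstr (A : 'M[quat R]_2) : R :=
  xget 0 [set x | exists l m, diagonal_form A l m /\ x = `|l| + `|m|].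

End Hyperbolic5.

(* Main.v *)
From mathcomp Require Import all_boot all_order all_algebra.
From mathcomp Require Import all_classical all_reals all_analysis.
From mathcomp Require Import ring lra.
Require Import Defs.

Set Implicit Arguments.
Unset Strict Implicit.
Unset Printing Implicit Defensive.

Import Order.TTheory GRing.Theory Num.Theory.
Import numFieldNormedType.Exports.

Local Open Scope classical_set_scope.
Local Open Scope ring_scope.

(** Let G be Zariski-dense and not discrete. It suffices to find hyperbolic
    elements g of G arbitrarily close to the identity which, in the frame where
    f is diag(l, m) or the translation by mu, fix neither 0 nor infinity. Indeed
    inequalities of Jorgensen and Shimizu type then show that <f, g> is not
    discrete: iterating the map sending g to g f g^-1 produces infinitely many
    elements in a bounded set (in the diagonal case, f and f^-1 alternate;
    [jorgensen], [shimizu]). In the diagonal case the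
    off-diagonal entries of g f g^-1 have factors l q - q m, and
    |l q - q m|^2 is at most |l|^2 + |m|^2 - 2 |l| |m| cos (arg l + arg m) times
    |q|^2 ([twist_norm]); since |l| |m| = 1, the hypotheses on argtr and abstr say
    exactly that this factor is less than 1.

    Hyperbolic space is modelled by the positive definite quaternionic Hermitian
    2 by 2 matrices of determinant 1, on which A acts by X |-> A X A^T with A^T
    the conjugate transpose. Geodesics are plane sections there
    ([geodesic_span]), so that Zariski-density says that G fixes no point
    of hyperbolic space or at infinity, and that a G-invariant linear space of
    Hermitian matrices containing a positive one is the whole space ([zariski_dense_irreducible]).

    Hyperbolicity is detected by the real trace: |Re tr A| > 2 is an open condition
    that implies it ([loxodromic_hyperbolic]). This rests on two facts. A bounded
    group fixes a point of hyperbolic space ([bounded_fixes_positive]), so that its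
    elements have real trace at most 2 in norm. An unbounded set has rank one
    limit directions ([unbounded_rank1]); applied to the centralizer of A, this
    yields an eigenvector of A. Applied to G, the same two facts yield an element
    of G with large real trace ([irreducible_loxodromic]).

    In the frame of such an element, conjugating elements of G that tend to the
    identity by its powers, and passing to the limit, gives small nontrivial
    translations fixing infinity, and others fixing 0, in the closure of G
    ([norm_closure_translation]). Among short words in these translations one
    has real trace greater than 2 ([translations_word]), whence hyperbolic
    elements of G near the identity ([near_loxodromic]). The argument needs that
    the elements of G near the identity have no common fixed point at infinity
    ([germ_not_fixed]), which again follows from irreducibility. *)

(** * Quaternions and 2 by 2 quaternionic matrices *)

Section Quaternions.
Variable R : realType.
Implicit Types p q : quat R.

Lemma quatP p q : qre p = qre q -> qi p = qi q -> qj p = qj q -> qk p = qk q ->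
  p = q.
Proof. by case: p q => [a b c d] [a' b' c' d'] /= -> -> -> ->. Qed.

Lemma sqr_qnorm q : `|q| ^+ 2 = qnormsq q.
Proof. by rewrite sqr_sqrtr ?qnormsq_ge0. Qed.

Lemma qnormE q : `|q| = Num.sqrt (qnormsq q). Proof. by []. Qed.

Lemma qnormsqM p q : qnormsq (p * q) = qnormsq p * qnormsq q.
Proof. by case: p q => [a b c d] [a' b' c' d']; rewrite /qnormsq /=; ring. Qed.

Lemma qnormM p q : `|p * q| = `|p| * `|q|.
Proof. by rewrite !qnormE qnormsqM sqrtrM ?qnormsq_ge0. Qed.

Lemma qnorm1 : `|1 : quat R| = 1.
Proof. by rewrite qnormE /qnormsq /= !expr0n /= !addr0 expr1n sqrtr1. Qed.

Lemma qnorm_conj q : `|qconj q| = `|q|.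
Proof. by rewrite !qnormE /qnormsq /= !sqrrN. Qed.

Lemma qmulV q : q != 0 -> q * q^-1 = 1.
Proof. exact: qmulqV. Qed.

Lemma qmulVl q : q != 0 -> q^-1 * q = 1.
Proof. exact: qmulVq. Qed.

Lemma qnormV q : `|q^-1| = `|q|^-1.
Proof.
have [->|q0] := eqVneq q 0; first by rewrite invr0 normr0 invr0.
have h : `|q| != 0 by rewrite normr_eq0.
by apply: (mulfI h); rewrite -qnormM qmulV // mulfV // qnorm1.
Qed.

Lemma qmul_eq0 p q : (p * q == 0) = (p == 0) || (q == 0).
Proof. by rewrite -normr_eq0 qnormM mulf_eq0 !normr_eq0. Qed.

Lemma qconjM p q : qconj (p * q) = qconj q * qconj p.
Proof. by apply: quatP => /=; ring. Qed.

Lemma qconjK : involutive (@qconj R).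
Proof. by case=> a b c d; congr Quat; rewrite /= opprK. Qed.

Lemma qconjD p q : qconj (p + q) = qconj p + qconj q.
Proof. by apply: quatP => /=; ring. Qed.

Lemma qreMC p q : qre (p * q) = qre (q * p).
Proof. by rewrite /=; ring. Qed.

Lemma qreD p q : qre (p + q) = qre p + qre q. Proof. by []. Qed.

Lemma qreN q : qre (- q) = - qre q. Proof. by []. Qed.

Lemma sqr_norm_re (x : R) : `|x| ^+ 2 = x ^+ 2.
Proof. by rewrite real_normK ?num_real. Qed.

Lemma qcoord_le q : [/\ `|qre q| <= `|q|, `|qi q| <= `|q|, `|qj q| <= `|q|
  & `|qk q| <= `|q|].
Proof.
have h : forall x, x ^+ 2 <= qnormsq q -> `|x| <= `|q|.
  by move=> x hx; rewrite -(@ler_pXn2r _ 2) ?nnegrE // sqr_qnorm sqr_norm_re.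
have [a b c d] : [/\ 0 <= qre q ^+ 2, 0 <= qi q ^+ 2, 0 <= qj q ^+ 2
  & 0 <= qk q ^+ 2] by split; apply: sqr_ge0.
by split; apply: h; rewrite /qnormsq; lra.
Qed.

Lemma qre_le q : `|qre q| <= `|q|.
Proof. by case: (qcoord_le q). Qed.

Lemma qnorm_le_coord q : `|q| <= `|qre q| + `|qi q| + `|qj q| + `|qk q|.
Proof.
rewrite -(@ler_pXn2r _ 2) ?nnegrE ?addr_ge0 // sqr_qnorm /qnormsq.
rewrite -!(sqr_norm_re (_ q)).
move: (normr_ge0 (qre q)) (normr_ge0 (qi q)) (normr_ge0 (qj q))
  (normr_ge0 (qk q)).
by move: `|qre q| `|qi q| `|qj q| `|qk q| => a b c d; nra.
Qed.

Definition qreal (x : R) : quat R := Quat x 0 0 0.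

Lemma qrealM x q : qreal x * q = x *: q.
Proof. by apply: quatP => /=; ring. Qed.

Lemma qrealC x q : qreal x * q = q * qreal x.
Proof. by apply: quatP => /=; ring. Qed.

Lemma qnorm_real x : `|qreal x| = `|x|.
Proof. by rewrite qnormE /qnormsq /= expr0n /= !addr0 sqrtr_sqr. Qed.

Lemma qmul_conj q : q * qconj q = qreal (qnormsq q).
Proof. by apply: quatP; rewrite /qnormsq /=; ring. Qed.

Lemma qscaleAr2 (x : R) p q : p * (x *: q) = x *: (p * q).
Proof. by apply: quatP => /=; ring. Qed.

Lemma qscaleAl2 (x : R) p q : (x *: p) * q = x *: (p * q).
Proof. by apply: quatP => /=; ring. Qed.

End Quaternions.

Section Matrices.
Variable R : realType.
Local Notation M2 := 'M[quat R]_2.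
Implicit Types A B C X Y : M2.

Lemma mx200 (a b c d : quat R) : mx2 a b c d 0 0 = a.
Proof. by rewrite mxE. Qed.
Lemma mx201 (a b c d : quat R) : mx2 a b c d 0 1 = b.
Proof. by rewrite mxE. Qed.
Lemma mx210 (a b c d : quat R) : mx2 a b c d 1 0 = c.
Proof. by rewrite mxE. Qed.
Lemma mx211 (a b c d : quat R) : mx2 a b c d 1 1 = d.
Proof. by rewrite mxE. Qed.
Definition mx2e := (mx200, mx201, mx210, mx211).

Lemma ord2P (P : 'I_2 -> Prop) : P 0 -> P 1 -> forall i, P i.
Proof.
move=> P0 P1 i; have [->|->] // : i = 0 \/ i = 1.
by case: i => -[|[|]] // lti; [left|right]; apply: val_inj.
Qed.

Lemma mx2_ext A B : A 0 0 = B 0 0 -> A 0 1 = B 0 1 -> A 1 0 = B 1 0 ->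
  A 1 1 = B 1 1 -> A = B.
Proof. by move=> *; apply/matrixP; apply: ord2P; apply: ord2P. Qed.

Lemma mx2_eta A : A = mx2 (A 0 0) (A 0 1) (A 1 0) (A 1 1).
Proof. by apply: mx2_ext; rewrite mxE. Qed.

Lemma mul2E A B i j : (A * B) i j = A i 0 * B 0 j + A i 1 * B 1 j.
Proof.
rewrite mxE !big_ord_recl big_ord0 addr0; congr (A i _ * B _ j + A i _ * B _ j);
  exact: val_inj.
Qed.

Lemma mulmx2E n (A : M2) (v : 'M[quat R]_(2, n)) i j :
  (A *m v) i j = A i 0 * v 0 j + A i 1 * v 1 j.
Proof.
rewrite mxE !big_ord_recl big_ord0 addr0; congr (A i _ * v _ j + A i _ * v _ j);
  exact: val_inj.
Qed.

Lemma one2E : [/\ (1 : M2) 0 0 = 1, (1 : M2) 0 1 = 0, (1 : M2) 1 0 = 0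
  & (1 : M2) 1 1 = 1].
Proof. by split; rewrite mxE. Qed.

Lemma mx2_one : (1 : M2) = mx2 1 0 0 1.
Proof. by apply: mx2_ext; rewrite !mxE. Qed.

Lemma mx2_mul (a b c d a' b' c' d' : quat R) :
  mx2 a b c d * mx2 a' b' c' d' =
  mx2 (a * a' + b * c') (a * b' + b * d') (c * a' + d * c') (c * b' + d * d').
Proof. by apply: mx2_ext; rewrite mul2E !mx2e. Qed.

(** Among the equivalent norms, the sum of the entry norms is chosen because it
    is submultiplicative. *)
Definition mxnorm A : R := `|A 0 0| + `|A 0 1| + `|A 1 0| + `|A 1 1|.

Lemma mxnorm_ge0 A : 0 <= mxnorm A.
Proof. by rewrite !addr_ge0. Qed.

Lemma mxnormD A B : mxnorm (A + B) <= mxnorm A + mxnorm B.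
Proof.
rewrite /mxnorm !mxE.
have := (ler_normD (A 0 0) (B 0 0), ler_normD (A 0 1) (B 0 1)).
have := (ler_normD (A 1 0) (B 1 0), ler_normD (A 1 1) (B 1 1)).
by move=> [h1 h2] [h3 h4]; lra.
Qed.

Lemma mxnormN A : mxnorm (- A) = mxnorm A.
Proof. by rewrite /mxnorm !mxE !normrN. Qed.

Lemma mxnormBC A B : mxnorm (A - B) = mxnorm (B - A).
Proof. by rewrite -mxnormN opprB. Qed.

Lemma mxnorm_tri A B C : mxnorm (A - C) <= mxnorm (A - B) + mxnorm (B - C).
Proof. by have := mxnormD (A - B) (B - C); rewrite addrA subrK. Qed.

Lemma mxnorm_entry A i j : `|A i j| <= mxnorm A.
Proof.
have h := (normr_ge0 (A 0 0), normr_ge0 (A 0 1), normr_ge0 (A 1 0),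
  normr_ge0 (A 1 1)).
case: h => [[[h1 h2] h3] h4].
by move: j; apply: ord2P; move: i; apply: ord2P; rewrite /mxnorm; lra.
Qed.

Lemma mxnorm0_eq A : mxnorm A = 0 -> A = 0.
Proof.
move=> A0; apply/matrixP => i j; rewrite mxE; apply/eqP; rewrite -normr_eq0.
by rewrite eq_le normr_ge0 andbT -A0 mxnorm_entry.
Qed.

Lemma mxnormM A B : mxnorm (A * B) <= mxnorm A * mxnorm B.
Proof.
rewrite /mxnorm !mul2E.
have h i j : `|A i 0 * B 0 j + A i 1 * B 1 j| <=
    `|A i 0| * `|B 0 j| + `|A i 1| * `|B 1 j|.
  by rewrite -!qnormM ler_normD.
have := (h 0 0, h 0 1, h 1 0, h 1 1); move=> [[[{h}]]].
move: (normr_ge0 (A 0 0)) (normr_ge0 (A 0 1)) (normr_ge0 (A 1 0))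
  (normr_ge0 (A 1 1)) (normr_ge0 (B 0 0)) (normr_ge0 (B 0 1))
  (normr_ge0 (B 1 0)) (normr_ge0 (B 1 1)).
move: `|A 0 0| `|A 0 1| `|A 1 0| `|A 1 1| => a b c d.
move: `|B 0 0| `|B 0 1| `|B 1 0| `|B 1 1| => e f g k a0 b0 c0 d0 e0 f0 g0 k0.
move=> h1 h2 h3 h4; rewrite -subr_ge0.
have p : 0 <= a * g + a * k + b * e + b * f + (c * g + c * k + d * e + d * f).
  by rewrite !addr_ge0 ?mulr_ge0.
lra.
Qed.

Lemma mxnormM_le A B x y : 0 <= y -> mxnorm A <= x -> mxnorm B <= y ->
  mxnorm (A * B) <= x * y.
Proof.
move=> y0 hx hy; apply: le_trans (mxnormM _ _) _.
apply: le_trans (ler_wpM2r (mxnorm_ge0 _) hx) _.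
by apply: ler_wpM2l => //; apply: le_trans hx; apply: mxnorm_ge0.
Qed.

Lemma mxnorm1 : mxnorm (1 : M2) = 2.
Proof. by rewrite /mxnorm !mxE /= qnorm1 normr0; ring. Qed.

(** Real scalars commute with all matrices, unlike the quaternionic scalars of
    the left module structure. *)
Definition rscale (x : R) A : M2 := \matrix_(i, j) (x *: A i j).

Lemma rscaleE x A i j : rscale x A i j = x *: A i j.
Proof. by rewrite mxE. Qed.

Lemma mxnorm_rscale x A : mxnorm (rscale x A) = `|x| * mxnorm A.
Proof. by rewrite /mxnorm !mxE !normrZ -!mulrDr. Qed.

Lemma rscaleAl x A B : rscale x A * B = rscale x (A * B).
Proof.
by apply/matrixP => i j; rewrite rscaleE !mul2E !rscaleE !qscaleAl2 scalerDr.
Qed.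

Lemma rscaleAr x A B : A * rscale x B = rscale x (A * B).
Proof.
by apply/matrixP => i j; rewrite rscaleE !mul2E !rscaleE !qscaleAr2 scalerDr.
Qed.

Lemma rscaleA x y A : rscale x (rscale y A) = rscale (x * y) A.
Proof. by apply/matrixP => i j; rewrite !rscaleE scalerA. Qed.

Lemma rscale1 A : rscale 1 A = A.
Proof. by apply/matrixP => i j; rewrite rscaleE scale1r. Qed.

Lemma rscale_inj x A B : x != 0 -> rscale x A = rscale x B -> A = B.
Proof.
by move=> x0 /(congr1 (rscale x^-1)); rewrite !rscaleA mulVf // !rscale1.
Qed.

Lemma rscaleDr x A B : rscale x (A + B) = rscale x A + rscale x B.
Proof. by apply/matrixP => i j; rewrite !mxE scalerDr. Qed.

Lemma rscaleN x A : rscale x (- A) = - rscale x A.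
Proof. by apply/matrixP => i j; rewrite !mxE scalerN. Qed.

(** The real part of the trace, invariant under conjugation although the
    quaternionic trace is not *)
Definition retr A : R := qre (A 0 0) + qre (A 1 1).

Lemma retrMC A B : retr (A * B) = retr (B * A).
Proof.
rewrite /retr !mul2E !qreD (qreMC (A 0 0)) (qreMC (A 0 1)) (qreMC (A 1 0)).
by rewrite (qreMC (A 1 1)); ring.
Qed.

Lemma retrD A B : retr (A + B) = retr A + retr B.
Proof. by rewrite /retr !mxE !qreD; ring. Qed.

Lemma retrN A : retr (- A) = - retr A.
Proof. by rewrite /retr !mxE !qreN; ring. Qed.

Lemma retr_rscale x A : retr (rscale x A) = x * retr A.
Proof. by rewrite /retr !rscaleE /=; ring. Qed.

Lemma retr_le A : `|retr A| <= mxnorm A.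
Proof.
apply: le_trans (ler_normD _ _) _; rewrite /mxnorm.
have := (qre_le (A 0 0), qre_le (A 1 1), normr_ge0 (A 0 1), normr_ge0 (A 1 0)).
by move=> [[[h1 h2] h3] h4]; lra.
Qed.

Lemma retr_lip A B : `|retr A - retr B| <= mxnorm (A - B).
Proof. by rewrite -retrN -retrD retr_le. Qed.

Definition star A : M2 := \matrix_(i, j) qconj (A j i).

Lemma starE A i j : star A i j = qconj (A j i).
Proof. by rewrite mxE. Qed.

Lemma starK : involutive star.
Proof. by move=> A; apply/matrixP => i j; rewrite !starE qconjK. Qed.

Lemma starM A B : star (A * B) = star B * star A.
Proof.
by apply/matrixP => i j; rewrite starE !mul2E !starE qconjD !qconjM.
Qed.

Lemma star1 : star 1 = 1.
Proof.
by apply: mx2_ext; rewrite !mxE; apply: quatP; rewrite //= ?oppr0.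
Qed.

Lemma mxnorm_star A : mxnorm (star A) = mxnorm A.
Proof. by rewrite /mxnorm !starE !qnorm_conj; ring. Qed.

(** The square of the quaternionic determinant as a polynomial, valid whether
    or not the upper left entry vanishes. *)
Definition sqdet A : R :=
  qnormsq (A 0 0) * qnormsq (A 1 1) + qnormsq (A 0 1) * qnormsq (A 1 0)
  - 2 * qre (qconj (A 0 0) * A 0 1 * qconj (A 1 1) * A 1 0).

Lemma qdet_ge0 A : 0 <= qdet A.
Proof. by rewrite /qdet; case: ifP. Qed.

Lemma sqdetE A : sqdet A = qdet A ^+ 2.
Proof.
rewrite (mx2_eta A) /sqdet /qdet !mx2e.
move: (A 0 0) (A 0 1) (A 1 0) (A 1 1) => a b c d.
have [->|a0] := eqVneq a 0.
  rewrite sqr_qnorm qnormsqM {1}/qnormsq /=; ring.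
have -> : a * d - a * c * a^-1 * b = a * (d - c * a^-1 * b).
  by rewrite mulrBr !mulrA.
rewrite sqr_qnorm qnormsqM.
have n0 : qnormsq a != 0 by rewrite qnormsq_eq0.
have -> : a^-1 = (qnormsq a)^-1 *: qconj a by [].
move: a b c d n0 {a0} => [a0 a1 a2 a3] [b0 b1 b2 b3] [c0 c1 c2 c3] [d0 d1 d2 d3].
rewrite /qnormsq /= => n0; by field.
Qed.

Lemma SL2H_sqdet A : SL2H A <-> sqdet A = 1.
Proof.
rewrite /SL2H /= sqdetE; split=> [->|/eqP]; first by rewrite expr1n.
rewrite sqrf_eq1 => /orP[/eqP //|/eqP h]; have := qdet_ge0 A.
by rewrite h ler0N1.
Qed.

(** Hermitian matrices, with the determinant as a real quadratic form of
    signature (1, 5): the linear model of hyperbolic 5-space. *)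
Definition herm X := star X = X.

Definition hdet X : R := qre (X 0 0) * qre (X 1 1) - qnormsq (X 0 1).

Lemma hermP X : herm X -> [/\ X 0 0 = qreal (qre (X 0 0)),
  X 1 1 = qreal (qre (X 1 1)) & X 1 0 = qconj (X 0 1)].
Proof.
move=> hX; have h i j : qconj (X j i) = X i j by rewrite -starE hX.
have r (q : quat R) : qconj q = q -> q = qreal (qre q).
  case: q => a b c d []; rewrite /qreal /= => h1 h2 h3; congr Quat; lra.
by split; [apply: r|apply: r|].
Qed.

Lemma mx2_hermP (x y : R) z : herm (mx2 (qreal x) z (qconj z) (qreal y)).
Proof.
by apply: mx2_ext; rewrite starE !mx2e ?qconjK //; apply: quatP;
  rewrite //= oppr0.
Qed.

Lemma herm_eta X : herm X ->
  X = mx2 (qreal (qre (X 0 0))) (X 0 1) (qconj (X 0 1)) (qreal (qre (X 1 1))).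
Proof. by case/hermP => h1 h2 h3; apply: mx2_ext; rewrite mx2e. Qed.

Lemma herm_star_mul A : herm (A * star A).
Proof. by rewrite /herm starM starK. Qed.

Lemma herm_conj A X : herm X -> herm (A * X * star A).
Proof. by move=> hX; rewrite /herm !starM starK hX mulrA. Qed.

Lemma hermD X Y : herm X -> herm Y -> herm (X + Y).
Proof.
move=> hX hY; rewrite /herm -{2}hX -{2}hY.
by apply/matrixP => i j; rewrite !mxE qconjD.
Qed.

Lemma herm_rscale x X : herm X -> herm (rscale x X).
Proof.
move=> hX; rewrite /herm -{2}hX; apply/matrixP => i j; rewrite !mxE.
by apply: quatP => /=; ring.
Qed.

Lemma herm1 : herm 1. Proof. exact: star1. Qed.

Lemma hdet1 : hdet 1 = 1.
Proof. by rewrite /hdet !mxE /= /qnormsq /=; ring. Qed.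

Lemma hdet_conj A X : herm X -> hdet (A * X * star A) = sqdet A * hdet X.
Proof.
move=> /herm_eta ->; rewrite (mx2_eta A) /hdet /sqdet !mul2E !starE !mx2e.
move: (A 0 0) (A 0 1) (A 1 0) (A 1 1) (X 0 1) (qre (X 0 0)) (qre (X 1 1)).
move=> [a0 a1 a2 a3] [b0 b1 b2 b3] [c0 c1 c2 c3] [d0 d1 d2 d3] [z0 z1 z2 z3] x y.
by rewrite /qnormsq /=; ring.
Qed.

Lemma sqdet_hdet A : sqdet A = hdet (A * star A).
Proof. by have := hdet_conj A herm1; rewrite mulr1 hdet1 mulr1. Qed.

Lemma sqdetM A B : sqdet (A * B) = sqdet A * sqdet B.
Proof.
rewrite sqdet_hdet starM mulrA -(mulrA A) hdet_conj; last exact: herm_star_mul.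
by rewrite -sqdet_hdet.
Qed.

Lemma sqdet1 : sqdet 1 = 1.
Proof. by rewrite sqdet_hdet star1 mulr1 hdet1. Qed.

Lemma sqdet_ge0 A : 0 <= sqdet A.
Proof. by rewrite sqdetE sqr_ge0. Qed.

Lemma sqdet_star A : sqdet (star A) = sqdet A.
Proof.
rewrite (mx2_eta A) /sqdet !starE !mx2e.
move: (A 0 0) (A 0 1) (A 1 0) (A 1 1).
move=> [a0 a1 a2 a3] [b0 b1 b2 b3] [c0 c1 c2 c3] [d0 d1 d2 d3].
by rewrite /qnormsq /=; ring.
Qed.

Lemma sqdet_rscale x A : sqdet (rscale x A) = x ^+ 4 * sqdet A.
Proof.
rewrite (mx2_eta A) /sqdet !rscaleE !mx2e.
move: (A 0 0) (A 0 1) (A 1 0) (A 1 1).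
move=> [a0 a1 a2 a3] [b0 b1 b2 b3] [c0 c1 c2 c3] [d0 d1 d2 d3].
by rewrite /qnormsq /=; ring.
Qed.

Lemma sqdet_diag (l m : quat R) : sqdet (mx2 l 0 0 m) = (`|l| * `|m|) ^+ 2.
Proof.
rewrite /sqdet !mx2e exprMn !sqr_qnorm; move: l m => [l0 l1 l2 l3] [m0 m1 m2 m3].
by rewrite /qnormsq /=; ring.
Qed.

Lemma sqdet_tri (l m b : quat R) : sqdet (mx2 l b 0 m) = (`|l| * `|m|) ^+ 2.
Proof.
rewrite /sqdet !mx2e exprMn !sqr_qnorm; move: l m b => [l0 l1 l2 l3] [m0 m1 m2 m3].
by case=> b0 b1 b2 b3; rewrite /qnormsq /=; ring.
Qed.

Definition hadj X : M2 :=
  mx2 (X 1 1) (- X 0 1) (- X 1 0) (X 0 0).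

Lemma mul_hadj X : herm X -> X * hadj X = rscale (hdet X) 1 /\
  hadj X * X = rscale (hdet X) 1.
Proof.
move=> /herm_eta ->; rewrite /hadj /hdet !mx2e mx2_one.
split; apply: mx2_ext; rewrite mul2E rscaleE !mx2e; apply: quatP;
  rewrite /qnormsq /=; ring.
Qed.

(** With the star denoting the conjugate transpose, A times A star is Hermitian
    and has an adjugate, and A star times this adjugate inverts A on the right;
    symmetrically on the left. *)
Lemma sqdet1_inv A : sqdet A = 1 -> exists2 B, mx_inverse A B & sqdet B = 1.
Proof.
move=> A1.
have [hr _] := mul_hadj (herm_star_mul A).
have [_ hl] : herm (star A * A) /\ hadj (star A * A) * (star A * A) = 1.
  have h : herm (star A * A) by rewrite -{2}(starK A); apply: herm_star_mul.
  have [_ ->] := mul_hadj h; split => //.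
  by rewrite -{2}(starK A) -sqdet_hdet sqdet_star A1 rscale1.
have {hr} : A * (star A * hadj (A * star A)) = 1.
  by rewrite mulrA hr -sqdet_hdet A1 rscale1.
set B := (X in A * X = 1) => AB.
have {}hl : (hadj (star A * A) * star A) * A = 1 by rewrite -mulrA.
have BE : B = hadj (star A * A) * star A.
  by rewrite -[RHS]mulr1 -AB mulrA hl mul1r.
exists B; first by split; [exact: AB|rewrite BE; exact: hl].
by have := sqdetM A B; rewrite AB sqdet1 A1 mul1r.
Qed.

Lemma mx_inverse_sym A B : mx_inverse A B -> mx_inverse B A.
Proof. by case. Qed.

Lemma mx_inverse_uniq A B C : mx_inverse A B -> mx_inverse A C -> B = C.
Proof. by move=> [_ h1] [h2 _]; rewrite -[LHS]mulr1 -h2 mulrA h1 mul1r. Qed.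

Lemma mx_inverseM A B A' B' : mx_inverse A A' -> mx_inverse B B' ->
  mx_inverse (A * B) (B' * A').
Proof.
move=> [h1 h2] [h3 h4]; split.
  by rewrite mulrA -(mulrA A) h3 mulr1.
by rewrite mulrA -(mulrA B') h2 mulr1.
Qed.

Lemma mx_inverse_sqdet A B : mx_inverse A B -> sqdet A = 1 -> sqdet B = 1.
Proof. by move=> [AB _] A1; have := sqdetM A B; rewrite AB sqdet1 A1 mul1r. Qed.

(* If the first row of A kills the second column of A^-1, the Schur complement
   of a is the inverse of d'. *)
Let inv_entry (a b c d b' d' : quat R) :
  sqdet (mx2 a b c d) = 1 -> a * b' + b * d' = 0 -> c * b' + d * d' = 1 ->
  `|d'| = `|a|.
Proof.
rewrite /sqdet !mx2e => D1 h0 h1.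
have [a0|a0] := eqVneq a 0.
  rewrite a0 normr0; move: D1 h0; rewrite a0 mul0r add0r.
  have [->|b0 _] := eqVneq b 0.
    move=> D1; suff : (1 : R) = 0 by move/eqP; rewrite oner_eq0.
    rewrite -D1; move: c d {D1 h1} => [c0 c1 c2 c3] [d0 d1 d2 d3].
    by rewrite /qnormsq /=; ring.
  by move/eqP; rewrite qmul_eq0 (negPf b0) /= => /eqP ->; rewrite normr0.
pose s := qnormsq a *: d - c * qconj a * b.
have sd : s * d' = qreal (qnormsq a).
  have -> : qreal (qnormsq a) = qnormsq a *: (c * b' + d * d').
    by rewrite h1; apply: quatP => /=; ring.
  have {}h0 : qconj a * (b * d') = - (qnormsq a *: b').
    rewrite (_ : b * d' = - (a * b')); last by apply/eqP; rewrite -addr_eq0 addrC h0.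
    by apply: quatP; rewrite /qnormsq /=; ring.
  rewrite /s mulrBl -!mulrA h0 scalerDr mulrN opprK qscaleAl2 qscaleAr2.
  by rewrite addrC.
have sn : qnormsq s = qnormsq a.
  transitivity (qnormsq a * 1); last by rewrite mulr1.
  rewrite -D1 /s; move: a b c d {s sd D1 h0 h1 a0}.
  move=> [a0 a1 a2 a3] [b0 b1 b2 b3] [c0 c1 c2 c3] [d0 d1 d2 d3].
  by rewrite /qnormsq /=; ring.
have n0 : `|a| != 0 by rewrite normr_eq0.
have : `|s| * `|d'| = `|a| ^+ 2.
  by rewrite -qnormM sd qnorm_real sqr_qnorm ger0_norm ?qnormsq_ge0.
by rewrite [`|s|]qnormE sn -qnormE expr2 => /(mulfI n0).
Qed.

(** Each entry of the inverse is the inverse of a Schur complement, whose norm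
    the determinant ties to the opposite entry. *)
Lemma inv_entry_norm A B : mx_inverse A B -> sqdet A = 1 ->
  [/\ `|B 0 0| = `|A 1 1|, `|B 0 1| = `|A 0 1|, `|B 1 0| = `|A 1 0|
    & `|B 1 1| = `|A 0 0|].
Proof.
move=> [AB _]; rewrite {1}(mx2_eta A).
have h i j : A i 0 * B 0 j + A i 1 * B 1 j = (1 : M2) i j by rewrite -mul2E AB.
have := (h 0 0, h 0 1, h 1 0, h 1 1); case: one2E => -> -> -> -> [[[]]].
move: (A 0 0) (A 0 1) (A 1 0) (A 1 1) (B 0 0) (B 0 1) (B 1 0) (B 1 1).
move=> a b c d a' b' c' d' h1 h2 h3 h4 D1.
split.
- apply: (@inv_entry d c b a c' a'); rewrite 1?addrC //; rewrite -D1 /sqdet !mx2e.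
  move: a b c d {D1 h1 h2 h3 h4}.
  move=> [a0 a1 a2 a3] [b0 b1 b2 b3] [c0 c1 c2 c3] [d0 d1 d2 d3].
  by rewrite /qnormsq /=; ring.
- apply: (@inv_entry b a d c d' b'); rewrite 1?addrC //; rewrite -D1 /sqdet !mx2e.
  move: a b c d {D1 h1 h2 h3 h4}.
  move=> [a0 a1 a2 a3] [b0 b1 b2 b3] [c0 c1 c2 c3] [d0 d1 d2 d3].
  by rewrite /qnormsq /=; ring.
- apply: (@inv_entry c d a b a' c') => //; rewrite -D1 /sqdet !mx2e.
  move: a b c d {D1 h1 h2 h3 h4}.
  move=> [a0 a1 a2 a3] [b0 b1 b2 b3] [c0 c1 c2 c3] [d0 d1 d2 d3].
  by rewrite /qnormsq /=; ring.
- exact: (@inv_entry a b c d b' d').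
Qed.

Lemma mxnorm_inv A B : mx_inverse A B -> sqdet A = 1 -> mxnorm B = mxnorm A.
Proof.
by move=> AB A1; rewrite /mxnorm; case: (inv_entry_norm AB A1) => -> -> -> ->;
  ring.
Qed.

Lemma sqdet_abs A : sqdet A = 1 ->
  `| `|A 0 0| * `|A 1 1| - `|A 0 1| * `|A 1 0| | <= 1 /\
  1 <= `|A 0 0| * `|A 1 1| + `|A 0 1| * `|A 1 0|.
Proof.
have := qre_le (qconj (A 0 0) * A 0 1 * qconj (A 1 1) * A 1 0).
rewrite !qnormM !qnorm_conj /sqdet -!sqr_qnorm ler_norml => /andP[h1 h2] D1.
have := (normr_ge0 (A 0 0), normr_ge0 (A 0 1), normr_ge0 (A 1 0),
  normr_ge0 (A 1 1)).
move: h1 h2 D1; move: (qre _) `|A 0 0| `|A 0 1| `|A 1 0| `|A 1 1|.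
move=> r a b c d h1 h2 D1 [[[a0 b0] c0] d0].
have ad := mulr_ge0 a0 d0; have bc := mulr_ge0 b0 c0.
split.
  rewrite -(@ler_pXn2r _ 2) ?nnegrE // expr1n sqr_norm_re; nra.
by rewrite -(@ler_pXn2r _ 2) ?nnegrE ?addr_ge0 // expr1n; nra.
Qed.

End Matrices.
(** * Topology of the matrix space *)

Section Topology.
Variable R : realType.
Local Notation M2 := 'M[quat R]_2.
Implicit Types A B : M2.
Implicit Type G : set M2.

Lemma nbhs_mxnorm A (V : set M2) :
  nbhs A V <-> exists2 e : R, 0 < e & forall B, mxnorm (B - A) < e -> V B.
Proof.
split.
  move=> [P hP sPV].
  have h i j : exists2 e : R, 0 < e & forall q, `|q - A i j| < e -> P i j q.
    have /nbhs_ballP[e /= e0 he] := hP i j; exists e => // q hq; apply: he.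
    by rewrite -ball_normE /= distrC.
  have [e1 p1 h1] := h 0 0; have [e2 p2 h2] := h 0 1.
  have [e3 p3 h3] := h 1 0; have [e4 p4 h4] := h 1 1.
  exists (Num.min (Num.min e1 e2) (Num.min e3 e4)).
    by rewrite !lt_min p1 p2 p3 p4.
  move=> B; rewrite !lt_min => /andP[/andP[b1 b2] /andP[b3 b4]]; apply: sPV => /=.
  have k i j : `|B i j - A i j| <= mxnorm (B - A).
    by have := mxnorm_entry (B - A) i j; rewrite !mxE.
  by apply: ord2P; apply: ord2P; [apply: h1|apply: h2|apply: h3|apply: h4];
    apply: le_lt_trans (k _ _) _.
move=> [e e0 he]; exists (fun i j => ball (A i j) (e / 4)).
  by move=> i j; apply: nbhsx_ballx; apply: divr_gt0.
move=> B /= hB; apply: he; rewrite /mxnorm !mxE.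
have k i j : `|B i j - A i j| < e / 4.
  by rewrite distrC; have := hB i j; rewrite -ball_normE.
by have := (k 0 0, k 0 1, k 1 0, k 1 1) => -[[[]]]; lra.
Qed.

Lemma mxnorm_mulV_lt A A' B (M : R) : mx_inverse A A' -> 0 < M ->
  mxnorm A' <= M -> forall e, mxnorm (B - A) < e / M -> mxnorm (A' * B - 1) < e.
Proof.
move=> [_ h] M0 hM e he; rewrite -h -mulrBr.
apply: le_lt_trans (mxnormM _ _) _.
rewrite ltr_pdivlMr // mulrC in he; apply: le_lt_trans he.
by apply: ler_wpM2r => //; apply: mxnorm_ge0.
Qed.

Lemma discreteP G : subgroup_SL2H G ->
  discrete_subset G <->
  exists2 e : R, 0 < e & forall k, G k -> mxnorm (k - 1) < e -> k = 1.
Proof.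
move=> [_ G1 GM GV]; split=> [dG|[e e0 he] A GA].
  have [_ [V /nbhs_mxnorm[e e0 he] VG]] := dG _ G1.
  exists e => // k Gk hk.
  have : (V `&` G) k by split=> //; apply: he.
  by rewrite VG.
split; first exact: mem_set.
have [B GB AB] := GV A GA.
exists [set k | mxnorm (B * k - 1) < e].
  have M0 : 0 < mxnorm B + 1 by rewrite ltr_wpDl // mxnorm_ge0.
  apply/nbhs_mxnorm; exists (e / (mxnorm B + 1)); first exact: divr_gt0.
  move=> k hk /=; apply: (mxnorm_mulV_lt AB M0) hk.
  by rewrite lerDl.
apply/seteqP; split=> k /=.
  move=> [hk Gk]; have BA1 := he _ (GM _ _ GB Gk) hk.
  by case: AB => AB _; rewrite -[RHS]mulr1 -BA1 mulrA AB mul1r.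
by move=> ->; case: AB => _ ->; rewrite subrr /mxnorm !mxE !normr0 !addr0.
Qed.

Definition coords A : seq R :=
  flatten [seq [:: qre q; qi q; qj q; qk q]
    | q <- [:: A 0 0; A 0 1; A 1 0; A 1 1]].

Let coord_le A k : `|nth 0 (coords A) k| <= mxnorm A.
Proof.
have h : all (fun x => `|x| <= mxnorm A) (coords A).
  have e i j : all (fun x => `|x| <= mxnorm A)
      [:: qre (A i j); qi (A i j); qj (A i j); qk (A i j)].
    have [h1 h2 h3 h4] := qcoord_le (A i j); have h := mxnorm_entry A i j.
    by rewrite /= !(le_trans _ h).
  move: (e 0 0) (e 0 1) (e 1 0) (e 1 1); rewrite /coords /=.
  by move=> /and5P[-> -> -> -> _] /and5P[-> -> -> -> _]
    /and5P[-> -> -> -> _] /and5P[-> -> -> -> _].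
have [ks|ks] := ltnP k (size (coords A)); first exact: (allP h _ (mem_nth 0 ks)).
by rewrite nth_default // normr0 mxnorm_ge0.
Qed.

(** Bolzano-Weierstrass, in the sixteen real coordinates *)
Lemma bounded_cluster (u : nat -> M2) (M : R) : (forall n, mxnorm (u n) <= M) ->
  exists L, forall e, 0 < e -> forall m, exists2 n, (m <= n)%N &
    mxnorm (u n - L) < e.
Proof.
move=> uM.
pose v n : 'rV[R]_16 := \row_k nth 0 (coords (u n)) k.
pose K := [set w : 'rV[R]_16 | forall i, w ord0 i \in `[- M, M]].
have cK : compact K.
  apply: (@rV_compact _ _ (fun=> `[- M, M]%classic)) => _; exact: segment_compact.
have vK : (v @ \oo) K.
  exists 0%N => // n _ i /=; rewrite /v mxE in_itv /= -ler_norml.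
  by apply: le_trans (uM n); apply: coord_le.
have [p [_ hp]] := cK _ _ vK.
pose c k := p ord0 (inord k).
exists (mx2 (Quat (c 0%N) (c 1%N) (c 2%N) (c 3%N))
  (Quat (c 4%N) (c 5%N) (c 6%N) (c 7%N))
  (Quat (c 8%N) (c 9%N) (c 10%N) (c 11%N))
  (Quat (c 12%N) (c 13%N) (c 14%N) (c 15%N))) => e e0 m.
have e1 : 0 < e / 17 by apply: divr_gt0.
have hm : (v @ \oo) [set v n | n in [set n | (m <= n)%N]].
  by exists m => // n /= mn; exists n.
have [_ [[n /= mn <-] hn]] := hp _ _ hm (nbhsx_ballx p _ e1).
exists n => //.
have h k : (k < 16)%N -> `|nth 0 (coords (u n)) k - c k| < e / 17.
  move=> k16; case: hn => _ /(_ ord0 (inord k)).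
  by rewrite mxE inordK // -ball_normE /= distrC.
have q x y z t (q : quat R) d : `|qre q - x| < d -> `|qi q - y| < d ->
    `|qj q - z| < d -> `|qk q - t| < d -> `|q - Quat x y z t| <= 4 * d.
  move=> h1 h2 h3 h4; apply: le_trans (qnorm_le_coord _) _ => /=.
  lra.
rewrite /mxnorm !mxE /=.
have := (q _ _ _ _ (u n 0 0) _ (h 0%N isT) (h 1%N isT) (h 2%N isT) (h 3%N isT),
  q _ _ _ _ (u n 0 1) _ (h 4%N isT) (h 5%N isT) (h 6%N isT) (h 7%N isT),
  q _ _ _ _ (u n 1 0) _ (h 8%N isT) (h 9%N isT) (h 10%N isT) (h 11%N isT),
  q _ _ _ _ (u n 1 1) _ (h 12%N isT) (h 13%N isT) (h 14%N isT) (h 15%N isT)).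
by move=> [[[h1 h2] h3] h4]; lra.
Qed.

End Topology.
(** * The hyperboloid model *)

Section Hyperboloid.
Variable R : realType.
Local Notation M2 := 'M[quat R]_2.
Implicit Types A B X Y : M2.

Definition positive X := [/\ herm X, 0 < qre (X 0 0) & 0 < hdet X].

Lemma positive11 X : positive X -> 0 < qre (X 1 1).
Proof.
move=> [_ x0]; rewrite /hdet => h; have n0 := qnormsq_ge0 (X 0 1).
by rewrite -(pmulr_rgt0 _ x0); lra.
Qed.

Lemma positive_of11 X : herm X -> 0 < qre (X 1 1) -> 0 < hdet X -> positive X.
Proof.
move=> hX y0 h; split=> //; have n0 := qnormsq_ge0 (X 0 1).
by rewrite -(pmulr_lgt0 _ y0); move: h; rewrite /hdet; lra.
Qed.

Lemma positive1 : positive (1 : M2).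
Proof. by split; [exact: herm1|rewrite mxE /=|rewrite hdet1]. Qed.

Lemma positive_rscale x X : 0 < x -> positive X -> positive (rscale x X).
Proof.
move=> x0 [h1 h2 h3]; split; first exact: herm_rscale.
  by rewrite rscaleE /= mulr_gt0.
rewrite (_ : hdet _ = x ^+ 2 * hdet X) ?mulr_gt0 ?exprn_gt0 //.
by rewrite /hdet !rscaleE /qnormsq /=; ring.
Qed.

Lemma hdet_rscale x X : hdet (rscale x X) = x ^+ 2 * hdet X.
Proof. by rewrite /hdet !rscaleE /qnormsq /=; ring. Qed.

Lemma rscaleNl x X : rscale (- x) X = - rscale x X.
Proof. by apply/matrixP => i j; rewrite !mxE scaleNr. Qed.

(** The polar form of hdet *)
Definition hform X Y : R :=
  (qre (X 0 0) * qre (Y 1 1) + qre (Y 0 0) * qre (X 1 1)) / 2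
  - qre (X 0 1 * qconj (Y 0 1)).

Lemma hform_diag X : hform X X = hdet X.
Proof. by rewrite /hform /hdet /qnormsq /=; field. Qed.

Lemma hformC X Y : hform X Y = hform Y X.
Proof. by rewrite /hform /=; ring. Qed.

Lemma hformDr X Y Z : hform X (Y + Z) = hform X Y + hform X Z.
Proof. by rewrite /hform !mxE /=; field. Qed.

Lemma hformZr X x Y : hform X (rscale x Y) = x * hform X Y.
Proof. by rewrite /hform !mxE /=; field. Qed.

(** Signature (1, 5): the orthogonal complement of a positive matrix is
    negative definite. *)
Lemma hform_definite X Y : positive X -> herm Y -> hform X Y = 0 ->
  0 <= hdet Y -> Y = 0.
Proof.
move=> pX hY; have y0 := positive11 pX; case: pX => hX x0.
rewrite /hform /hdet => d0.
have := qre_le (X 0 1 * qconj (Y 0 1)); rewrite qnormM qnorm_conj => hr.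
have {hr} : qre (X 0 1 * qconj (Y 0 1)) ^+ 2 <= qnormsq (X 0 1) * qnormsq (Y 0 1).
  by rewrite -!sqr_qnorm -exprMn -sqr_norm_re ler_pXn2r ?nnegrE ?mulr_ge0.
have nX := qnormsq_ge0 (X 0 1); have nY := qnormsq_ge0 (Y 0 1).
suff : forall x y n p q m r : R, 0 < x -> 0 < y -> 0 < x * y - n -> 0 <= n ->
    0 <= m -> r ^+ 2 <= n * m -> (x * q + p * y) / 2 - r = 0 ->
    0 <= p * q - m -> [/\ p = 0, q = 0 & m = 0].
  move=> H hr h1 h2; have [p0 q0 m0] := H _ _ _ _ _ _ _ x0 y0 d0 nX nY hr h1 h2.
  have w0 : Y 0 1 = 0 by apply/eqP; rewrite -qnormsq_eq0 m0.
  rewrite (herm_eta hY) p0 q0 w0; apply: mx2_ext; rewrite mx2e !mxE //.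
  by apply: quatP; rewrite //= oppr0.
move=> {X Y hX hY x0 y0 d0 nX nY} x y n p q m r x0 y0 d0 n0 m0 h1 h2 h3.
have r2 : r = (x * q + p * y) / 2 by lra.
have pq : p * q = 0.
  apply/eqP; rewrite eq_le; apply/andP; split; last by lra.
  rewrite -(@pmulr_rle0 _ (x * y - n)) //.
  have := sqr_ge0 (x * q - p * y); rewrite r2 in h1.
  have : n * m <= n * (p * q) by rewrite ler_wpM2l //; lra.
  nra.
have m1 : m = 0 by lra.
rewrite m1 mulr0 in h1.
have r0 : r = 0 by apply/eqP; rewrite -sqrf_eq0 eq_le h1 sqr_ge0.
have xq : x * q + p * y = 0 by lra.
split=> //.
  have : y * p ^+ 2 = 0 by nra.
  by move/eqP; rewrite mulf_eq0 (gt_eqF y0) /= sqrf_eq0 => /eqP.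
have : x * q ^+ 2 = 0 by nra.
by move/eqP; rewrite mulf_eq0 (gt_eqF x0) /= sqrf_eq0 => /eqP.
Qed.

Lemma herm_row_pos X (a b : quat R) : positive X -> (a != 0) || (b != 0) ->
  0 < qre (a * X 0 0 * qconj a + b * X 1 0 * qconj a + a * X 0 1 * qconj b
           + b * X 1 1 * qconj b).
Proof.
move=> pX ab; have y0 := positive11 pX; case: pX => hX x0 d0.
rewrite -(pmulr_rgt0 _ x0).
have -> : qre (X 0 0) * qre (a * X 0 0 * qconj a + b * X 1 0 * qconj a
    + a * X 0 1 * qconj b + b * X 1 1 * qconj b) =
    qnormsq (qre (X 0 0) *: qconj a + X 0 1 * qconj b) + hdet X * qnormsq b.
  rewrite /hdet; case/hermP: hX => -> -> -> /=; rewrite /qnormsq /=; ring.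
have n0 := qnormsq_ge0 (qre (X 0 0) *: qconj a + X 0 1 * qconj b).
have [b0|b0] := eqVneq b 0; last first.
  by rewrite ltr_wpDl // mulr_gt0 // lt_def qnormsq_ge0 qnormsq_eq0 b0.
move: ab; rewrite b0 eqxx orbF => a0.
have -> : qnormsq (0 : quat R) = 0 by apply/eqP; rewrite qnormsq_eq0.
rewrite mulr0 addr0 lt_def qnormsq_ge0 andbT qnormsq_eq0.
have -> : qconj (0 : quat R) = 0 by apply: quatP; rewrite //= oppr0.
rewrite mulr0 addr0 scaler_eq0 negb_or gt_eqF //= -normr_eq0 qnorm_conj.
by rewrite normr_eq0.
Qed.

Lemma positive_conj A X : sqdet A != 0 -> positive X ->
  positive (A * X * star A).
Proof.
move=> A0 pX; have [hX _ d0] := pX; apply: positive_of11; first exact: herm_conj.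
  rewrite !mul2E !starE !mulrDl !addrA; apply: herm_row_pos => //.
  rewrite -negb_and; apply: contra A0 => /andP[/eqP c0 /eqP e0].
  apply/eqP; rewrite (mx2_eta A) c0 e0 /sqdet !mx2e.
  by move: (A 0 0) (A 0 1) => [a0 a1 a2 a3] [b0 b1 b2 b3]; rewrite /qnormsq /=; ring.
by rewrite hdet_conj // mulr_gt0 // lt_def A0 sqdet_ge0.
Qed.

Lemma herm_eq X Y : herm X -> herm Y -> hdet X = hdet Y -> X 0 1 = Y 0 1 ->
  X 1 1 = Y 1 1 -> qre (Y 1 1) != 0 -> X = Y.
Proof.
move=> hX hY; rewrite /hdet => hd h01 h11 y0.
rewrite (herm_eta hX) (herm_eta hY) h01 h11; congr (mx2 (qreal _) _ _ _).
apply: (mulIf y0); move: hd; rewrite h01 h11; lra.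
Qed.

(** The point (z, t) of the upper half-space as a positive matrix of
    determinant 1 *)
Definition embed (p : quat R * R) : M2 :=
  rscale p.2^-1 (mx2 (qreal (qnormsq p.1 + p.2 ^+ 2)) p.1 (qconj p.1) 1).

Lemma embedE p : [/\ embed p 0 0 = qreal (p.2^-1 * (qnormsq p.1 + p.2 ^+ 2)),
  embed p 0 1 = p.2^-1 *: p.1, embed p 1 0 = p.2^-1 *: qconj p.1 &
  embed p 1 1 = qreal p.2^-1].
Proof.
by split; rewrite rscaleE mx2e //; apply: quatP; rewrite /= ?mulr0 ?mulr1.
Qed.

Lemma herm_embed p : herm (embed p).
Proof. by apply: herm_rscale; rewrite -/(qreal 1); apply: mx2_hermP. Qed.

Lemma hdet_embed p : H5 p -> hdet (embed p) = 1.
Proof.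
rewrite /H5 /= => t0; have t1 : p.2 != 0 by rewrite gt_eqF.
case: (embedE p) => h1 h2 h3 h4; rewrite /hdet h1 h2 h4 /qnormsq /=.
by field.
Qed.

Lemma positive_embed p : H5 p -> positive (embed p).
Proof.
move=> hp; apply: positive_of11; first exact: herm_embed.
  by case: (embedE p) => _ _ _ -> /=; rewrite invr_gt0.
by rewrite hdet_embed.
Qed.

Lemma embed_inj p q : H5 p -> H5 q -> embed p = embed q -> p = q.
Proof.
case: p q => [z t] [w s]; rewrite /H5 /= => t0 s0 e.
have [_ a1 _ a2] := embedE (z, t); have [_ b1 _ b2] := embedE (w, s).
have ts : t = s.
  by move: a2; rewrite e b2 => -[] /(congr1 GRing.inv); rewrite !invrK.
move: a1; rewrite e b1 /= ts => /(congr1 (fun x => s *: x)).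
by rewrite !scalerA mulfV ?gt_eqF // !scale1r => ->.
Qed.

Lemma embed_onto X : positive X -> hdet X = 1 -> exists2 p, H5 p & embed p = X.
Proof.
move=> pX d1; have y0 := positive11 pX; have [hX _ _] := pX.
exists ((qre (X 1 1))^-1 *: X 0 1, (qre (X 1 1))^-1).
  by rewrite /H5 /= invr_gt0.
case: (embedE ((qre (X 1 1))^-1 *: X 0 1, (qre (X 1 1))^-1)) => /= _ h2 _ h4.
apply: herm_eq => //; first exact: herm_embed.
- by rewrite d1 hdet_embed // /H5 /= invr_gt0.
- by rewrite h2 invrK scalerA mulfV ?scale1r // gt_eqF.
- by rewrite h4 invrK; case/hermP: hX => _ <-.
- by rewrite gt_eqF.
Qed.

Lemma embed_poincare A p : sqdet A = 1 -> H5 p ->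
  H5 (poincare A p) /\ embed (poincare A p) = A * embed p * star A.
Proof.
move=> A1 hp; have pP : positive (A * embed p * star A).
  by apply: positive_conj; rewrite ?A1 ?oner_neq0 //; apply: positive_embed.
have t0 : p.2 != 0 by rewrite gt_eqF.
set Y := A * embed p * star A in pP *.
set N := `|A 1 0 * p.1 + A 1 1| ^+ 2 + `|A 1 0| ^+ 2 * p.2 ^+ 2.
have [hY _ dY] := pP.
have Y11 : Y 1 1 = qreal (p.2^-1 * N).
  rewrite /N !sqr_qnorm /Y !mul2E !starE; case: (embedE p) => -> -> -> ->.
  move: (A 1 0) (A 1 1) p.1 t0 => [c0 c1 c2 c3] [d0 d1 d2 d3] [z0 z1 z2 z3] t0.
  by apply: quatP; rewrite /qnormsq /=; field.
have N0 : 0 < N.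
  have := positive11 pP; rewrite Y11 /= pmulr_rgt0 // invr_gt0; exact: hp.
have hq : H5 (poincare A p) by rewrite /H5 /= mulr_gt0 ?invr_gt0.
have Nn : N != 0 by rewrite gt_eqF.
split=> //; apply: herm_eq; rewrite ?Y11 //=.
- exact: herm_embed.
- by rewrite hdet_embed // /Y hdet_conj ?A1 ?hdet_embed ?mulr1 //; apply: herm_embed.
- case: (embedE (poincare A p)) => _ -> _ _; rewrite /poincare /= -/N.
  rewrite invrM ?unitfE ?invr_eq0 // invrK scalerA.
  rewrite -mulrA mulfV // mulr1 /Y !mul2E !starE; case: (embedE p) => -> -> -> ->.
  move: (A 0 0) (A 0 1) (A 1 0) (A 1 1) p.1 {Y pP hY dY Y11 N N0 Nn hq A1 hp}.
  move=> [a0 a1 a2 a3] [b0 b1 b2 b3] [c0 c1 c2 c3] [d0 d1 d2 d3] [z0 z1 z2 z3].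
  by apply: quatP; rewrite /qnormsq /=; field.
- case: (embedE (poincare A p)) => _ _ _ -> /=.
  by rewrite -/N invrM ?unitfE ?invr_eq0 // invrK.
- by rewrite mulf_neq0 // invr_neq0.
Qed.

Lemma fixed_embed A p : sqdet A = 1 -> H5 p ->
  poincare A p = p <-> A * embed p * star A = embed p.
Proof.
move=> A1 hp; have [h1 h2] := embed_poincare A1 hp.
by rewrite -h2; split=> [->//|]; apply: embed_inj.
Qed.

Lemma positive_normalize X : positive X ->
  exists2 p, H5 p & exists2 r, 0 < r & X = rscale r (embed p).
Proof.
move=> pX; have [_ _ d0] := pX; pose r := Num.sqrt (hdet X).
have r0 : 0 < r by rewrite sqrtr_gt0.
have pY : positive (rscale r^-1 X) by apply: positive_rscale; rewrite ?invr_gt0.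
have [|p hp e] := embed_onto pY.
  by rewrite hdet_rscale exprVn sqr_sqrtr ?mulVf ?gt_eqF // ltW.
by exists p => //; exists r => //; rewrite e rscaleA mulfV ?rscale1 // gt_eqF.
Qed.

(** The right-hand side is the hyperbolic cosine of the distance. *)
Lemma hform_embed p q : H5 p -> H5 q -> hform (embed p) (embed q) =
  1 + (`|p.1 - q.1| ^+ 2 + (p.2 - q.2) ^+ 2) / (2 * p.2 * q.2).
Proof.
rewrite /H5 /= => hp hq.
have p0 : p.2 != 0 by rewrite gt_eqF.
have q0 : q.2 != 0 by rewrite gt_eqF.
case: (embedE p) (embedE q) => h1 h2 h3 h4 [k1 k2 k3 k4].
rewrite /hform h1 h2 h4 k1 k2 k4 sqr_qnorm /qnormsq /=.
by field; rewrite p0 q0.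
Qed.

Lemma arcoshE (x : R) : 1 <= x ->
  (expR (arcosh x) + (expR (arcosh x))^-1) / 2 = x.
Proof.
move=> x1; rewrite /arcosh; set s := Num.sqrt _.
have s2 : s ^+ 2 = x ^+ 2 - 1 by rewrite sqr_sqrtr // subr_ge0 expr_ge1 // (le_trans ler01).
have s0 : 0 <= s by apply: sqrtr_ge0.
have xs : 0 < x + s by lra.
rewrite lnK ?posrE //.
suff -> : (x + s)^-1 = x - s by field.
apply: (mulfI (lt0r_neq0 xs)); rewrite mulfV ?lt0r_neq0 //.
by rewrite mulrC -subr_sqr s2; ring.
Qed.

Lemma hform_geodesic gamma s t : geodesic_line gamma ->
  hform (embed (gamma s)) (embed (gamma t)) =
  (expR s / expR t + expR t / expR s) / 2 :> R.
Proof.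
move=> [gH gD].
have hs : H5 (gamma s) by apply: gH; exists s.
have ht : H5 (gamma t) by apply: gH; exists t.
have x1 : 1 <= hform (embed (gamma s)) (embed (gamma t)).
  rewrite hform_embed // lerDl divr_ge0 //; last by rewrite !mulr_ge0 // ltW.
  by rewrite addr_ge0 ?sqr_ge0.
rewrite -(arcoshE x1) (hform_embed hs ht) -/(hdist _ _) gD.
have es := expR_gt0 s; have et := expR_gt0 t.
have [st|st] := leP 0 (s - t).
  by rewrite ger0_norm // expRB invf_div.
by rewrite ltr0_norm // opprB expRB invf_div addrC.
Qed.

(** Geodesics are plane sections: by the addition formulas the three Gram
    vectors are linearly dependent. *)
Lemma geodesic_span gamma s1 s2 s3 : geodesic_line gamma -> s1 != s2 ->
  exists a b, embed (gamma s3) =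
    rscale a (embed (gamma s1)) + rscale b (embed (gamma s2)).
Proof.
move=> gl s12.
have E := hform_geodesic _ _ gl.
have p1 := positive_embed (gl.1 _ (ex_intro2 _ _ s1 I erefl)).
pose u := expR s1; pose v := expR s2; pose w := expR s3.
have u0 : 0 < u by apply: expR_gt0.
have v0 : 0 < v by apply: expR_gt0.
have w0 : 0 < w by apply: expR_gt0.
have u1 := lt0r_neq0 u0; have v1 := lt0r_neq0 v0; have w1 := lt0r_neq0 w0.
have uv : u ^+ 2 - v ^+ 2 != 0.
  rewrite subr_sqr mulf_neq0 //; last by rewrite gt_eqF // addr_gt0.
  by rewrite subr_eq0; apply: contra s12 => /eqP/expR_inj ->.
have vu : v ^+ 2 - u ^+ 2 != 0 by rewrite -oppr_eq0 opprB.
pose a := (u / w) * (w ^+ 2 - v ^+ 2) / (u ^+ 2 - v ^+ 2).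
pose b := (v / w) * (w ^+ 2 - u ^+ 2) / (v ^+ 2 - u ^+ 2).
exists a, b.
set X1 := embed (gamma s1); set X2 := embed (gamma s2).
pose Y := embed (gamma s3) + (rscale (- a) X1 + rscale (- b) X2).
have O s : hform (embed (gamma s)) Y = 0.
  rewrite /Y !hformDr (hformZr _ (- a)) (hformZr _ (- b)) /X1 /X2 !E -/u -/v -/w /a /b.
  have x1 := lt0r_neq0 (expR_gt0 s); move: (expR s) x1 => x x1.
  by field; rewrite ?u1 ?v1 ?w1 ?uv ?vu ?x1.
have /eqP : Y = 0.
  apply: (hform_definite p1) => //.
    by apply: hermD; [|apply: hermD; apply: herm_rscale]; apply: herm_embed.
  rewrite -hform_diag {2}/Y !hformDr (hformZr _ (- a)) (hformZr _ (- b)).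
  by rewrite /X1 /X2 !(hformC Y) !O !mulr0 !addr0.
by rewrite /Y addr_eq0 opprD -!rscaleNl !opprK => /eqP.
Qed.

End Hyperboloid.
(** * Zariski-density as a linear irreducibility *)

Section Irreducibility.
Variable R : realType.
Local Notation M2 := 'M[quat R]_2.
Local Notation V2 := 'M[quat R]_(2, 1).
Implicit Types A B X Y : M2.
Implicit Types (v w : V2) (k : 'M[quat R]_1).
Implicit Type G : set M2.

(** Boundary points are the right quaternionic lines of H^2; v spans a line
    fixed by A when it is a right eigenvector. *)
Definition eigvec A v : Prop := exists k, A *m v = v *m k.

(** The three consequences of Zariski-density that the proof uses. Unlike the
    definition, they speak of linear actions only, hence pass to conjugates. *)
Definition irreducible G : Prop := [/\
  ~ (exists2 X, positive X & forall A, G A -> A * X * star A = X),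
  forall v, v != 0 -> exists2 A, G A & ~ eigvec A v &
  forall W : set M2, (forall X Y, W X -> W Y -> W (X + Y)) ->
    (forall x X, W X -> W (rscale x X)) ->
    (forall A X, G A -> W X -> W (A * X * star A)) ->
    (exists2 X, positive X & W X) -> forall X, herm X -> W X].

Definition colq (x y : quat R) : V2 := \matrix_(i, j) if i == 0 then x else y.

Lemma colqE x y : (colq x y 0 0 = x) * (colq x y 1 0 = y).
Proof. by rewrite !mxE. Qed.

Lemma col_ext v w : v 0 0 = w 0 0 -> v 1 0 = w 1 0 -> v = w.
Proof.
move=> h0 h1; apply/matrixP; apply: ord2P => j; rewrite (ord1 j) //.
Qed.

Lemma colq_eta v : v = colq (v 0 0) (v 1 0).
Proof. by apply: col_ext; rewrite colqE. Qed.

Lemma mul_col_k v k i : (v *m k) i 0 = v i 0 * k 0 0.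
Proof. by rewrite mxE big_ord_recl big_ord0 addr0; congr (v i _ * k _ _); apply: val_inj. Qed.

Lemma eigvec_colq A x y : eigvec A (colq x y) <->
  exists c : quat R, A 0 0 * x + A 0 1 * y = x * c /\
    A 1 0 * x + A 1 1 * y = y * c.
Proof.
split=> [[k e]|[k [h0 h1]]].
  have h i : (A *m colq x y) i 0 = (colq x y *m k) i 0 by rewrite e.
  by exists (k 0 0); have := (h 0, h 1); rewrite !mulmx2E !mul_col_k !colqE => -[].
by exists (k%:M); apply: col_ext; rewrite mulmx2E mul_col_k !colqE mxE.
Qed.

Lemma eigvec_scale A v k : k 0 0 != 0 -> eigvec A (v *m k) <-> eigvec A v.
Proof.
move=> k0; pose k' : 'M[quat R]_1 := ((k 0 0)^-1)%:M.
have kE : k = (k 0 0)%:M by apply/matrixP => i j; rewrite !ord1 mxE.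
have kk : k *m k' = 1%:M by rewrite kE -scalar_mxM qmulV.
have k'k : k' *m k = 1%:M by rewrite kE -scalar_mxM qmulVl.
split=> -[m e].
  exists (k *m m *m k'); rewrite -[LHS]mulmx1 -kk !mulmxA.
  by rewrite -(mulmxA A v k) e.
by exists (k' *m m *m k); rewrite mulmxA e -!mulmxA (mulmxA k) kk mul1mx.
Qed.

Lemma eigvec_conj P Q A v : mx_inverse P Q ->
  eigvec (Q * A * P) v <-> eigvec A (P *m v).
Proof.
move=> [PQ QP]; split=> -[k e]; exists k.
  rewrite -mulmxA -e !mulmxA.
  by rewrite (_ : P *m Q = 1%:M) ?mul1mx.
by rewrite -!mulmxA e !mulmxA (_ : Q *m P = 1%:M) ?mul1mx.
Qed.

Definition homog (z : option (quat R)) : V2 :=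
  if z is Some z' then colq z' 1 else colq 1 0.

Lemma homog_onto v : v != 0 -> exists z k, k 0 0 != 0 /\ v = homog z *m k.
Proof.
move=> v0; have [y0|y0] := eqVneq (v 1 0) 0; last first.
  exists (Some (v 0 0 * (v 1 0)^-1)), ((v 1 0)%:M); rewrite mxE; split=> //.
  apply: col_ext; rewrite mul_col_k !colqE !mxE /= ?mul1r //.
  by rewrite -mulrA qmulVl // mulr1.
exists None, ((v 0 0)%:M); rewrite mxE; split.
  by apply: contra v0 => /eqP x0; apply/eqP/col_ext; rewrite mxE.
by apply: col_ext; rewrite mul_col_k !colqE !mxE /= ?mul1r // mul0r.
Qed.

Lemma homog_neq0 z : homog z != 0.
Proof.
apply/eqP; case: z => [z|] /= /matrixP h.
  by have := h 1 0; rewrite !mxE => /eqP; rewrite oner_eq0.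
by have := h 0 0; rewrite !mxE => /eqP; rewrite oner_eq0.
Qed.

Lemma sqdet_row1 A : sqdet A = 1 -> forall x y : quat R,
  A 0 0 * x + A 0 1 * y = 0 -> A 1 0 * x + A 1 1 * y = 0 -> x = 0 /\ y = 0.
Proof.
move=> /sqdet1_inv[B [_ BA] _] x y h0 h1.
suff : colq x y = 0.
  by move/matrixP => h; have := (h 0 0, h 1 0); rewrite !colqE !mxE => -[].
rewrite -[LHS]mul1mx -[1%:M]BA -mulmxA (_ : A *m _ = 0) ?mulmx0 //.
by apply: col_ext; rewrite mulmx2E !colqE mxE.
Qed.

Lemma mobius_fixed A z : sqdet A = 1 -> mobius A z = z <-> eigvec A (homog z).
Proof.
move=> A1; case: z => [z|] /=; rewrite eigvec_colq ?mulr1 ?mulr0 ?addr0.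
  have [cz|cz] := eqVneq (A 1 0 * z + A 1 1) 0.
    split=> // -[k [h0 h1]]; move: h0 h1; rewrite mul1r cz => h0 k0.
    have [] := sqdet_row1 A1 (x := z) (y := 1).
    - by rewrite mulr1 h0 -k0 mulr0.
    - by rewrite mulr1.
    by move=> _ /eqP; rewrite oner_eq0.
  split=> [[h]|[k [h0 h1]]].
    exists (A 1 0 * z + A 1 1); rewrite mul1r; split=> //.
    by rewrite -[LHS]mulr1 -(qmulVl cz) mulrA h.
  by rewrite h0 h1 mul1r -mulrA; move: cz; rewrite h1 mul1r => cz; rewrite qmulV // mulr1.
have [c0|c0] := eqVneq (A 1 0) 0.
  by split=> // _; exists (A 0 0); rewrite mul1r mul0r.
by split=> // -[k [_ h]]; move: c0; rewrite h mul0r eqxx.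
Qed.

(** By [geodesic_span], a linear subspace containing two points of a geodesic
    contains the whole geodesic. *)
Lemma totally_geodesic_section (W : set M2) :
  (forall X Y, W X -> W Y -> W (X + Y)) ->
  (forall x X, W X -> W (rscale x X)) ->
  (exists2 p, H5 p & W (embed p)) ->
  totally_geodesic [set p | H5 p /\ W (embed p)].
Proof.
move=> WD WZ [p hp Wp]; split.
- by exists p.
- by move=> q [].
move=> a b gamma [_ Wa] [_ Wb] ab gl [s _ sa] [t _ tb] _ [r _ <-].
have [gH _] := gl; split; first by apply: gH; exists r.
have st : s != t by apply: contra ab => /eqP st; rewrite -sa -tb st.
have [x [y ->]] := geodesic_span r gl st.
by rewrite sa tb; apply: WD; apply: WZ.
Qed.

Lemma mx_inverse_star A B : mx_inverse A B -> mx_inverse (star B) (star A).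
Proof. by move=> [h1 h2]; split; rewrite -starM ?h1 ?h2 star1. Qed.

Lemma herm_conjK A B X : mx_inverse A B ->
  B * (A * X * star A) * star B = X.
Proof.
move=> AB; have [_ h1] := AB; have [_ h2] := mx_inverse_star AB.
by rewrite -!mulrA h2 mulr1 mulrA h1 mul1r.
Qed.

Lemma herm_shift X : herm X -> exists2 c, 0 < c & positive (X + rscale c 1).
Proof.
move=> hX; pose c := 1 + `|qre (X 0 0)| + `|qre (X 1 1)| + `|X 0 1|.
have := (normr_ge0 (qre (X 0 0)), normr_ge0 (qre (X 1 1)), normr_ge0 (X 0 1)).
move=> [[n1 n2] n3].
have c0 : 0 < c by rewrite /c; lra.
exists c => //.
have h1 : 1 + `|X 0 1| <= qre (X 0 0) + c.
  by have := ler_norm (- qre (X 0 0)); rewrite normrN /c; lra.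
have h2 : 1 + `|X 0 1| <= qre (X 1 1) + c.
  by have := ler_norm (- qre (X 1 1)); rewrite normrN /c; lra.
have e00 : qre ((X + rscale c 1) 0 0) = qre (X 0 0) + c.
  by rewrite !mxE /= mulr1.
have e11 : qre ((X + rscale c 1) 1 1) = qre (X 1 1) + c.
  by rewrite !mxE /= mulr1.
have e01 : (X + rscale c 1) 0 1 = X 0 1 by rewrite !mxE /= scaler0 addr0.
split.
- by apply: hermD => //; apply: herm_rscale; exact: herm1.
- by rewrite e00; lra.
by rewrite /hdet e00 e11 e01 -sqr_qnorm; nra.
Qed.

(** Every Hermitian matrix is a difference of positive ones. *)
Lemma sub_full (W : set M2) :
  (forall X Y, W X -> W Y -> W (X + Y)) ->
  (forall x X, W X -> W (rscale x X)) ->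
  (forall p, H5 p -> W (embed p)) -> forall X, herm X -> W X.
Proof.
move=> WD WZ WE X hX.
have Wpos Y : positive Y -> W Y.
  by move=> /positive_normalize[p hp [r _ ->]]; apply: WZ; apply: WE.
have [c c0 pX] := herm_shift hX.
have -> : X = (X + rscale c 1) + rscale (- c) 1 by rewrite rscaleNl addrK.
by apply: WD; [apply: Wpos|apply: WZ; apply: Wpos; exact: positive1].
Qed.

(** An invariant linear subspace with a positive element meets hyperbolic space
    in an invariant totally geodesic subspace; invariant lines of H^2 are fixed
    points at infinity. *)
Lemma zariski_dense_irreducible G : subgroup_SL2H G -> zariski_dense G ->
  irreducible G.
Proof.
move=> [GS G1 GM GV] [no_pt no_bd no_geod].
have S1 A : G A -> sqdet A = 1 by move=> /GS /SL2H_sqdet.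
split.
- move=> [X /positive_normalize[p hp [r r0 ->]] XG]; apply: no_pt.
  exists p => // A GA; apply/fixed_embed; rewrite ?S1 //.
  have := XG _ GA; rewrite rscaleAr rscaleAl; apply: rscale_inj.
  exact: lt0r_neq0.
- move=> v v0; apply: contrapT => h; apply: no_bd.
  have [z [k [k0 vE]]] := homog_onto v0; exists z => A GA.
  apply/mobius_fixed; first exact: S1.
  apply/(eigvec_scale _ _ k0); rewrite -vE; apply: contrapT => e; apply: h.
  by exists A.
move=> W WD WZ WG [X pX WX].
have [p hp [r r0 XE]] := positive_normalize pX.
have Wp : W (embed p).
  have -> : embed p = rscale r^-1 X by rewrite XE rscaleA mulVf ?rscale1 ?lt0r_neq0.
  exact: WZ.
apply: sub_full => // q hq; apply: contrapT => Wq.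
have WP A a : G A -> H5 a -> W (embed a) ->
    H5 (poincare A a) /\ W (embed (poincare A a)).
  move=> GA ha Wa; have [h1 h2] := embed_poincare (S1 _ GA) ha; split=> //.
  by rewrite h2; apply: WG.
apply: no_geod; exists [set p | H5 p /\ W (embed p)]; split.
- by apply: totally_geodesic_section => //; exists p.
- by move=> e; have : H5 q by []; rewrite -e => -[].
move=> A GA; apply/seteqP; split=> [_ [a [ha Wa] <-]|a [ha Wa]].
  exact: WP.
have [B GB AB] := GV A GA; exists (poincare B a); first exact: WP.
have [h1 h2] := embed_poincare (S1 _ GB) ha.
have [h3 h4] := embed_poincare (S1 _ GA) h1.
apply: embed_inj => //; rewrite h4 h2; apply: herm_conjK.
exact: mx_inverse_sym.
Qed.

(** Conjugation by P, seen from the frame whose columns are those of P *)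
Definition conjset (P Q : M2) G : set M2 := [set A | G (P * A * Q)].

Lemma conjset_mem P Q G A : mx_inverse P Q -> G A -> conjset P Q G (Q * A * P).
Proof.
move=> [PQ QP] GA; rewrite /conjset /= !mulrA PQ mul1r -mulrA PQ mulr1 //.
Qed.

Lemma conjsetK P Q A : mx_inverse P Q -> Q * (P * A * Q) * P = A.
Proof. by move=> [_ QP]; rewrite !mulrA QP mul1r -mulrA QP mulr1. Qed.

Lemma subgroup_conjset P Q G : sqdet P = 1 -> mx_inverse P Q ->
  subgroup_SL2H G -> subgroup_SL2H (conjset P Q G).
Proof.
move=> P1 PQ [GS G1 GM GV]; have Q1 := mx_inverse_sqdet PQ P1.
have [h1 h2] := PQ; split.
- move=> A /GS /SL2H_sqdet; rewrite !sqdetM P1 Q1 mulr1 mul1r => ?.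
  exact/SL2H_sqdet.
- by rewrite /conjset /= mulr1 h1.
- move=> A B /GM h /h; rewrite /conjset /=.
  by rewrite -!mulrA (mulrA Q) h2 mul1r !mulrA.
move=> A GA; have [B GB AB] := GV _ GA; exists (Q * B * P).
  exact: conjset_mem.
rewrite -(conjsetK A PQ); move: (P * A * Q) AB => X [XB BX]; split.
  by rewrite !mulrA -(mulrA (Q * X)) h1 mulr1 -(mulrA Q) XB mulr1 h2.
by rewrite !mulrA -(mulrA (Q * B)) h1 mulr1 -(mulrA Q) BX mulr1 h2.
Qed.

Lemma conj_star_mul P Q A X : mx_inverse P Q ->
  A * (P * X * star P) * star A =
  P * ((Q * A * P) * X * star (Q * A * P)) * star P.
Proof.
move=> [PQ QP]; have PQs : star Q * star P = 1 by rewrite -starM PQ star1.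
rewrite !starM !mulrA PQ mul1r -[in RHS]mulrA PQs mulr1.
by rewrite -!mulrA.
Qed.

Lemma irreducible_conjset P Q G : sqdet P = 1 -> mx_inverse P Q ->
  irreducible G -> irreducible (conjset P Q G).
Proof.
move=> P1 PQ [I1 I2 I3]; have QP := mx_inverse_sym PQ.
have P0 : sqdet P != 0 by rewrite P1 oner_neq0.
split.
- move=> [X pX XG]; apply: I1; exists (P * X * star P).
    exact: positive_conj.
  move=> A GA; rewrite (conj_star_mul _ _ PQ) XG //.
  exact: conjset_mem.
- move=> v v0; have [|A GA nA] := I2 (P *m v).
    apply: contra v0 => /eqP Pv; apply/eqP; case: PQ => _ h.
    by rewrite -[LHS]mul1mx -[1%:M]h -mulmxA Pv mulmx0.
  exists (Q * A * P); first exact: conjset_mem.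
  by move/(eigvec_conj _ _ PQ).
move=> W WD WZ WG [X pX WX] Y hY.
have QPs := mx_inverse_star QP.
have e Z : Q * (P * Z * star P) * star Q = Z by apply: herm_conjK.
rewrite -(e Y); apply: (I3 [set Z | W (Q * Z * star Q)]) => /=.
- by move=> Z T hZ hT; rewrite mulrDr mulrDl; apply: WD.
- by move=> x Z hZ; rewrite rscaleAr rscaleAl; apply: WZ.
- move=> A Z GA hZ.
  have -> : A * Z * star A = P * (Q * A * P * (Q * Z * star Q) *
      star (Q * A * P)) * star P.
    by rewrite -conj_star_mul // (herm_conjK _ QP).
  by rewrite e; apply: WG => //; apply: conjset_mem.
- by exists (P * X * star P); [exact: positive_conj|rewrite e].
exact: herm_conj.
Qed.

End Irreducibility.
(** * Bounded groups *)

Section Bounded.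
Variable R : realType.
Local Notation M2 := 'M[quat R]_2.
Implicit Types A B X Y Z : M2.
Implicit Type G : set M2.

Lemma ler_addM_eps (x y c : R) : 0 <= c -> (forall e, 0 < e -> x <= y + c * e) ->
  x <= y.
Proof.
move=> c0 h; apply/ler_addgt0Pr => e e0.
have c1 : 0 < c + 1 by lra.
apply: le_trans (h (e / (c + 1)) _) _; first exact: divr_gt0.
rewrite lerD2l mulrA ler_pdivrMr // mulrC ler_pM2l //; lra.
Qed.

Lemma mxnorm_eps_eq A B (c : R) : 0 <= c ->
  (forall e, 0 < e -> mxnorm (A - B) <= c * e) -> A = B.
Proof.
move=> c0 h; apply/eqP; rewrite -subr_eq0; apply/eqP/mxnorm0_eq/eqP.
rewrite eq_le mxnorm_ge0 andbT; apply: (ler_addM_eps c0) => e e0.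
by rewrite add0r; apply: h.
Qed.

Let ler_of_lip (a b m x y : R) : - x <= a - b -> x <= y -> a <= m ->
  b <= m + y.
Proof. lra. Qed.

Lemma hdet_lip X Y (K : R) : mxnorm X <= K -> mxnorm Y <= K ->
  `|hdet X - hdet Y| <= 4 * K * mxnorm (X - Y).
Proof.
move=> hX hY.
have kX i j := le_trans (mxnorm_entry X i j) hX.
have kY i j := le_trans (mxnorm_entry Y i j) hY.
have d i j : `|X i j - Y i j| <= mxnorm (X - Y).
  by have := mxnorm_entry (X - Y) i j; rewrite !mxE.
set D := mxnorm _ in d *.
have D0 : 0 <= D by apply: mxnorm_ge0.
have K0 : 0 <= K by apply: le_trans (mxnorm_ge0 X) hX.
have r i : `|qre (X i i) - qre (Y i i)| <= D.
  by apply: le_trans (d i i); exact: (qre_le (X i i - Y i i)).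
rewrite /hdet -!sqr_qnorm.
have -> : qre (X 0 0) * qre (X 1 1) - `|X 0 1| ^+ 2
    - (qre (Y 0 0) * qre (Y 1 1) - `|Y 0 1| ^+ 2) =
  (qre (X 0 0) - qre (Y 0 0)) * qre (X 1 1)
  + qre (Y 0 0) * (qre (X 1 1) - qre (Y 1 1))
  + (`|Y 0 1| - `|X 0 1|) * (`|Y 0 1| + `|X 0 1|) by ring.
apply: le_trans (ler_normD _ _) _.
have h1 : `|(`|Y 0 1| - `|X 0 1|) * (`|Y 0 1| + `|X 0 1|)| <= D * (2 * K).
  rewrite normrM; apply: ler_pM => //.
    by apply: le_trans (ler_dist_dist _ _) _; rewrite distrC.
  rewrite ger0_norm ?addr_ge0 //; have := (kX 0 1, kY 0 1); case; lra.
have h2 : `|(qre (X 0 0) - qre (Y 0 0)) * qre (X 1 1)| <= D * K.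
  by rewrite normrM; apply: ler_pM => //; apply: le_trans (kX 1 1); apply: qre_le.
have h3 : `|qre (Y 0 0) * (qre (X 1 1) - qre (Y 1 1))| <= K * D.
  by rewrite normrM; apply: ler_pM => //; apply: le_trans (kY 0 0); apply: qre_le.
have := ler_normD ((qre (X 0 0) - qre (Y 0 0)) * qre (X 1 1))
  (qre (Y 0 0) * (qre (X 1 1) - qre (Y 1 1))).
lra.
Qed.

Lemma hformDl X Y Z : hform (X + Y) Z = hform X Z + hform Y Z.
Proof. by rewrite !(hformC _ Z) hformDr. Qed.

Lemma hdetD X Y : hdet (X + Y) = hdet X + hdet Y + 2 * hform X Y.
Proof. by rewrite /hdet /hform /qnormsq !mxE /=; field. Qed.

(** The reversed Cauchy-Schwarz inequality *)
Lemma hform_ge X Y (c : R) : 0 <= c -> positive X -> positive Y ->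
  c <= hdet X -> c <= hdet Y -> c <= hform X Y.
Proof.
move=> c0 pX pY; have yX := positive11 pX; have yY := positive11 pY.
case: pX pY => _ xX _ [_ xY _]; rewrite /hdet /hform -!sqr_qnorm.
have := qre_le (X 0 1 * qconj (Y 0 1)); rewrite qnormM qnorm_conj.
move/(le_trans (ler_norm _)).
move: (normr_ge0 (X 0 1)) (normr_ge0 (Y 0 1)); move: `|X 0 1| `|Y 0 1| => z w.
move: (qre (X 0 0)) (qre (X 1 1)) (qre (Y 0 0)) (qre (Y 1 1))
  (qre (X 0 1 * qconj (Y 0 1))) xX yX xY yY => x y x' y' r x0 y0 x0' y0' z0 w0 hr h1 h2.
suff : c + z * w <= (x * y' + x' * y) / 2 by lra.
have p1 : 0 <= (x * y' + x' * y) / 2.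
  by rewrite divr_ge0 // addr_ge0 // mulr_ge0 // ltW.
have p2 : 0 <= c + z * w by rewrite addr_ge0 // mulr_ge0.
rewrite -(@ler_pXn2r _ 2) ?nnegrE //.
apply: (@le_trans _ _ ((c + z ^+ 2) * (c + w ^+ 2))).
  have := mulr_ge0 c0 (sqr_ge0 (z - w)); nra.
apply: (@le_trans _ _ ((x * y) * (x' * y'))).
  by apply: ler_pM; rewrite ?addr_ge0 ?sqr_ge0 //; lra.
have := sqr_ge0 (x * y' - x' * y); nra.
Qed.

Lemma positiveD X Y : positive X -> positive Y -> positive (X + Y).
Proof.
move=> pX pY; have [hX xX dX] := pX; have [hY xY dY] := pY.
split; first exact: hermD.
  by rewrite mxE /= addr_gt0.
rewrite hdetD; have := hform_ge (lexx 0) pX pY (ltW dX) (ltW dY); lra.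
Qed.

(** Closure under midpoints is all that the uniqueness of a maximum needs. *)
Definition midpoint_convex (C : set M2) :=
  forall X Y, C X -> C Y -> C (rscale 2^-1 (X + Y)).

Definition midpoint_hull (S : set M2) : set M2 :=
  [set X | forall C, midpoint_convex C -> S `<=` C -> C X].

Lemma sub_midpoint_hull S : S `<=` midpoint_hull S.
Proof. by move=> X SX C _; apply. Qed.

Lemma convex_midpoint_hull S : midpoint_convex (midpoint_hull S).
Proof. by move=> X Y hX hY C cC SC; apply: (cC); [apply: hX|apply: hY]. Qed.

Lemma convex_positive : midpoint_convex [set X | positive X /\ 1 <= hdet X].
Proof.
move=> X Y [pX dX] [pY dY] /=; split.
  by apply: positive_rscale; [lra|exact: positiveD].
rewrite hdet_rscale hdetD; have := hform_ge ler01 pX pY dX dY.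
by rewrite expr2; lra.
Qed.

(** On the closed convex hull of the orbit of the identity the determinant has a
    unique maximum, because it is strictly concave between matrices of equal
    determinant. *)
Lemma bounded_fixes_positive G (M : R) : G 1 ->
  (forall A B, G A -> G B -> G (A * B)) -> (forall A, G A -> sqdet A = 1) ->
  (forall A, G A -> mxnorm A <= M) ->
  exists2 X, positive X & forall A, G A -> A * X * star A = X.
Proof.
move=> G1 GM GS Gb.
pose S := [set A * star A | A in G]; pose C := midpoint_hull S.
have M0 : 0 <= M by apply: le_trans (Gb _ G1); apply: mxnorm_ge0.
have Cpos X : C X -> positive X /\ 1 <= hdet X.
  move=> /(_ _ convex_positive); apply=> _ [A GA <-] /=.
  have A1 := GS _ GA; have dA : hdet (A * star A) = 1 by rewrite -sqdet_hdet.
  split; last by rewrite dA.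
  rewrite -[A in positive (A * _)]mulr1; apply: positive_conj; last exact: positive1.
  by rewrite A1 oner_neq0.
have Cb X : C X -> mxnorm X <= M * M.
  move=> /(_ [set X | mxnorm X <= M * M]); apply.
    move=> Y Z /= hY hZ; rewrite mxnorm_rscale ger0_norm ?invr_ge0 //.
    have := mxnormD Y Z; lra.
  move=> _ [A GA <-] /=; apply: mxnormM_le => //; first exact: Gb.
  by rewrite mxnorm_star; apply: Gb.
have CG A X : G A -> C X -> C (A * X * star A).
  move=> GA CX D cD SD; apply: (CX [set X | D (A * X * star A)]).
    move=> Y Z /= hY hZ; have := cD _ _ hY hZ.
    by rewrite rscaleAr rscaleAl mulrDr mulrDl.
  move=> _ [B GB <-] /=; apply: SD; exists (A * B); first exact: GM.
  by rewrite starM !mulrA.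
have CI : C 1.
  by apply: sub_midpoint_hull; exists 1 => //; rewrite star1 mulr1.
pose D := [set hdet X | X in C].
have hsD : has_sup D.
  split; first by exists (hdet 1), 1.
  exists (M * M * (M * M)) => _ [X CX <-].
  rewrite /hdet; have n0 := qnormsq_ge0 (X 0 1).
  have k i : `|qre (X i i)| <= M * M.
    by apply: le_trans (Cb _ CX); apply: le_trans (mxnorm_entry X i i); apply: qre_le.
  have : qre (X 0 0) * qre (X 1 1) <= M * M * (M * M).
    by apply: le_trans (ler_norm _) _; rewrite normrM; apply: ler_pM.
  lra.
pose m := sup D.
have Dm X : C X -> hdet X <= m.
  by move=> CX; apply: (ub_le_sup hsD.2); exists X.
have m1 : 1 <= m by rewrite -(hdet1 R); apply: Dm.
have [u uP] : exists u : nat -> M2, forall n, C (u n) /\ m - n.+1%:R^-1 < hdet (u n).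
  suff /choice[u hu] : forall n : nat, exists X, C X /\ m - n.+1%:R^-1 < hdet X.
    by exists u.
  move=> n.
  have n0 : 0 < n.+1%:R^-1 :> R by rewrite invr_gt0.
  by have [_ [X CX <-] h] := sup_adherent n0 hsD; exists X.
have [L HL] := bounded_cluster (fun n => Cb _ (uP n).1).
have {u uP}HL e : 0 < e -> exists X, [/\ C X, m - e < hdet X & mxnorm (X - L) < e].
  move=> e0; have [N _ hN] := near_infty_natSinv_lt (PosNum e0).
  have [n Nn hn] := HL _ e0 N; exists (u n); have [h1 h2] := uP n; split=> //.
  apply: lt_trans h2; rewrite ltrD2l ltrN2; exact: (hN n Nn).
have Lb : mxnorm L <= M * M.
  apply: (ler_addM_eps ler01) => e e0; have [X [CX _ hX]] := HL e e0.
  have := mxnormD (L - X) X; rewrite subrK mxnormBC; have := Cb _ CX; lra.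
have K0 : 0 <= M * M by apply: mulr_ge0.
have hL : herm L.
  apply: (@mxnorm_eps_eq _ _ 2) => // e e0; have [X [CX _ hX]] := HL e e0.
  have [[hX0 _ _] _] := Cpos _ CX.
  have := mxnorm_tri (star L) X L; rewrite -{1}hX0.
  have -> : star L - star X = star (L - X).
    by apply/matrixP => i j; rewrite !mxE; apply: quatP => /=; ring.
  by rewrite mxnorm_star (mxnormBC L); lra.
have dL : hdet L = m.
  apply/eqP; rewrite eq_le; apply/andP; split.
    apply: (@ler_addM_eps _ _ (4 * (M * M))); first by lra.
    move=> e e0; have [X [CX _ hX]] := HL e e0; have h := Dm _ CX.
    have := hdet_lip (Cb _ CX) Lb; rewrite ler_norml => /andP[h1 _].
    have : 4 * (M * M) * mxnorm (X - L) <= 4 * (M * M) * e by apply: ler_wpM2l; lra.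
    lra.
  apply: (@ler_addM_eps _ _ (4 * (M * M) + 1)); first by lra.
  move=> e e0; have [X [CX dX hX]] := HL e e0.
  have := hdet_lip (Cb _ CX) Lb; rewrite ler_norml => /andP[_ h1].
  have : 4 * (M * M) * mxnorm (X - L) <= 4 * (M * M) * e by apply: ler_wpM2l; lra.
  lra.
have L00 : 0 <= qre (L 0 0).
  apply: (ler_addM_eps ler01) => e e0; have [X [CX _ hX]] := HL e e0.
  have [[_ x0 _] _] := Cpos _ CX.
  have := le_trans (qre_le ((X - L) 0 0)) (mxnorm_entry (X - L) 0 0).
  rewrite !mxE /= ler_norml => /andP[]; lra.
have pL : positive L.
  split=> //; last by rewrite dL; lra.
  rewrite lt_def L00 andbT; apply/eqP => z0; move: dL; rewrite /hdet z0 mul0r.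
  have := qnormsq_ge0 (L 0 1); lra.
exists L => // A GA; set Y := A * L * star A.
have A1 := GS _ GA.
have dY : hdet Y = m by rewrite /Y hdet_conj // A1 mul1r.
have pY : positive Y by apply: positive_conj => //; rewrite A1 oner_neq0.
have hm : hdet (rscale 2^-1 (L + Y)) <= m.
  have Ab := Gb _ GA.
  have Yb : mxnorm Y <= M * (M * M) * M.
    rewrite /Y; apply: mxnormM_le => //; last by rewrite mxnorm_star.
    by apply: mxnormM_le.
  pose K := M * M + M * (M * M) * M.
  have b1 : mxnorm (rscale 2^-1 (L + Y)) <= K.
    rewrite mxnorm_rscale ger0_norm ?invr_ge0 //; have := mxnormD L Y.
    have := mxnorm_ge0 Y; rewrite /K; lra.
  have K1 : 0 <= K by rewrite addr_ge0 // !mulr_ge0.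
  apply: (@ler_addM_eps _ _ (4 * K * (1 + M * M))).
    by rewrite !mulr_ge0 // addr_ge0.
  move=> e e0; have [X [CX _ hX]] := HL e e0.
  pose Z := rscale 2^-1 (X + A * X * star A).
  have CZ : C Z by apply: convex_midpoint_hull => //; apply: CG.
  have b2 : mxnorm Z <= K.
    by apply: le_trans (Cb _ CZ) _; rewrite /K lerDl !mulr_ge0.
  have := hdet_lip b2 b1; rewrite ler_norml => /andP[h1 _].
  have h2 : mxnorm (Z - rscale 2^-1 (L + Y)) <= (1 + M * M) * e.
    rewrite /Z -rscaleN -rscaleDr mxnorm_rscale ger0_norm ?invr_ge0 //.
    have -> : X + A * X * star A - (L + Y) = (X - L) + A * (X - L) * star A.
      by rewrite /Y mulrBr mulrBl opprD addrACA.
    have := mxnormD (X - L) (A * (X - L) * star A).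
    have : mxnorm (A * (X - L) * star A) <= M * e * M.
      apply: mxnormM_le => //; last by rewrite mxnorm_star.
      by apply: mxnormM_le => //; apply: ltW.
    have := mulr_ge0 K0 (ltW e0); rewrite (mulrAC M e) mulrDl mul1r.
    move: (M * M * e) (mxnorm (X - L)) (mxnorm (A * _ * _)) (mxnorm (_ + _)) hX e0.
    by clear => q x y z *; lra.
  have h3 := Dm _ CZ.
  have h4 : 4 * K * mxnorm (Z - rscale 2^-1 (L + Y)) <= 4 * K * (1 + M * M) * e.
    by rewrite -(mulrA (4 * K)); apply: ler_wpM2l => //; rewrite mulr_ge0.
  exact: (ler_of_lip h1 h4 h3).
rewrite hdet_rscale hdetD dL dY expr2 in hm.
apply/eqP; rewrite -subr_eq0; apply/eqP.
have nE : Y - L = Y + rscale (-1) L by rewrite rscaleNl rscale1.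
apply: (hform_definite (positiveD pL pY)).
- by rewrite nE; apply: hermD; [case: pY|apply: herm_rscale].
- rewrite nE hformDr hformZr !hformDl !hform_diag dL dY (hformC L Y).
  by ring.
move: hm; rewrite nE hdetD hdet_rscale hformZr dL dY (hformC Y L).
by move: (m) (hform L Y); clear => m h; lra.
Qed.

(** A conjugate of A that fixes the identity matrix is unitary. *)
Lemma retr_fixes_positive A X : sqdet A = 1 -> positive X ->
  A * X * star A = X -> `|retr A| <= 2.
Proof.
move=> A1 /positive_normalize[[z t] hp [r r0 ->]].
rewrite rscaleAr rscaleAl => /(rscale_inj (lt0r_neq0 r0)) e.
have t0 : 0 < t by [].
pose s := Num.sqrt t.
have s0 : 0 < s by rewrite sqrtr_gt0.
have s2 : s ^+ 2 = t by rewrite sqr_sqrtr // ltW.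
pose T := mx2 (qreal s) (s^-1 *: z) 0 (qreal s^-1).
have T1 : sqdet T = 1.
  rewrite sqdet_tri !qnorm_real normfV mulfV ?expr1n //.
  by rewrite normr_eq0 gt_eqF.
have TE : embed (z, t) = T * star T.
  have sn := lt0r_neq0 s0.
  case: (embedE (z, t)) => h1 h2 h3 h4.
  apply: mx2_ext; rewrite ?h1 ?h2 ?h3 ?h4 mul2E !starE !mx2e /= -s2;
    by apply: quatP; rewrite /qnormsq /=; field.
have [Ti [TTi TiT] Ti1] := sqdet1_inv T1.
have UU : (Ti * A * T) * star (Ti * A * T) = 1.
  rewrite !starM !mulrA -(mulrA _ T) -TE -(mulrA Ti) -(mulrA Ti) e TE.
  by rewrite mulrA TiT mul1r -starM TiT star1.
have <- : retr (Ti * A * T) = retr A.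
  by rewrite -mulrA retrMC -mulrA TTi mulr1.
move: (Ti * A * T) UU => U UU.
have d i : (U * star U) i i = qreal (`|U i 0| ^+ 2 + `|U i 1| ^+ 2).
  by rewrite mul2E !starE !qmul_conj !sqr_qnorm; apply: quatP; rewrite /=; ring.
have d0 i : `|U i 0| ^+ 2 + `|U i 1| ^+ 2 = 1.
  have := d i; rewrite UU mxE eqxx => -[<-] //.
have u i j : `|U i j| <= 1.
  rewrite -(@ler_pXn2r _ 2) ?nnegrE // expr1n.
  have := (sqr_ge0 `|U i 0|, sqr_ge0 `|U i 1|); have := d0 i.
  by move: j; apply: ord2P => ? [? ?]; lra.
apply: le_trans (ler_normD _ _) _.
have := le_trans (qre_le (U 0 0)) (u 0 0).
have := le_trans (qre_le (U 1 1)) (u 1 1); lra.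
Qed.

End Bounded.
(** * Large traces and hyperbolic elements *)

Section Loxodromic.
Variable R : realType.
Local Notation M2 := 'M[quat R]_2.
Local Notation V2 := 'M[quat R]_(2, 1).
Local Notation U2 := 'M[quat R]_(1, 2).
Implicit Types A B T : M2.
Implicit Type G : set M2.

Lemma mul_col_row (p : V2) (q : U2) i j : (p *m q) i j = p i 0 * q 0 j.
Proof.
by rewrite mxE big_ord_recl big_ord0 addr0; congr (p i _ * q _ j); apply: val_inj.
Qed.

Lemma mul_row_col (q : U2) (p : V2) :
  (q *m p) 0 0 = q 0 0 * p 0 0 + q 0 1 * p 1 0.
Proof.
rewrite mxE !big_ord_recl big_ord0 addr0; congr (q _ _ * p _ _ + q _ _ * p _ _);
  exact: val_inj.
Qed.

Definition rowq (x y : quat R) : U2 := \matrix_(i, j) if j == 0 then x else y.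

Lemma rowqE x y : (rowq x y 0 0 = x) * (rowq x y 0 1 = y).
Proof. by rewrite !mxE. Qed.

Lemma row_neq0 (q : U2) : q != 0 -> q 0 0 != 0 \/ q 0 1 != 0.
Proof.
move=> q0; have [h0|] := eqVneq (q 0 0) 0; last by left.
right; apply: contra q0 => /eqP h1; apply/eqP/matrixP => i.
by apply: ord2P; rewrite (ord1 i) mxE.
Qed.

Lemma col_neq0 (p : V2) : p != 0 -> p 0 0 != 0 \/ p 1 0 != 0.
Proof.
move=> p0; have [h0|] := eqVneq (p 0 0) 0; last by left.
by right; apply: contra p0 => /eqP h1; apply/eqP/col_ext; rewrite mxE.
Qed.

Lemma sqdet0_rank1 A : sqdet A = 0 -> A != 0 ->
  exists (p : V2) (q : U2), [/\ p != 0, q != 0 & A = p *m q].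
Proof.
have cn x y : (x != 0) || (y != 0) -> colq x y != 0.
  move=> h; apply/eqP => /matrixP e; move: h.
  by have := (e 0 0, e 1 0); rewrite !colqE !mxE => -[-> ->]; rewrite eqxx.
have rn x y : (x != 0) || (y != 0) -> rowq x y != 0.
  move=> h; apply/eqP => /matrixP e; move: h.
  by have := (e 0 0, e 0 1); rewrite !rowqE !mxE => -[-> ->]; rewrite eqxx.
rewrite sqdetE => /eqP; rewrite sqrf_eq0 /qdet => h A0.
have [a0|a0] := eqVneq (A 0 0) 0; move: h.
  rewrite a0 eqxx normr_eq0 qmul_eq0 => /orP[/eqP b0|/eqP c0].
    exists (colq 0 1), (rowq (A 1 0) (A 1 1)); split.
    - by apply: cn; rewrite oner_neq0 orbT.
    - apply: rn; rewrite -negb_and; apply: contra A0 => /andP[/eqP c0 /eqP d0].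
      by apply/eqP; apply: mx2_ext; rewrite mxE.
    by apply: mx2_ext; rewrite mul_col_row !colqE !rowqE ?mul0r ?mul1r.
  exists (colq (A 0 1) (A 1 1)), (rowq 0 1); split.
  - apply: cn; rewrite -negb_and; apply: contra A0 => /andP[/eqP b0 /eqP d0].
    by apply/eqP; apply: mx2_ext; rewrite mxE.
  - by apply: rn; rewrite oner_neq0 orbT.
  by apply: mx2_ext; rewrite mul_col_row !colqE !rowqE ?mulr0 ?mulr1.
rewrite (negPf a0) normr_eq0 => h.
exists (colq (A 0 0) (A 1 0)), (rowq 1 ((A 0 0)^-1 * A 0 1)); split.
- by apply: cn; rewrite a0.
- by apply: rn; rewrite oner_neq0.
apply: mx2_ext; rewrite mul_col_row !colqE !rowqE ?mulr1 //.
  by rewrite mulrA qmulV // mul1r.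
have : A 0 0 * (A 1 1 - A 1 0 * ((A 0 0)^-1 * A 0 1)) == 0.
  by rewrite mulrBr !mulrA.
by rewrite qmul_eq0 (negPf a0) subr_eq0 => /eqP.
Qed.

Lemma mxnormM_close A B C D (K e : R) : 0 <= K -> 0 <= e -> mxnorm B <= K ->
  mxnorm C <= K -> mxnorm (A - C) <= e -> mxnorm (B - D) <= e ->
  mxnorm (A * B - C * D) <= 2 * K * e.
Proof.
move=> K0 e0 hB hC h1 h2.
have -> : A * B - C * D = (A - C) * B + C * (B - D).
  by rewrite mulrBl mulrBr addrA subrK.
apply: le_trans (mxnormD _ _) _.
have h3 := mxnormM_le K0 h1 hB; have h4 := mxnormM_le e0 hC h2; lra.
Qed.

(** After division by the norm the determinant tends to 0, so that the limit
    directions at infinity have rank one. *)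
Lemma unbounded_rank1 (G : set M2) : (forall A, G A -> sqdet A = 1) ->
  (forall M, exists2 A, G A & M < mxnorm A) ->
  exists (p : V2) (q : U2), [/\ p != 0, q != 0 & forall e, 0 < e ->
    exists2 A, G A & e^-1 < mxnorm A /\
      mxnorm (rscale (mxnorm A)^-1 A - p *m q) < e].
Proof.
move=> GS Gu.
have /choice[u hu] : forall n : nat, exists A, G A /\ n.+1%:R < mxnorm A.
  by move=> n; have [A GA h] := Gu n.+1%:R; exists A.
have u0 n : 0 < mxnorm (u n) by apply: lt_trans (hu n).2.
pose v n := rscale (mxnorm (u n))^-1 (u n).
have v1 n : mxnorm (v n) = 1.
  by rewrite mxnorm_rscale ger0_norm ?invr_ge0 ?ltW // mulVf ?lt0r_neq0.
have [E HE] : exists L, forall e, 0 < e -> forall m, exists2 n, (m <= n)%N &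
    mxnorm (v n - L) < e.
  by apply: (@bounded_cluster _ v 1) => n; rewrite v1.
have {}HE e : 0 < e -> exists2 n, e^-1 < mxnorm (u n) & mxnorm (v n - E) < e.
  move=> e0; have [N hN] : exists N : nat, e^-1 < N%:R.
    by exists (Num.bound e^-1); apply: archi_boundP; rewrite invr_ge0 ltW.
  have [n Nn hn] := HE e e0 N; exists n => //.
  apply: lt_trans (hu n).2; apply: lt_le_trans hN _; rewrite ler_nat.
  exact: leq_trans Nn _.
have E1 : mxnorm E = 1.
  apply/eqP; rewrite eq_le; apply/andP; split; apply: (ler_addM_eps ler01).
    move=> e e0; have [n _ hn] := HE e e0; have := mxnormD (E - v n) (v n).
    by rewrite subrK v1 mxnormBC; lra.
  move=> e e0; have [n _ hn] := HE e e0; have := mxnormD (v n - E) E.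
  by rewrite subrK v1; lra.
have dE : sqdet E = 0.
  apply/eqP; rewrite eq_le sqdet_ge0 andbT.
  apply: (@ler_addM_eps _ _ _ 9) => // e' e'0.
  pose e := Num.min 1 e'.
  have e0 : 0 < e by rewrite lt_min ltr01.
  have e1 : e <= 1 by rewrite ge_min lexx.
  have ee : e <= e' by rewrite ge_min lexx orbT.
  have [n un vn] := HE e e0.
  have dv : sqdet (v n) <= e.
    rewrite sqdet_rscale (GS _ (hu n).1) mulr1.
    have x0 : 0 < (mxnorm (u n))^-1 by rewrite invr_gt0.
    have xe : (mxnorm (u n))^-1 < e.
      by rewrite -[e]invrK ltf_pV2 ?posrE ?invr_gt0.
    move: (mxnorm (u n))^-1 x0 xe => x x0 xe.
    have x1 : x <= 1 by lra.
    have : x ^+ 4 <= x ^+ 1 by rewrite ler_wiXn2l // ltW.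
    rewrite expr1; lra.
  have b A : mxnorm A = 1 -> mxnorm (A * star A) <= 1.
    by move=> h; apply: le_trans (mxnormM _ _) _; rewrite mxnorm_star h mulr1.
  have := hdet_lip (b _ E1) (b _ (v1 n)); rewrite -!sqdet_hdet.
  have h : mxnorm (E * star E - v n * star (v n)) <= 2 * 1 * e.
    apply: mxnormM_close => //; rewrite ?mxnorm_star ?v1 ?E1 //; first exact: ltW.
      by rewrite mxnormBC ltW.
    have -> : star E - star (v n) = star (E - v n).
      by apply/matrixP => i j; rewrite !mxE; apply: quatP => /=; ring.
    by rewrite mxnorm_star mxnormBC ltW.
  rewrite ler_norml => /andP[_]; lra.
have E0 : E != 0.
  by apply/eqP => E0; move: E1; rewrite E0 /mxnorm !mxE normr0; lra.
have [p [q [p0 q0 EE]]] := sqdet0_rank1 dE E0.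
exists p, q; split=> // e e0; have [n un vn] := HE e e0.
by exists (u n); [exact: (hu n).1|rewrite -EE].
Qed.

(** Either the centralizer of A is bounded, and A is conjugate to a unitary
    matrix, or it has a direction at infinity, a rank one matrix commuting
    with A. *)
Lemma eigvec_exists A : sqdet A = 1 -> 2 < `|retr A| ->
  exists2 v, v != 0 & eigvec A v.
Proof.
move=> A1 trA; pose Z := [set B | sqdet B = 1 /\ A * B = B * A].
have Z1 B : Z B -> sqdet B = 1 by case.
have [[M hM]|hM] := pselect (exists M, forall B, Z B -> mxnorm B <= M).
  have [||X pX XZ] := bounded_fixes_positive _ _ Z1 hM.
  - by split; rewrite ?sqdet1 ?mulr1 ?mul1r.
  - move=> B C [B1 AB] [C1 AC]; split; first by rewrite sqdetM B1 C1 mulr1.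
    by rewrite mulrA AB -mulrA AC mulrA.
  have := retr_fixes_positive A1 pX (XZ A (conj A1 erefl)).
  by rewrite leNgt trA.
have [M|p [q [p0 q0 hpq]]] := unbounded_rank1 Z1.
  apply: contrapT => h; apply: hM; exists M => B ZB; rewrite leNgt.
  by apply/negP => hB; apply: h; exists B.
have cE : A * (p *m q) = (p *m q) * A.
  apply: (@mxnorm_eps_eq _ _ _ (2 * mxnorm A)).
    by rewrite mulr_ge0 // mxnorm_ge0.
  move=> e e0; have [B [_ AB] [_ hB]] := hpq e e0.
  set B' := rscale _ _ in hB.
  have AB' : A * B' = B' * A by rewrite /B' rscaleAr rscaleAl AB.
  have -> : A * (p *m q) - (p *m q) * A =
      A * (p *m q - B') + (B' - p *m q) * A.
    by rewrite mulrBr mulrBl AB' addrA subrK.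
  apply: le_trans (mxnormD _ _) _.
  have a0 := mxnorm_ge0 A.
  have h1 : mxnorm (A * (p *m q - B')) <= mxnorm A * e.
    by apply: mxnormM_le => //; rewrite 1?mxnormBC ltW.
  have h2 : mxnorm ((B' - p *m q) * A) <= e * mxnorm A.
    by apply: mxnormM_le => //; rewrite ltW.
  lra.
exists p => //.
suff [w qw] : exists w : V2, q *m w = 1%:M.
  exists (q *m A *m w); rewrite -[A *m p]mulmx1 -qw !mulmxA.
  by congr (_ *m w); rewrite -mulmxA; exact: cE.
have s : forall m : 'M[quat R]_1, m 0 0 = 1 -> m = 1%:M.
  by move=> m h; apply/matrixP => i j; rewrite !ord1 h mxE.
case: (row_neq0 q0) => h.
  exists (colq (q 0 0)^-1 0); apply: s.
  by rewrite mul_row_col !colqE mulr0 addr0 qmulV.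
exists (colq 0 (q 0 1)^-1); apply: s.
by rewrite mul_row_col !colqE mulr0 add0r qmulV.
Qed.

(** Sylvester's equation: when the norms differ, l and m have no common
    conjugate, and the real minimal polynomial of m is invertible at l. *)
Lemma sylvester (l m b : quat R) : `|l| != `|m| -> exists z, l * z + b = z * m.
Proof.
move=> lm; pose P := l * l - (2 * qre m) *: l + qreal (qnormsq m).
have cP : l * P = P * l.
  by rewrite /P; apply: quatP => /=; ring.
have P0 : P != 0.
  apply: contra lm => /eqP P0.
  suff : qnormsq l = qnormsq m by move=> h; rewrite !qnormE h.
  have h0 := congr1 (@qre R) P0; have h1 := congr1 (@qi R) P0.
  have h2 := congr1 (@qj R) P0; have h3 := congr1 (@qk R) P0.
  move: h0 h1 h2 h3; rewrite /P /qnormsq /=.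
  move: l m {P cP P0} => [x1 x2 x3 x4] [y1 y2 y3 y4] /= h0 h1 h2 h3.
  have k (x : R) : x1 * x + x * x1 - 2 * y1 * x = 0 -> 2 * (x1 - y1) * x = 0.
    by move=> <-; ring.
  have [e|ne] := eqVneq x1 y1; first by subst; nra.
  have n2 : 2 * (x1 - y1) != 0 by rewrite mulf_neq0 // subr_eq0.
  have z (x : R) : 2 * (x1 - y1) * x = 0 -> x = 0.
    by move/eqP; rewrite mulf_eq0 (negPf n2) /= => /eqP.
  have e2 : x2 = 0 by apply: z; rewrite -h1; ring.
  have e3 : x3 = 0 by apply: z; rewrite -h2; ring.
  have e4 : x4 = 0 by apply: z; rewrite -h3; ring.
  subst; exfalso; move/eqP: ne; apply.
  have : (x1 - y1) ^+ 2 = 0.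
    have := (sqr_ge0 (x1 - y1), sqr_ge0 y2, sqr_ge0 y3, sqr_ge0 y4).
    by move=> [[[? ?] ?] ?]; nra.
  by move/eqP; rewrite sqrf_eq0 subr_eq0 => /eqP.
have cV : l * P^-1 = P^-1 * l.
  rewrite -[LHS]mul1r -(qmulVl P0) -[RHS]mulr1 -(qmulV P0).
  by rewrite !mulrA -(mulrA P^-1 P l) -cP mulrA.
have bE : b = P^-1 * (P * b) by rewrite mulrA qmulVl // mul1r.
exists (P^-1 * (b * qconj m - l * b)).
transitivity (P^-1 * (l * (b * qconj m - l * b)) + P^-1 * (P * b)).
  by rewrite -bE (mulrA l) cV -(mulrA P^-1).
rewrite -mulrDr -(mulrA P^-1); congr (_ * _).
by rewrite /P; apply: quatP; rewrite /qnormsq /=; ring.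
Qed.

Definition swap2 : M2 := mx2 0 1 1 0.

Lemma swap2K : swap2 * swap2 = 1.
Proof. by rewrite mx2_one mx2_mul !mulr0 !mul0r !mulr1 !addr0 !add0r. Qed.

Lemma sqdet_swap2 : sqdet swap2 = 1.
Proof. by rewrite /sqdet !mx2e /qnormsq /=; ring. Qed.

Lemma swap2_conj a b c d : swap2 * mx2 a b c d * swap2 = mx2 d c b a.
Proof.
by rewrite !mx2_mul !mul0r !mul1r !add0r !addr0 !mulr0 !mulr1 !add0r !addr0.
Qed.

Lemma retr_conj P Q A : mx_inverse P Q -> retr (Q * A * P) = retr A.
Proof. by move=> [PQ _]; rewrite -mulrA retrMC -mulrA PQ mulr1. Qed.

Lemma eigvec_e0 A : eigvec A (colq 1 0) <-> A 1 0 = 0.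
Proof.
rewrite eigvec_colq !mulr1 !mulr0 !addr0; split=> [[k [_ ->]]|->].
  by rewrite mul0r.
by exists (A 0 0); rewrite mul1r mul0r.
Qed.

(** An eigenvector makes A triangular. The eigenvalues have distinct norms since
    otherwise both norms would be 1 and the real trace at most 2; Sylvester's
    equation then removes the off-diagonal entry. *)
Lemma loxodromic_diag A : sqdet A = 1 -> 2 < `|retr A| ->
  exists T T' l m, [/\ sqdet T = 1, mx_inverse T T', T' * A * T = mx2 l 0 0 m,
    `|l| * `|m| = 1 & 1 < `|l| ].
Proof.
move=> A1 trA; have [v v0 eA] := eigvec_exists A1 trA.
have [z [k [k0 vE]]] := homog_onto v0.
have {v0 vE eA k0}ez : eigvec A (homog z) by move: eA; rewrite vE eigvec_scale.
have [T1 [sT1 eT1]] : exists T1 : M2, sqdet T1 = 1 /\ T1 *m colq 1 0 = homog z.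
  case: z ez => [z|] _; last first.
    by exists 1; rewrite sqdet1; split=> //; apply: mul1mx.
  exists (mx2 z (-1) 1 0); split.
    rewrite /sqdet !mx2e; move: z => [z0 z1 z2 z3]; rewrite /qnormsq /=; ring.
  apply: col_ext; rewrite mulmx2E !colqE !mx2e;
    by rewrite ?mulr1 ?mulr0 ?addr0.
have [S1 iT1 sS1] := sqdet1_inv sT1.
pose B := S1 * A * T1.
have B1 : sqdet B = 1 by rewrite !sqdetM sT1 sS1 A1 !mulr1.
have B10 : B 1 0 = 0.
  by apply/eigvec_e0; apply/(eigvec_conj _ _ iT1); rewrite eT1.
have trB : retr B = retr A by apply: retr_conj.
have BE : B = mx2 (B 0 0) (B 0 1) 0 (B 1 1) by rewrite {1}(mx2_eta B) B10.
have lm1 : `|B 0 0| * `|B 1 1| = 1.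
  move: B1; rewrite {1}BE sqdet_tri => /eqP; rewrite sqrf_eq1 => /orP[/eqP //|/eqP h].
  by have : 0 <= `|B 0 0| * `|B 1 1|; [rewrite mulr_ge0|rewrite h ler0N1].
have lm : `|B 0 0| != `|B 1 1|.
  apply/eqP => e; move: lm1; rewrite -e -expr2 => /eqP.
  rewrite sqrp_eq1 // => /eqP e1; move: trA; rewrite -trB ltNge => /negP; apply.
  apply: le_trans (ler_normD _ _) _.
  by have := (qre_le (B 0 0), qre_le (B 1 1)); rewrite -e e1; case; lra.
have [y hy] := sylvester (B 0 1) lm.
pose T2 := mx2 1 y 0 1; pose S2 := mx2 1 (- y) 0 1.
have iT2 : mx_inverse T2 S2.
  by split; rewrite mx2_mul mx2_one !mulr0 !mul0r !mulr1 !mul1r !addr0 ?add0r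
    ?addNr ?subrr.
have sT2 : sqdet T2 = 1 by rewrite sqdet_tri qnorm1 mulr1 expr1n.
have D : S2 * B * T2 = mx2 (B 0 0) 0 0 (B 1 1).
  rewrite {1}BE !mx2_mul !mulr0 !mul0r !mulr1 !mul1r !addr0 !add0r.
  by rewrite mulNr addrA hy subrr mul0r add0r.
have iT := mx_inverseM iT1 iT2.
have sT : sqdet (T1 * T2) = 1 by rewrite sqdetM sT1 sT2 mulr1.
have D' : S2 * S1 * A * (T1 * T2) = mx2 (B 0 0) 0 0 (B 1 1).
  by rewrite -D /B !mulrA.
have [h|h] := ltP 1 `|B 0 0|.
  by exists (T1 * T2), (S2 * S1), (B 0 0), (B 1 1).
exists (T1 * T2 * swap2), (swap2 * (S2 * S1)), (B 1 1), (B 0 0); split.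
- by rewrite sqdetM sT sqdet_swap2 mulr1.
- by apply: mx_inverseM => //; split; exact: swap2K.
- rewrite -swap2_conj -D' !mulrA //.
- by rewrite mulrC.
have b0 : 0 < `|B 0 0|.
  rewrite lt_def normr_ge0 andbT; apply/eqP => e.
  by move: lm1; rewrite e mul0r => /eqP; rewrite eq_sym oner_eq0.
rewrite lt_def; apply/andP; split.
  apply/eqP => e; move: lm1 lm; rewrite e mulr1 => ->; by rewrite eqxx.
by rewrite -(ler_pM2l b0) mulr1 lm1.
Qed.

Lemma eigvec_diag_off l m (v : V2) : `|l| != `|m| ->
  eigvec (mx2 l 0 0 m) v -> v 0 0 = 0 \/ v 1 0 = 0.
Proof.
move=> lm; rewrite [v]colq_eta eigvec_colq !mx2e !colqE !mul0r !add0r !addr0.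
move=> [k [h0 h1]]; have [|x0] := eqVneq (v 0 0) 0; first by left.
have [|y0] := eqVneq (v 1 0) 0; first by right.
have n (a b c : quat R) : b != 0 -> a * b = b * c -> `|a| = `|c|.
  move=> b0 /(congr1 Num.norm); rewrite !qnormM mulrC.
  by apply: mulfI; rewrite normr_eq0.
by move: lm; rewrite (n _ _ _ x0 h0) (n _ _ _ y0 h1) eqxx.
Qed.

Lemma homog_inj z w (k : 'M[quat R]_1) : homog w = homog z *m k -> w = z.
Proof.
move/matrixP => h; have := (h 0 0, h 1 0); rewrite !mul_col_k.
case: z w {h} => [z|] [w|]; rewrite /homog !colqE ?mul1r ?mul0r //.
- by move=> [-> <-]; rewrite mulr1.
- by move=> [h k0]; move: h; rewrite -k0 mulr0 => /eqP; rewrite oner_eq0.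
- by move=> [_ /eqP]; rewrite oner_eq0.
Qed.

(** In the diagonalizing frame, an eigenvector off the axes would make the two
    eigenvalues conjugate; so the axes are the only fixed points at infinity. *)
Lemma loxodromic_hyperbolic A : sqdet A = 1 -> 2 < `|retr A| -> hyperbolic A.
Proof.
move=> A1 trA; split; first exact/SL2H_sqdet.
  move=> [p hp /fixed_embed e].
  have := retr_fixes_positive A1 (positive_embed hp) (e A1 hp).
  by rewrite leNgt trA.
have [T [T' [l [m [T1 iT D lm l1]]]]] := loxodromic_diag A1 trA.
have lm' : `|l| != `|m|.
  apply: contraL l1 => /eqP e; move: lm; rewrite -e -expr2 => /eqP.
  by rewrite sqrp_eq1 // => /eqP ->; rewrite ltxx.
have Tn (v : V2) : v != 0 -> T *m v != 0.
  apply: contra => /eqP h; apply/eqP; case: iT => _ T'T.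
  by rewrite -[LHS]mul1mx -[1%:M]T'T -mulmxA h mulmx0.
pose e0 := colq (1 : quat R) 0; pose e1 := colq (0 : quat R) 1.
have e0n : e0 != 0 by apply: (homog_neq0 None).
have e1n : e1 != 0 by apply: (homog_neq0 (Some 0)).
have [z1 [k1 [k10 E1]]] := homog_onto (Tn _ e0n).
have [z2 [k2 [k20 E2]]] := homog_onto (Tn _ e1n).
have eig z (k : 'M[quat R]_1) (v : V2) : k 0 0 != 0 -> T *m v = homog z *m k -> eigvec (mx2 l 0 0 m) v ->
    mobius A z = z.
  move=> k0 E; rewrite -D => /(eigvec_conj _ _ iT); rewrite E.
  by move/(eigvec_scale _ _ k0)/mobius_fixed; apply.
exists z1, z2; split.
  move=> z12; rewrite z12 in E1.
  pose k1' : 'M[quat R]_1 := ((k1 0 0)^-1)%:M.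
  have kk : k1 *m k1' = 1%:M.
    have -> : k1 = (k1 0 0)%:M by apply/matrixP => i j; rewrite !ord1 mxE.
    by rewrite -scalar_mxM qmulV.
  have : T *m e1 = T *m (e0 *m (k1' *m k2)).
    by rewrite !mulmxA E1 -(mulmxA _ k1) kk mulmx1.
  move/(congr1 (mulmx T')); rewrite mulmxA (mulmxA T').
  case: iT => _ T'T; rewrite (_ : T' *m T = 1%:M) // !mul1mx => /matrixP /(_ 1 0).
  by rewrite mul_col_k !colqE mul0r => /eqP; rewrite oner_eq0.
apply/seteqP; split=> [w /= /(mobius_fixed _ A1) ew|w /= [->|->]]; last 2 first.
- apply: (eig z1 k1 e0) => //; apply/eigvec_e0; by rewrite mx2e.
- apply: (eig z2 k2 e1) => //; apply/eigvec_colq; exists m; rewrite !mx2e.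
  by rewrite !mulr0 !mul0r !addr0 !add0r mul1r mulr1.
have sc (x : quat R) : (x%:M : 'M[quat R]_1) 0 0 = x by rewrite mxE.
have TT' : T *m (T' *m homog w) = homog w.
  by case: iT => TT' _; rewrite mulmxA (_ : T *m T' = 1%:M) ?mul1mx.
have : eigvec (mx2 l 0 0 m) (T' *m homog w).
  by rewrite -D; apply/(eigvec_conj _ _ iT); rewrite TT'.
move/(eigvec_diag_off lm'); set u := T' *m homog w in TT' * => -[h|h].
  right; apply: (@homog_inj _ _ (k2 *m (u 1 0)%:M)).
  rewrite -TT' mulmxA -E2 -mulmxA; congr (_ *m _); apply: col_ext;
    by rewrite mul_col_k sc /e1 !colqE ?mul0r ?mul1r.
left; apply: (@homog_inj _ _ (k1 *m (u 0 0)%:M)).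
rewrite -TT' mulmxA -E1 -mulmxA; congr (_ *m _); apply: col_ext;
  by rewrite mul_col_k sc /e0 !colqE ?mul0r ?mul1r.
Qed.

Lemma kernel_line (q : U2) (p w : V2) : q != 0 -> p != 0 ->
  (q *m p) 0 0 = 0 -> (q *m w) 0 0 = 0 -> exists k : 'M[quat R]_1, w = p *m k.
Proof.
rewrite !mul_row_col => q0 p0 hp hw.
have solve (a b x y : quat R) : a != 0 -> a * x + b * y = 0 ->
    x = - (a^-1 * b * y).
  move=> a0 /eqP; rewrite addr_eq0 => /eqP h.
  by rewrite -mulrA -mulrN -h mulrA qmulVl // mul1r.
have ext : forall k : quat R, w 0 0 = p 0 0 * k -> w 1 0 = p 1 0 * k ->
    exists k : 'M[quat R]_1, w = p *m k.
  by move=> k h0 h1; exists k%:M; apply: col_ext; rewrite mul_col_k mxE.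
case: (row_neq0 q0) => h.
  have ep := solve _ _ _ _ h hp; have ew := solve _ _ _ _ h hw.
  have p1 : p 1 0 != 0.
    by case: (col_neq0 p0) => //; rewrite ep; apply: contra => /eqP ->;
      rewrite mulr0 oppr0.
  apply: (ext ((p 1 0)^-1 * w 1 0)); last by rewrite mulrA qmulV // mul1r.
  by rewrite ew ep mulNr -!mulrA (mulrA (p 1 0)) qmulV // mul1r.
rewrite addrC in hp; rewrite addrC in hw.
have ep := solve _ _ _ _ h hp; have ew := solve _ _ _ _ h hw.
have p1 : p 0 0 != 0.
  by case: (col_neq0 p0) => //; rewrite ep; apply: contra => /eqP ->;
    rewrite mulr0 oppr0.
apply: (ext ((p 0 0)^-1 * w 0 0)); first by rewrite mulrA qmulV // mul1r.
by rewrite ew ep mulNr -!mulrA (mulrA (p 0 0)) qmulV // mul1r.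
Qed.

Lemma retr_col_row (p : V2) (q : U2) : retr (p *m q) = qre ((q *m p) 0 0).
Proof.
by rewrite /retr !mul_col_row mul_row_col qreD (qreMC (p 0 0)) (qreMC (p 1 0)).
Qed.

(** If all real traces are bounded by 2, G is unbounded because it fixes no point
    of hyperbolic space. Bounded traces then force q x p = 0 for all x in G,
    where p q is a rank one limit direction: all x map p into the kernel of q,
    which is the line of p, a common fixed point at infinity. *)
Lemma irreducible_loxodromic G : subgroup_SL2H G -> irreducible G ->
  exists2 A, G A & 2 < `|retr A|.
Proof.
move=> [GS G1 GM GV] [I1 I2 _]; apply: contrapT => no.
have tr A : G A -> `|retr A| <= 2.
  by move=> GA; rewrite leNgt; apply/negP => h; apply: no; exists A.
have S1 A : G A -> sqdet A = 1 by move=> /GS /SL2H_sqdet.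
have [[M hM]|hM] := pselect (exists M, forall B, G B -> mxnorm B <= M).
  by have [X pX XG] := bounded_fixes_positive G1 GM S1 hM; apply: I1; exists X.
have [M|p [q [p0 q0 hpq]]] := unbounded_rank1 S1.
  apply: contrapT => h; apply: hM; exists M => B ZB; rewrite leNgt.
  by apply/negP => hB; apply: h; exists B.
(* With E = p q, the real traces of x E and of x E x E are limits of bounded
   traces divided by norms that tend to infinity. They are the real parts of
   q x p and of its square. *)
have z x : G x -> (q *m x *m p) 0 0 = 0.
  move=> Gx; pose F := x * (p *m q); set al := (q *m x *m p) 0 0.
  have FE : F = (x *m p) *m q by rewrite /F -mulmxA.
  have tF : retr F = qre al by rewrite FE retr_col_row mulmxA.
  have tFF : retr (F * F) = qre (al * al).
    have -> : F * F = ((x *m p) *m (q *m x *m p)) *m q.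
      by rewrite -[F * F]/(F *m F) FE !mulmxA.
    by rewrite retr_col_row mulmxA (mulmxA q) mxE big_ord1.
  pose K := mxnorm x * (mxnorm (p *m q) + 1).
  have K0 : 0 <= K by rewrite mulr_ge0 ?addr_ge0 ?mxnorm_ge0.
  have near e : 0 < e -> e <= 1 -> exists B s, [/\ G B, 0 < s, s < e,
      mxnorm (rscale s B - F) <= mxnorm x * e & mxnorm (rscale s B) <= K].
    move=> e0 e1; have [B GB [hB1 hB2]] := hpq e e0.
    have B0 : 0 < mxnorm B by apply: lt_trans hB1; rewrite invr_gt0.
    exists (x * B), (mxnorm B)^-1; split.
    - exact: GM.
    - by rewrite invr_gt0.
    - by rewrite -[e]invrK ltf_pV2 ?posrE ?invr_gt0.
    - rewrite -rscaleAr /F -mulrBr; apply: mxnormM_le => //; exact: ltW.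
    rewrite -rscaleAr; apply: mxnormM_le => //.
      by rewrite addr_ge0 ?mxnorm_ge0.
    have := mxnormD (rscale (mxnorm B)^-1 B - p *m q) (p *m q).
    by rewrite subrK; lra.
  have x0 := mxnorm_ge0 x.
  have r1 : qre al = 0.
    rewrite -tF; apply/eqP; rewrite -normr_eq0 eq_le normr_ge0 andbT.
    apply: (@ler_addM_eps _ _ _ (mxnorm x + 2)); first by lra.
    move=> e' e'0; pose e := Num.min 1 e'.
    have e0 : 0 < e by rewrite lt_min ltr01.
    have e1 : e <= 1 by rewrite ge_min lexx.
    have ee : e <= e' by rewrite ge_min lexx orbT.
    have [B [s [GB s0 se hB _]]] := near e e0 e1.
    have h1 := retr_lip (rscale s B) F; rewrite retr_rscale in h1.
    have h2 : `|s * retr B| <= s * 2.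
      by rewrite normrM gtr0_norm // ler_pM2l // tr.
    have h3 : mxnorm x * e <= mxnorm x * e' by apply: ler_wpM2l.
    have := ler_normB (s * retr B) (s * retr B - retr F).
    rewrite subKr add0r mulrDl; move: h1 h2 h3 se ee hB; move: (mxnorm x * e) (mxnorm x * e').
    by clear=> *; lra.
  have r2 : qre (al * al) = 0.
    rewrite -tFF; apply/eqP; rewrite -normr_eq0 eq_le normr_ge0 andbT.
    have Kx : 0 <= 2 * (K + mxnorm F) * mxnorm x.
      by rewrite !mulr_ge0 // addr_ge0 // mxnorm_ge0.
    apply: (@ler_addM_eps _ _ _ (2 * (K + mxnorm F) * mxnorm x + 2)).
      by rewrite addr_ge0.
    move=> e' e'0; pose e := Num.min 1 e'.
    have e0 : 0 < e by rewrite lt_min ltr01.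
    have e1 : e <= 1 by rewrite ge_min lexx.
    have ee : e <= e' by rewrite ge_min lexx orbT.
    have [B [s [GB s0 se hB hK]]] := near e e0 e1.
    have := retr_lip (rscale s B * rscale s B) (F * F).
    rewrite rscaleAl rscaleAr rscaleA retr_rscale => h1.
    have h2 : `|s * s * retr (B * B)| <= s * 2.
      rewrite normrM gtr0_norm ?mulr_gt0 // -mulrA ler_pM2l //.
      rewrite -[leRHS]mul1r; apply: ler_pM => //; first exact: ltW.
        exact: le_trans (ltW se) e1.
      by apply: tr; apply: GM.
    have h3 : mxnorm (rscale (s * s) (B * B) - F * F) <=
        2 * (K + mxnorm F) * (mxnorm x * e).
      rewrite -rscaleA -rscaleAr -rscaleAl.
      have F0 := mxnorm_ge0 F.
      apply: mxnormM_close => //.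
      - exact: addr_ge0.
      - by rewrite mulr_ge0 // ltW.
      - by apply: le_trans hK _; rewrite lerDl.
      - by rewrite lerDr.
    rewrite mulrA in h3.
    have h4 : 2 * (K + mxnorm F) * mxnorm x * e <=
        2 * (K + mxnorm F) * mxnorm x * e' by apply: ler_wpM2l.
    have := ler_normB (s * s * retr (B * B)) (s * s * retr (B * B) - retr (F * F)).
    rewrite subKr => h5; rewrite add0r mulrDl.
    apply: le_trans h5 _; rewrite addrC; apply: lerD.
      by apply: le_trans h1 _; apply: le_trans h3 _.
    by apply: le_trans h2 _; move: se ee; clear=> *; lra.
  apply/eqP; rewrite -qnormsq_eq0; apply/eqP.
  by move: r1 r2; case: (al) => a b c d; rewrite /qnormsq /= => -> h; lra.
have [x Gx nx] := I2 p p0; apply: nx.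
apply: (kernel_line q0 p0); last by rewrite mulmxA z.
by rewrite -[q]mulmx1 z.
Qed.

End Loxodromic.
(** * Elements near the identity of an indiscrete group *)

Section NearIdentity.
Variable R : realType.
Local Notation M2 := 'M[quat R]_2.
Local Notation V2 := 'M[quat R]_(2, 1).
Implicit Types A B P Q X Y : M2.
Implicit Types v w : V2.
Implicit Type G : set M2.

Definition indiscrete G : Prop :=
  forall e : R, 0 < e -> exists2 k, G k & k != 1 /\ mxnorm (k - 1) < e.

Lemma conj_near P Q (e : R) : mx_inverse P Q -> 0 < e ->
  exists2 d, 0 < d & forall k, mxnorm (k - 1) < d -> mxnorm (Q * k * P - 1) < e.
Proof.
move=> [PQ QP] e0; pose K := mxnorm Q * mxnorm P + 1.
have K0 : 0 < K by rewrite ltr_wpDl // mulr_ge0 // mxnorm_ge0.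
exists (e / K); first exact: divr_gt0.
move=> k; rewrite ltr_pdivlMr // => h.
have -> : Q * k * P - 1 = Q * (k - 1) * P by rewrite mulrBr mulrBl mulr1 QP.
apply: le_lt_trans h; apply: le_trans (mxnormM _ _) _.
apply: le_trans (ler_wpM2r (mxnorm_ge0 _) (mxnormM _ _)) _.
rewrite mulrAC mulrC ler_wpM2l ?mxnorm_ge0 // /K; lra.
Qed.

Lemma indiscrete_conjset P Q G : mx_inverse P Q -> indiscrete G ->
  indiscrete (conjset P Q G).
Proof.
move=> PQ nG e e0; have [d d0 hd] := conj_near PQ e0.
have [k Gk [k1 hk]] := nG d d0; exists (Q * k * P); first exact: conjset_mem.
split; last exact: hd.
apply: contra k1 => /eqP h.
by rewrite -(conjsetK k (mx_inverse_sym PQ)) h mulr1; case: PQ => ->.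
Qed.

Definition germ_fixed G v : Prop :=
  exists2 e : R, 0 < e & forall k, G k -> mxnorm (k - 1) < e -> eigvec k v.

Lemma germ_fixed_mul G A v : subgroup_SL2H G -> G A -> germ_fixed G v ->
  germ_fixed G (A *m v).
Proof.
move=> [_ _ GM GV] GA [e e0 he]; have [B GB AB] := GV _ GA.
have [d d0 hd] := conj_near AB e0; exists d => // k Gk hk.
by apply/(eigvec_conj _ _ AB); apply: he; [exact: GM _ _ (GM _ _ GB Gk) GA|apply: hd].
Qed.

Lemma germ_fixed_conjset G P Q v : mx_inverse P Q -> germ_fixed G (P *m v) ->
  germ_fixed (conjset P Q G) v.
Proof.
move=> PQ [e e0 he]; have [d d0 hd] := conj_near (mx_inverse_sym PQ) e0.
exists d => // k Gk hk; rewrite -(conjsetK k PQ); apply/(eigvec_conj _ _ PQ).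
by apply: he => //; apply: hd.
Qed.

Lemma germ_fixed_scale G v (k : 'M[quat R]_1) : k 0 0 != 0 ->
  germ_fixed G v -> germ_fixed G (v *m k).
Proof.
move=> k0 [e e0 he]; exists e => // x Gx hx.
by apply/eigvec_scale => //; apply: he.
Qed.

(** The matrix with columns v and w is not of rank one, so its determinant is
    nonzero and a real factor normalizes it. *)
Lemma frame_exists v w : v != 0 -> ~ (exists k : 'M[quat R]_1, w = v *m k) ->
  exists P Q (k : 'M[quat R]_1), [/\ sqdet P = 1, mx_inverse P Q, k 0 0 != 0,
    P *m colq 1 0 = v *m k & P *m colq 0 1 = w *m k].
Proof.
move=> v0 vw; pose A := mx2 (v 0 0) (w 0 0) (v 1 0) (w 1 0).
have A0 : A != 0.
  apply: contra v0 => /eqP A0; apply/eqP; apply: col_ext.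
    by have := congr1 (fun A : M2 => A 0 0) A0; rewrite !mxE.
  by have := congr1 (fun A : M2 => A 1 0) A0; rewrite !mxE.
have dA : sqdet A != 0.
  apply/eqP => dA; have [p [q [p0 q0 Apq]]] := sqdet0_rank1 dA A0.
  have e i j : A i j = p i 0 * q 0 j by rewrite Apq mul_col_row.
  have := (e 0 0, e 0 1, e 1 0, e 1 1); rewrite !mx2e => -[[[e1 e2] e3] e4].
  have q00 : q 0 0 != 0.
    apply: contra v0 => /eqP q00; apply/eqP/col_ext.
      by rewrite e1 q00 mulr0 mxE.
    by rewrite e3 q00 mulr0 mxE.
  apply: vw; exists (((q 0 0)^-1 * q 0 1)%:M); apply: col_ext;
    rewrite mul_col_k mxE ?e1 ?e2 ?e3 ?e4 -!mulrA (mulrA (q 0 0)) qmulV // mul1r //.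
have s0 : 0 < sqdet A by rewrite lt_def dA sqdet_ge0.
pose s := Num.sqrt (sqdet A); pose c := (Num.sqrt s)^-1.
have c4 : c ^+ 4 * sqdet A = 1.
  rewrite /c exprVn (exprM _ 2 2) sqr_sqrtr ?sqrtr_ge0 // sqr_sqrtr ?ltW //.
  by rewrite mulVf ?lt0r_neq0.
have sP : sqdet (rscale c A) = 1 by rewrite sqdet_rscale.
have c0 : c != 0.
  by apply/eqP => c0; move/eqP: c4; rewrite c0 expr0n mul0r eq_sym oner_eq0.
have [Q PQ _] := sqdet1_inv sP.
exists (rscale c A), Q, ((qreal c)%:M); split=> //.
- by rewrite mxE; apply: contra c0 => /eqP[->].
- apply: col_ext; rewrite mulmx2E mul_col_k !rscaleE !colqE !mx2e mxE /=;
    by rewrite mulr1 mulr0 addr0 mulr1n -qrealC qrealM.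
- apply: col_ext; rewrite mulmx2E mul_col_k !rscaleE !colqE !mx2e mxE /=;
    by rewrite mulr1 mulr0 add0r mulr1n -qrealC qrealM.
Qed.

(* Irreducibility yields a third fixed point of the germ, off the two axes. Then
   the germ is unitary, and the Hermitian matrices that it fixes form an
   invariant subspace, hence all of them: the germ is trivial. *)
Let germ_axes G : subgroup_SL2H G -> irreducible G -> indiscrete G ->
  germ_fixed G (colq 1 0) -> germ_fixed G (colq 0 1) -> False.
Proof.
move=> sG [_ _ I3] nG f0 f1; have [GS G1 GM GV] := sG.
have S1 A : G A -> sqdet A = 1 by move=> /GS /SL2H_sqdet.
(* Were both axes always mapped to axes, the diagonal Hermitian matrices would
   be invariant. *)
have [u [u0 u1 fu]] : exists u : V2, [/\ u 0 0 != 0, u 1 0 != 0 & germ_fixed G u].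
  apply: contrapT => no.
  have ax A v : G A -> germ_fixed G v -> (A *m v) 0 0 = 0 \/ (A *m v) 1 0 = 0.
    move=> GA fv; have [|h0] := eqVneq ((A *m v) 0 0) 0; first by left.
    have [|h1] := eqVneq ((A *m v) 1 0) 0; first by right.
    by exfalso; apply: no; exists (A *m v); split=> //; apply: germ_fixed_mul.
  have q0 : qconj (0 : quat R) = 0 by apply: quatP; rewrite //= oppr0.
  have [] := I3 [set X | herm X /\ X 0 1 = 0] _ _ _ _ (mx2 0 1 1 0).
  - move=> X Y [hX X0] [hY Y0]; split; first exact: hermD.
    by rewrite mxE X0 Y0 addr0.
  - move=> x X [hX X0]; split; first exact: herm_rscale.
    by rewrite rscaleE X0 scaler0.
  - move=> A X GA [hX X0]; split; first exact: herm_conj.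
    have [_ _ X1] := hermP hX; rewrite X0 q0 in X1.
    rewrite !mul2E !starE X0 X1 !mulr0 addr0 add0r.
    have a0 : A 0 0 * X 0 0 * qconj (A 1 0) = 0.
      case: (ax _ _ GA f0); rewrite mulmx2E !colqE mulr0 addr0 mulr1 => ->.
        by rewrite !mul0r.
      by rewrite q0 mulr0.
    have a1 : A 0 1 * X 1 1 * qconj (A 1 1) = 0.
      case: (ax _ _ GA f1); rewrite mulmx2E !colqE mulr0 add0r mulr1 => ->.
        by rewrite !mul0r.
      by rewrite q0 mulr0.
    by rewrite a0 a1 addr0.
  - by exists 1; [exact: positive1|split; [exact: herm1|rewrite mxE]].
  - have := mx2_hermP (0 : R) 0 (1 : quat R).
    rewrite (_ : qconj 1 = 1) //; by apply: quatP; rewrite //= oppr0.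
  by move=> _; rewrite mx2e => /eqP; rewrite oner_eq0.
(* An eigenvector off the axes forces the two diagonal entries to have the same
   norm. *)
have [e e0 he] : exists2 e : R, 0 < e & forall k, G k -> mxnorm (k - 1) < e ->
    [/\ k = mx2 (k 0 0) 0 0 (k 1 1), `|k 0 0| = 1 & `|k 1 1| = 1].
  have [e1 p1 h1] := f0; have [e2 p2 h2] := f1; have [e3 p3 h3] := fu.
  exists (Num.min e1 (Num.min e2 e3)); first by rewrite !lt_min p1 p2 p3.
  move=> k Gk; rewrite !lt_min => /and3P[/(h1 k Gk) k1 /(h2 k Gk) k2 /(h3 k Gk) k3].
  have k10 : k 1 0 = 0 by apply/eigvec_e0.
  have k01 : k 0 1 = 0.
    move/eigvec_colq: k2 => [c []]; rewrite !mulr0 add0r mulr1 mul0r.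
    by move=> ->.
  have kE : k = mx2 (k 0 0) 0 0 (k 1 1) by rewrite {1}(mx2_eta k) k10 k01.
  have dk : (`|k 0 0| * `|k 1 1|) ^+ 2 = 1 by rewrite -sqdet_diag -kE S1.
  have [c [c0 c1]] : exists c : quat R, k 0 0 * u 0 0 = u 0 0 * c /\
      k 1 1 * u 1 0 = u 1 0 * c.
    move: k3; rewrite [u]colq_eta eigvec_colq !colqE k10 k01 !mul0r addr0.
    by move=> [c]; rewrite add0r; exists c.
  have n (x y z : quat R) : y != 0 -> x * y = y * z -> `|x| = `|z|.
    move=> y0 /(congr1 Num.norm); rewrite !qnormM mulrC.
    by apply: mulfI; rewrite normr_eq0.
  have a := n _ _ _ u0 c0; have b := n _ _ _ u1 c1.
  move: dk; rewrite a b -expr2 -exprM => /eqP; rewrite pexprn_eq1 //= => /eqP c'.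
  by rewrite c'; split.
pose W := [set X | exists2 e : R, 0 < e & forall k, G k -> mxnorm (k - 1) < e ->
  k * X * star k = X].
have full X : herm X -> W X.
  apply: I3.
  - move=> Y Z [e1 p1 h1] [e2 p2 h2]; exists (Num.min e1 e2).
      by rewrite lt_min p1.
    move=> k Gk; rewrite lt_min => /andP[k1 k2].
    by rewrite mulrDr mulrDl h1 // h2.
  - move=> x Y [e1 p1 h1]; exists e1 => // k Gk hk.
    by rewrite rscaleAr rscaleAl h1.
  - move=> A Y GA [e1 p1 h1]; have [B GB AB] := GV _ GA.
    have [d d0 hd] := conj_near AB p1; exists d => // k Gk hk.
    by rewrite (conj_star_mul _ _ AB) h1 //; [exact: GM _ _ (GM _ _ GB Gk) GA|apply: hd].
  exists 1; first exact: positive1.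
  exists e => // k Gk hk; have [kE a1 b1] := he k Gk hk.
  have q0 : qconj (0 : quat R) = 0 by apply: quatP; rewrite //= oppr0.
  rewrite mulr1 kE mx2_one; apply: mx2_ext; rewrite mul2E !starE !mx2e ?q0;
    rewrite ?mulr0 ?mul0r ?addr0 ?add0r // qmul_conj -sqr_qnorm ?a1 ?b1 expr1n;
    exact: quatP.
have herm_off (z : quat R) : herm (mx2 0 z (qconj z) 0).
  exact: (mx2_hermP (0 : R) 0 z).
have [e1 p1 h1] := full _ (herm_off 1).
have [e2 p2 h2] := full _ (herm_off (Quat 0 1 0 0)).
have [e3 p3 h3] := full _ (herm_off (Quat 0 0 1 0)).
have [|k Gk [k1]] := nG (Num.min 1 (Num.min e (Num.min e1 (Num.min e2 e3)))).
  by rewrite !lt_min ltr01 e0 p1 p2 p3.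
rewrite !lt_min => /and5P[l0 l l1 l2 l3].
have [kE _ d1] := he k Gk l.
have off z : k * mx2 0 z (qconj z) 0 * star k = mx2 0 z (qconj z) 0 ->
    k 0 0 * z = z * k 1 1.
  move/(congr1 (fun X : M2 => X 0 1)).
  rewrite kE !mul2E !starE !mx2e !mulr0 !mul0r !add0r !addr0 mul0r add0r => h.
  transitivity (k 0 0 * z * qconj (k 1 1) * k 1 1); last by rewrite h.
  have -> : k 0 0 * z * qconj (k 1 1) * k 1 1 =
      k 0 0 * z * qreal (`|k 1 1| ^+ 2).
    rewrite -mulrA sqr_qnorm; congr (_ * _).
    by apply: quatP; rewrite /qnormsq /=; ring.
  by rewrite d1 expr1n; apply: quatP; rewrite /=; ring.
have o1 := off _ (h1 k Gk l1); have o2 := off _ (h2 k Gk l2).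
have o3 := off _ (h3 k Gk l3).
rewrite mulr1 mul1r in o1.
move: l0; have := mxnorm_entry (k - 1) 0 0; rewrite !mxE /=.
move/le_lt_trans => h /h {h}.
have := qre_le (k 0 0 - 1).
rewrite kE -o1 mx2_one in k1; rewrite -o1 in o2 o3.
move: d1; rewrite -o1; move: o2 o3 k1; case: (k 0 0) => a b c d.
move=> o2 o3 k1 /(congr1 (fun x => x ^+ 2)).
have j1 := congr1 (@qj R) o2; have j2 := congr1 (@qk R) o2.
have j3 := congr1 (@qi R) o3; have j4 := congr1 (@qk R) o3.
rewrite /= in j1 j2 j3 j4 *.
rewrite sqr_qnorm /qnormsq expr1n /= => d1 r1 r2.
have [b0 c0 d0] : [/\ b = 0, c = 0 & d = 0].
  by clear - j1 j2 j3 j4; split; lra.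
subst; move: k1; have -> : a = 1; last by rewrite eqxx.
have : (a - 1) * (a + 1) = 0 by rewrite -subr_sqr; nra.
move/eqP; rewrite mulf_eq0 => /orP[/eqP|/eqP h]; first by lra.
have : a - 1 = -2 by lra.
move=> e'; rewrite e' normrN in r1; have := ger0_norm (ler0n R 2); lra.
Qed.

(** The elements of G near the identity have no common fixed point at
    infinity: all translates of such a point would be of the same kind, and
    elements that fix three points at infinity fix a common point of
    hyperbolic space. *)
Lemma germ_not_fixed G v : subgroup_SL2H G -> irreducible G -> indiscrete G ->
  v != 0 -> ~ germ_fixed G v.
Proof.
move=> sG iG nG v0 fv; have [_ I2 _] := iG.
have [A GA nA] := I2 v v0.
have [P [Q [k [sP PQ k0 Pv Pw]]]] := frame_exists v0 nA.
have fw := germ_fixed_mul sG GA fv.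
apply: (@germ_axes (conjset P Q G)).
- exact: subgroup_conjset.
- exact: irreducible_conjset.
- exact: indiscrete_conjset.
- by apply: germ_fixed_conjset => //; rewrite Pv; apply: germ_fixed_scale.
- by apply: germ_fixed_conjset => //; rewrite Pw; apply: germ_fixed_scale.
Qed.

Lemma near_moves G v (e : R) : subgroup_SL2H G -> irreducible G ->
  indiscrete G -> v != 0 -> 0 < e ->
  exists k, [/\ G k, mxnorm (k - 1) < e & ~ eigvec k v].
Proof.
move=> sG iG nG v0 e0; apply: contrapT => h.
apply: (germ_not_fixed sG iG nG v0); exists e => // k Gk hk.
by apply: contrapT => nk; apply: h; exists k.
Qed.

Definition norm_closure G : set M2 :=
  [set A | forall e : R, 0 < e -> exists2 g, G g & mxnorm (g - A) < e].

Lemma norm_closureM G A B : (forall A B, G A -> G B -> G (A * B)) ->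
  norm_closure G A -> norm_closure G B -> norm_closure G (A * B).
Proof.
move=> GM cA cB e e0; pose K := mxnorm A + mxnorm B + 1.
have := (mxnorm_ge0 A, mxnorm_ge0 B) => -[a0 b0].
have K0 : 0 < K by rewrite /K; lra.
have d0 : 0 < Num.min 1 (e / (3 * K)) by rewrite lt_min ltr01 divr_gt0 // mulr_gt0.
have [g Gg] := cA _ d0; have [h Gh] := cB _ d0.
rewrite !lt_min => /andP[h1 h2] /andP[g1 g2].
exists (g * h); first exact: GM.
have : mxnorm (g * h - A * B) <= 2 * K * (e / (3 * K)).
  apply: mxnormM_close; rewrite ?ltW //.
  - by rewrite divr_gt0 // mulr_gt0.
  - by have := mxnormD (h - B) B; rewrite subrK /K; lra.
  - by rewrite /K; lra.
move/le_lt_trans; apply.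
have -> : 2 * K * (e / (3 * K)) = 2 / 3 * e by field; rewrite gt_eqF.
lra.
Qed.

Lemma norm_closureV G A B : subgroup_SL2H G -> sqdet A = 1 -> mx_inverse A B ->
  norm_closure G A -> norm_closure G B.
Proof.
move=> [GS _ _ GV] A1 AB cA e e0; pose K := (mxnorm A + 1) * (mxnorm B + 1).
have := (mxnorm_ge0 A, mxnorm_ge0 B) => -[a0 b0].
have K0 : 0 < K by rewrite mulr_gt0 //; lra.
have d0 : 0 < Num.min 1 (e / K) by rewrite lt_min ltr01 divr_gt0.
have [g Gg] := cA _ d0; rewrite lt_min => /andP[h1 h2].
have [g' Gg' gg'] := GV g Gg; exists g' => //.
have -> : g' - B = g' * (A - g) * B.
  case: AB gg' => AB _ [_ g'g].
  by rewrite mulrBr mulrBl g'g mul1r -mulrA AB mulr1.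
have g'n : mxnorm g' <= mxnorm A + 1.
  rewrite (mxnorm_inv gg'); last by apply/SL2H_sqdet; apply: GS.
  by have := mxnormD (g - A) A; rewrite subrK; lra.
rewrite ltr_pdivlMr // in h2; apply: le_lt_trans h2.
have h3 : mxnorm (g' * (A - g)) <= (mxnorm A + 1) * mxnorm (g - A).
  by apply: mxnormM_le; rewrite ?mxnorm_ge0 // mxnormBC.
have -> : mxnorm (g - A) * K = (mxnorm A + 1) * mxnorm (g - A) * (mxnorm B + 1).
  by rewrite /K; ring.
by apply: mxnormM_le => //; lra.
Qed.

Lemma norm_closure_conjset P Q G A : norm_closure (conjset P Q G) A ->
  norm_closure G (P * A * Q).
Proof.
move=> cA e e0; pose K := mxnorm P * mxnorm Q + 1.
have K0 : 0 < K by rewrite ltr_wpDl // mulr_ge0 // mxnorm_ge0.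
have [g Gg h] := cA (e / K) (divr_gt0 e0 K0); exists (P * g * Q) => //.
rewrite -mulrBl -mulrBr; rewrite ltr_pdivlMr // in h; apply: le_lt_trans h.
apply: le_trans (mxnormM _ _) _.
apply: le_trans (ler_wpM2r (mxnorm_ge0 _) (mxnormM _ _)) _.
rewrite mulrAC mulrC ler_wpM2l ?mxnorm_ge0 // /K; lra.
Qed.

Lemma powers_unbounded (t b c : R) : 1 < t -> 0 < b -> exists n, c <= b * t ^+ n.
Proof.
move=> t1 b0.
have B n : 1 + n%:R * (t - 1) <= t ^+ n.
  elim: n => [|n IH]; first by rewrite mul0r addr0 expr0.
  rewrite exprS -natr1; have n0 : 0 <= n%:R :> R by [].
  move: (t ^+ n) n%:R IH n0 => x y IH y0.
  have : 0 <= y * (t - 1) ^+ 2 by rewrite mulr_ge0 // sqr_ge0.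
  nra.
have q0 : 0 < b * (t - 1) by rewrite mulr_gt0 //; lra.
have [c0|c0] := ltP c 0; first by exists 0%N; rewrite expr0 mulr1; lra.
exists (Num.bound (c / (b * (t - 1)))).
have := archi_boundP (divr_ge0 c0 (ltW q0)); set N := Num.bound _.
rewrite ltr_pdivrMr // => h; apply: (@le_trans _ _ (b * (1 + N%:R * (t - 1)))).
  by rewrite mulrDr mulr1 (mulrCA b); lra.
by rewrite ler_wpM2l // ltW.
Qed.

(** Conjugating by powers of a loxodromic diag(l, m) expands the upper right
    entry; elements tending to the identity can thus be renormalized to a
    nontrivial translation in the limit. *)
Lemma norm_closure_translation G (l m : quat R) (d : R) : subgroup_SL2H G ->
  G (mx2 l 0 0 m) -> `|l| * `|m| = 1 -> 1 < `|l| ->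
  (forall e : R, 0 < e -> exists k, [/\ G k, mxnorm (k - 1) < e & k 0 1 != 0]) ->
  0 < d -> d <= 1 ->
  exists b, [/\ b != 0, `|b| <= d & norm_closure G (mx2 1 b 0 1)].
Proof.
move=> [GS G1 GM GV] Gg lm l1 hk d0 d1.
have l0 : l != 0 by rewrite -normr_eq0 gt_eqF // (lt_trans ltr01).
have m0 : m != 0.
  by apply/eqP => m0; move/eqP: lm; rewrite m0 normr0 mulr0 eq_sym oner_eq0.
have mi : `|m|^-1 = `|l|.
  by rewrite -[LHS]mul1r -lm mulfK // normr_eq0.
have li : `|l|^-1 = `|m|.
  by rewrite -[LHS]mul1r -lm mulrC mulKf // normr_eq0.
have Gg' : G (mx2 l^-1 0 0 m^-1).
  have [B GB gB] := GV _ Gg; rewrite (_ : mx2 _ _ _ _ = B) //.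
  apply: mx_inverse_uniq gB; split; rewrite mx2_mul mx2_one;
    by rewrite !mulr0 !mul0r !addr0 !add0r ?qmulV ?qmulVl.
pose t := `|l| ^+ 2.
have t1 : 1 < t by rewrite /t expr_gt1.
have t0 : 0 < t by apply: lt_trans t1.
have step j k : G k -> exists k', [/\ G k', `|k' 0 0 - 1| = `|k 0 0 - 1|,
    `|k' 1 1 - 1| = `|k 1 1 - 1|, `|k' 1 0| <= `|k 1 0| &
    `|k' 0 1| = `|k 0 1| * t ^+ j].
  move=> Gk; elim: j => [|j [k' [Gk' a1 a2 a3 a4]]].
    by exists k; split; rewrite // expr0 mulr1.
  exists (mx2 l 0 0 m * k' * mx2 l^-1 0 0 m^-1).
  have cn (x y : quat R) : x != 0 -> `|x * y * x^-1 - 1| = `|y - 1|.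
    move=> x0; have -> : x * y * x^-1 - 1 = x * (y - 1) * x^-1.
      by rewrite mulrBr mulrBl mulr1 qmulV.
    by rewrite !qnormM qnormV mulrAC mulfV ?mul1r // normr_eq0.
  rewrite !mul2E !mx2e !mulr0 !mul0r !addr0 !add0r; split.
  - exact: GM _ _ (GM _ _ Gg Gk') Gg'.
  - by rewrite cn.
  - by rewrite cn.
  - rewrite !qnormM qnormV li; apply: le_trans a3.
    rewrite mulrAC -expr2 -[leRHS]mul1r; apply: ler_wpM2r => //.
    by rewrite expr_le1 // -li invf_le1 ?ltW // (lt_trans ltr01).
  - by rewrite !qnormM qnormV mi a4 exprS /t; ring.
have /choice[u hu] : forall n : nat, exists k', [/\ G k', mxnorm (k' - 1) <= 6,
    [/\ `|k' 0 0 - 1| <= n.+1%:R^-1, `|k' 1 1 - 1| <= n.+1%:R^-1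
    & `|k' 1 0| <= n.+1%:R^-1] & d / t <= `|k' 0 1| <= d].
  move=> n; pose e := Num.min n.+1%:R^-1 (d / t).
  have e0 : 0 < e by rewrite lt_min invr_gt0 ltr0n divr_gt0.
  have [k [Gk hk1 k01]] := hk e e0; move: hk1; rewrite lt_min => /andP[hn hd].
  have en i j : `|(k - 1) i j| <= n.+1%:R^-1.
    exact: le_trans (mxnorm_entry _ _ _) (ltW hn).
  have ed : `|k 0 1| < d / t.
    by have := mxnorm_entry (k - 1) 0 1; rewrite !mxE /= subr0 => h; apply: le_lt_trans hd.
  have b0 : 0 < `|k 0 1| by rewrite normr_gt0.
  case: (ex_minnP (powers_unbounded (d / t) t1 b0)) => j hj jmin.
  have [k' [Gk' a1 a2 a3 a4]] := step j k Gk; exists k'.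
  have := (en 0 0, en 1 0, en 1 1); rewrite !mxE /= subr0 => -[[n1 n2] n3].
  have bd : d / t <= `|k' 0 1| <= d.
    rewrite a4 hj /=; case: j hj jmin {a4} => [|j] hj jmin.
      by move: hj; rewrite expr0 mulr1 leNgt ed.
    rewrite leNgt; apply/negP => h; suff : (j.+1 <= j)%N by rewrite ltnn.
    by apply: jmin; rewrite ler_pdivrMr // -mulrA -exprSr ltW.
  have nn : n.+1%:R^-1 <= 1 :> R by rewrite invf_le1 // ler1n.
  split=> //; last by rewrite a1 a2 (le_trans a3).
  rewrite /mxnorm !mxE /= !subr0 a1 a2; move/andP: bd => [_ bd].
  move: n1 n2 n3 a3 bd nn d1; move: (n.+1%:R^-1) => r.
  by clear=> *; lra.
have uM n : mxnorm (u n) <= 8.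
  have [_ h _ _] := hu n; have := mxnormD (u n - 1) 1.
  by rewrite subrK mxnorm1; lra.
have [L HL] := bounded_cluster uM.
have {}HL e : 0 < e -> exists n, mxnorm (u n - L) < e /\ n.+1%:R^-1 < e.
  move=> e0; have [N _ hN] := near_infty_natSinv_lt (PosNum e0).
  by have [n Nn hn] := HL _ e0 N; exists n; split=> //; exact: (hN n Nn).
have ent i j (x : quat R) : (forall n, `|u n i j - x| <= n.+1%:R^-1) -> L i j = x.
  move=> h; apply/eqP; rewrite -subr_eq0 -normr_eq0 eq_le normr_ge0 andbT.
  apply: (@ler_addM_eps _ _ _ 2) => // e e0; have [n [h1 h2]] := HL e e0.
  have := mxnorm_entry (u n - L) i j; rewrite !mxE => h3.
  have := ler_distD (u n i j) (L i j) x; rewrite (distrC (L i j) (u n i j)).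
  by have := le_lt_trans (h n) h2; lra.
have L00 : L 0 0 = 1 by apply: ent => n; have [_ _ []] := hu n.
have L11 : L 1 1 = 1 by apply: ent => n; have [_ _ []] := hu n.
have L10 : L 1 0 = 0 by apply: ent => n; rewrite subr0; have [_ _ []] := hu n.
have LE : L = mx2 1 (L 0 1) 0 1 by rewrite {1}(mx2_eta L) L00 L11 L10.
exists (L 0 1); split.
- rewrite -normr_gt0; apply: lt_le_trans (divr_gt0 d0 t0) _.
  apply: (@ler_addM_eps _ _ _ 1) => // e e0; have [n [h1 h2]] := HL e e0.
  have := mxnorm_entry (u n - L) 0 1; rewrite !mxE => h3.
  have [_ _ _ /andP[h4 _]] := hu n.
  by have := ler_normD (u n 0 1 - L 0 1) (L 0 1); rewrite subrK; lra.
- apply: (@ler_addM_eps _ _ _ 1) => // e e0; have [n [h1 h2]] := HL e e0.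
  have := mxnorm_entry (u n - L) 0 1; rewrite !mxE => h3.
  have [_ _ _ /andP[_ h4]] := hu n.
  have := ler_normD (L 0 1 - u n 0 1) (u n 0 1); rewrite subrK distrC; lra.
rewrite -LE => e e0; have [n [h1 _]] := HL e e0; exists (u n) => //.
by have [] := hu n.
Qed.

(** The real traces are 2 + Re(bc), 2 - Re(bc) and 2 - Re((bc)^2), and if
    Re(bc) = 0 then Re((bc)^2) < 0. *)
Lemma translations_word (b c : quat R) : b != 0 -> c != 0 ->
  let U := mx2 1 b 0 1 in let U' := mx2 1 (- b) 0 1 in let V := mx2 1 0 c 1 in
  [\/ 2 < retr (U * V), 2 < retr (U' * V) | 2 < retr (U * V * (U' * V))].
Proof.
move=> b0 c0 /=.
have : b * c != 0 by rewrite qmul_eq0 negb_or b0.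
rewrite -qnormsq_eq0 !mx2_mul /retr !mx2e.
move: b c {b0 c0} => [b0 b1 b2 b3] [c0 c1 c2 c3].
set w := (X in qnormsq X); move=> n0.
have np : 0 < qnormsq w by rewrite lt_def n0 qnormsq_ge0.
have [h|h|h] := ltgtP (qre w) 0.
- by constructor 2; move: h; rewrite /w /=; lra.
- by constructor 1; move: h; rewrite /w /=; lra.
constructor 3; rewrite (_ : _ + _ = 2 - (qre w ^+ 2 - (qnormsq w - qre w ^+ 2))).
  rewrite h; nra.
rewrite /w /qnormsq /=; ring.
Qed.

Let mxnorm_mul_near1 A B (d : R) : 0 < d -> d <= 1 -> mxnorm (A - 1) <= 3 * d ->
  mxnorm (B - 1) <= 3 * d -> mxnorm (A * B - 1) <= 18 * d.
Proof.
move=> d0 d1 nA nB.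
have -> : A * B - 1 = (A - 1) * B + (B - 1) by rewrite mulrBl mul1r addrA subrK.
have hB : mxnorm B <= 5 by have := mxnormD (B - 1) 1; rewrite subrK mxnorm1; lra.
have := mxnormD ((A - 1) * B) (B - 1).
have : mxnorm ((A - 1) * B) <= 3 * d * 5 by apply: mxnormM_le.
lra.
Qed.

(** In the frame of a loxodromic element of G, the closure of G contains small
    translations at both fixed points of that element, hence words with real
    trace greater than 2; having such a trace is an open condition. *)
Lemma near_loxodromic G (e : R) : subgroup_SL2H G -> irreducible G ->
  indiscrete G -> 0 < e ->
  exists g, [/\ G g, mxnorm (g - 1) < e & 2 < retr g].
Proof.
move=> sG iG nG e0; have [x Gx trx] := irreducible_loxodromic sG iG.
have x1 : sqdet x = 1 by case: sG => GS _ _ _; apply/SL2H_sqdet; apply: GS.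
have [T [T' [l [m [T1 TT' D lm l1]]]]] := loxodromic_diag x1 trx.
pose H := conjset T T' G.
have sH : subgroup_SL2H H by apply: subgroup_conjset.
have iH : irreducible H by apply: irreducible_conjset.
have nH : indiscrete H by apply: indiscrete_conjset.
have Hg : H (mx2 l 0 0 m) by rewrite -D; apply: conjset_mem.
have [d' d'0 hd'] := conj_near (mx_inverse_sym TT') e0.
pose d := Num.min 1 (d' / 36).
have d0 : 0 < d by rewrite lt_min ltr01 divr_gt0.
have d1 : d <= 1 by rewrite ge_min lexx.
have dd' : d <= d' / 36 by rewrite ge_min lexx orbT.
have [b [b0 bd cU]] : exists b, [/\ b != 0, `|b| <= d
    & norm_closure H (mx2 1 b 0 1)].
  apply: (norm_closure_translation sH Hg lm l1) => // r r0.
  have [k [Hk hk nk]] := near_moves sH iH nH (homog_neq0 (Some 0)) r0.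
  exists k; split=> //; apply/eqP => k01; apply: nk; apply/eigvec_colq.
  by exists (k 1 1); rewrite !mulr0 !mulr1 k01 !add0r mul1r mul0r.
have [c [c0 cd cV]] : exists c, [/\ c != 0, `|c| <= d
    & norm_closure H (mx2 1 0 c 1)].
  have ss : mx_inverse (swap2 R) (swap2 R) by split; exact: swap2K.
  have l0 : l != 0 by rewrite -normr_eq0 gt_eqF // (lt_trans ltr01).
  have m0 : m != 0.
    by apply/eqP => m0; move/eqP: lm; rewrite m0 normr0 mulr0 eq_sym oner_eq0.
  have mi : `|m|^-1 = `|l|.
    by rewrite -[LHS]mul1r -lm mulfK // normr_eq0.
  have [] := @norm_closure_translation (conjset (swap2 R) (swap2 R) H) m^-1 l^-1 d.
  - by apply: subgroup_conjset => //; exact: sqdet_swap2.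
  - rewrite /conjset /= swap2_conj; case: sH => _ _ _ HV.
    have [B HB gB] := HV _ Hg; rewrite (_ : mx2 _ _ _ _ = B) //.
    apply: mx_inverse_uniq gB; split; rewrite mx2_mul mx2_one;
      by rewrite !mulr0 !mul0r !addr0 !add0r ?qmulV ?qmulVl.
  - by rewrite !qnormV -invfM mulrC lm invr1.
  - by rewrite qnormV mi.
  - move=> r r0; have [r' r'0 hr'] := conj_near ss r0.
    have [k [Hk hk nk]] := near_moves sH iH nH (homog_neq0 None) r'0.
    exists (swap2 R * k * swap2 R); split; first exact: conjset_mem.
      exact: hr'.
    rewrite [k in swap2 R * k]mx2_eta swap2_conj mx2e.
    by apply/eqP => k10; apply: nk; apply/eigvec_e0.
  - exact: d0.
  - exact: d1.
  move=> c [c0 cd /norm_closure_conjset]; rewrite swap2_conj => cc.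
  by exists c.
have cU' : norm_closure H (mx2 1 (- b) 0 1).
  apply: norm_closureV cU => //; first by rewrite sqdet_tri qnorm1 mulr1 expr1n.
  by split; rewrite mx2_mul mx2_one !mulr0 !mul0r !mulr1 !mul1r !addr0 ?add0r
    ?addNr ?subrr.
have HM A B : H A -> H B -> H (A * B) by case: sH => _ _ h _; apply: h.
have nUV (y : quat R) : `|y| <= d ->
    mxnorm (mx2 1 y 0 1 * mx2 1 0 c 1 - 1) <= 3 * d.
  move=> yd; rewrite mx2_mul mx2_one /mxnorm !mxE /=.
  rewrite !(mulr1, mul1r, mulr0, mul0r, add0r, addr0, subr0) subrr normr0 addr0.
  rewrite (addrC 1) addrK.
  rewrite qnormM; have : `|y| * `|c| <= d * 1.
    by apply: ler_pM => //; apply: le_trans d1.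
  lra.
have nU : mxnorm (mx2 1 b 0 1 * mx2 1 0 c 1 - 1) <= 3 * d by apply: nUV.
have nU' : mxnorm (mx2 1 (- b) 0 1 * mx2 1 0 c 1 - 1) <= 3 * d.
  by apply: nUV; rewrite normrN.
have cUV := norm_closureM HM cU cV; have cU'V := norm_closureM HM cU' cV.
have [W [cW trW nW]] : exists W, [/\ norm_closure H W, 2 < retr W
    & mxnorm (W - 1) <= 18 * d].
  have d18 : 3 * d <= 18 * d by rewrite ler_pM2r // ler_nat.
  have [h|h|h] := translations_word b0 c0.
  - exists (mx2 1 b 0 1 * mx2 1 0 c 1); split=> //; exact: le_trans nU d18.
  - exists (mx2 1 (- b) 0 1 * mx2 1 0 c 1); split=> //; exact: le_trans nU' d18.
  exists (mx2 1 b 0 1 * mx2 1 0 c 1 * (mx2 1 (- b) 0 1 * mx2 1 0 c 1)); split.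
  - exact: (norm_closureM HM cUV cU'V).
  - exact: h.
  exact: (mxnorm_mul_near1 d0 d1 nU nU').
have r0 : 0 < Num.min (retr W - 2) (d' / 3).
  by rewrite lt_min divr_gt0 // andbT subr_gt0.
have [g Hg' ] := cW _ r0; rewrite lt_min => /andP[h1 h2].
exists (T * g * T'); split=> //.
  apply: hd'; move: h2 nW dd' (mxnorm_tri g W 1) d'0; move: (d) (d') => r r'.
  by clear=> *; lra.
rewrite retr_conj; last exact: mx_inverse_sym.
have := retr_lip g W; rewrite ler_norml => /andP[h3 _].
by move: h1 h3 trW; clear=> *; lra.
Qed.

(** Multiplying by further elements near the identity, which can be chosen to
    move 0 or infinity, breaks the coincidences without leaving the open set. *)
Lemma near_loxodromic_generic G (e : R) : subgroup_SL2H G -> irreducible G ->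
  indiscrete G -> 0 < e ->
  exists g, [/\ G g, mxnorm (g - 1) < e, 2 < retr g, g 0 1 != 0 & g 1 0 != 0].
Proof.
move=> sG iG nG e0; have [GS _ GM _] := sG.
have nz A : G A -> (A 0 1 = 0 -> A 0 0 != 0) /\ (A 1 0 = 0 -> A 1 1 != 0).
  move=> /GS /SL2H_sqdet /sqdet_abs[_ h1]; split=> h; apply/eqP => h';
    by move: h1; rewrite h h' normr0 ?mul0r ?mulr0 addr0 ler10.
have pert A : G A -> mxnorm (A - 1) < e -> 2 < retr A ->
    forall r : R, 0 < r -> exists2 d, 0 < d & forall k, mxnorm (k - 1) < d ->
    [/\ mxnorm (A * k - 1) < e, 2 < retr (A * k) & mxnorm (A * k - A) < r].
  move=> GA hA tA r r0.
  pose s := Num.min r (Num.min (e - mxnorm (A - 1)) (retr A - 2)).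
  have s0 : 0 < s by rewrite !lt_min r0 !subr_gt0 hA tA.
  have K0 : 0 < mxnorm A + 1 by rewrite ltr_wpDl // mxnorm_ge0.
  exists (s / (mxnorm A + 1)); first exact: divr_gt0.
  move=> k; rewrite ltr_pdivlMr // => hk.
  have : mxnorm (A * k - A) < s.
    rewrite -{2}[A]mulr1 -mulrBr; apply: le_lt_trans (mxnormM _ _) _.
    have := mxnorm_ge0 (k - 1); lra.
  rewrite !lt_min => /and3P[h1 h2 h3]; split=> //.
    by have := mxnorm_tri (A * k) A 1; lra.
  have := retr_lip (A * k) A; rewrite ler_norml => /andP[]; lra.
have [g0 [Gg0 h0 t0]] := near_loxodromic sG iG nG e0.
have [g1 [Gg1 h1 t1 g10]] : exists g, [/\ G g, mxnorm (g - 1) < e, 2 < retr g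
    & g 1 0 != 0].
  have [c0|c0] := eqVneq (g0 1 0) 0; last by exists g0.
  have [d d0 hd] := pert g0 Gg0 h0 t0 1 ltr01.
  have [k [Gk hk nk]] := near_moves sG iG nG (homog_neq0 None) d0.
  have [a1 a2 _] := hd k hk; exists (g0 * k); split=> //; first exact: GM.
  rewrite mul2E c0 mul0r add0r qmul_eq0 negb_or (nz _ Gg0).2 //=.
  by apply/eqP => k10; apply: nk; apply/eigvec_e0.
have [b0|b0] := eqVneq (g1 0 1) 0; last by exists g1.
have r0 : 0 < `|g1 1 0| by rewrite normr_gt0.
have [d d0 hd] := pert g1 Gg1 h1 t1 _ r0.
have [k [Gk hk nk]] := near_moves sG iG nG (homog_neq0 (Some 0)) d0.
have [a1 a2 a3] := hd k hk; exists (g1 * k); split=> //; first exact: GM.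
  rewrite mul2E b0 mul0r addr0 qmul_eq0 negb_or (nz _ Gg1).1 //=.
  apply/eqP => k01; apply: nk; apply/eigvec_colq.
  by exists (k 1 1); rewrite !mulr0 !mulr1 k01 !add0r mul1r mul0r.
apply/eqP => z; have := mxnorm_entry (g1 * k - g1) 1 0.
by rewrite mxE z mxE sub0r normrN leNgt a3.
Qed.

End NearIdentity.
(** * Jorgensen and Shimizu type inequalities *)

Section Inequalities.
Variable R : realType.
Local Notation M2 := 'M[quat R]_2.
Implicit Types A B P Q X Y g h : M2.
Implicit Types l m q : quat R.
Implicit Type H : set M2.

Definition gap_at_identity H : Prop :=
  exists2 e : R, 0 < e & forall k, H k -> mxnorm (k - 1) < e -> k = 1.

(** A discrete group has finitely many elements in a ball, so that the lower
    left entry cannot be nonzero and arbitrarily small there. *)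
Lemma gap_entry H (M : R) : subgroup_SL2H H -> gap_at_identity H ->
  exists2 d : R, 0 < d & forall h, H h -> mxnorm h <= M -> h 1 0 != 0 ->
    d <= `|h 1 0|.
Proof.
move=> [HS _ HM HV] [e e0 he]; apply: contrapT => no.
have /choice[u hu] : forall n : nat, exists h, [/\ H h, mxnorm h <= M, h 1 0 != 0
    & `|h 1 0| < n.+1%:R^-1].
  move=> n; apply: contrapT => h; apply: no; exists (n.+1%:R^-1).
    by rewrite invr_gt0.
  move=> k Hk kM k0; rewrite leNgt; apply/negP => kn; apply: h.
  by exists k.
have [L HL] : exists L, forall e, 0 < e -> forall j, exists2 n, (j <= n)%N &
    mxnorm (u n - L) < e.
  by apply: (@bounded_cluster _ u M) => n; have [] := hu n.
have M0 : 0 < M + 1.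
  by have [_ h _ _] := hu 0%N; have := mxnorm_ge0 (u 0%N); lra.
pose r := e / (M + 1) / 2.
have r0 : 0 < r by rewrite !divr_gt0.
have [n _ hn] := HL r r0 0%N; have [Hn nM n0 _] := hu n.
have c0 : 0 < `|u n 1 0| by rewrite normr_gt0.
have [N _ hN] := near_infty_natSinv_lt (PosNum c0).
have [k Nk hk] := HL r r0 N; have [Hk _ _ kn] := hu k.
have [v Hv nv] := HV _ Hn.
have n1 : sqdet (u n) = 1 by apply/SL2H_sqdet; apply: HS.
have : mxnorm (v * u k - 1) < e.
  apply: (mxnorm_mulV_lt nv M0); first by rewrite (mxnorm_inv nv n1); lra.
  have := mxnorm_tri (u k) L (u n); rewrite (mxnormBC L).
  have -> : e / (M + 1) = r + r by rewrite /r; field; rewrite gt_eqF.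
  lra.
move/(he _ (HM _ _ Hv Hk)) => vk.
have uk : u k = u n by case: nv => nv _; rewrite -[LHS]mul1r -nv -mulrA vk mulr1.
have := lt_trans kn (hN k Nk); rewrite uk /= ltxx //.
Qed.

(** One step of the iteration g, g f g^-1. Factoring the off-diagonal entries
    of g f g^-1 through l q - q m makes the contraction visible. *)
Lemma jorgensen_step l m (K : R) g g' : mx_inverse g g' -> sqdet g = 1 ->
  (forall q, `|l * q - q * m| <= K * `|q|) ->
  (forall q, q != 0 -> l * q != q * m) ->
  g 0 0 != 0 -> g 0 1 != 0 -> g 1 0 != 0 -> g 1 1 != 0 ->
  let h := g * mx2 l 0 0 m * g' in
  [/\ h 0 1 != 0 /\ `|h 0 1| <= K * `|g 0 0| * `|g 0 1|,
      h 1 0 != 0 /\ `|h 1 0| <= K * `|g 1 1| * `|g 1 0|,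
      `|h 0 0| <= `|l| * (`|g 0 0| * `|g 1 1|) + `|m| * (`|g 0 1| * `|g 1 0|) &
      `|h 1 1| <= `|m| * (`|g 0 0| * `|g 1 1|) + `|l| * (`|g 0 1| * `|g 1 0|)].
Proof.
move=> gg' g1 hK hlm a0 b0 c0 d0 h.
have [n00 n01 n10 n11] := inv_entry_norm gg' g1.
have [gE _] := gg'.
have e i j : g i 0 * g' 0 j + g i 1 * g' 1 j = (1 : M2) i j by rewrite -mul2E gE.
have hE i j : h i j = g i 0 * l * g' 0 j + g i 1 * m * g' 1 j.
  by rewrite /h !mul2E !mx2e !mulr0 addr0 add0r.
have fact (a b x y : quat R) : a != 0 -> a * x + b * y = 0 ->
    a * l * x + b * m * y = - (a * (l * (a^-1 * b) - (a^-1 * b) * m) * y).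
  move=> z0 /eqP; rewrite addr_eq0 => /eqP z.
  have -> : x = - (a^-1 * b * y) by rewrite -mulrA -mulrN -z mulrA qmulVl // mul1r.
  rewrite mulrBr mulrBl opprB !mulrN !mulrA qmulV // mul1r addrC //.
have nz (a b : quat R) : a != 0 -> b != 0 -> a^-1 * b != 0.
  by move=> z1 z2; rewrite qmul_eq0 negb_or z2 andbT invr_eq0.
have bd (a b y : quat R) (n : R) : a != 0 -> b != 0 -> `|y| = n ->
    `|- (a * (l * (a^-1 * b) - (a^-1 * b) * m) * y)| <= K * `|b| * n.
  move=> z1 z2 <-; rewrite normrN !qnormM; apply: ler_wpM2r => //.
  apply: le_trans (ler_wpM2l (normr_ge0 a) (hK _)) _.
  by rewrite mulrCA qnormM qnormV mulVKf ?normr_eq0.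
have ne (a b y : quat R) : a != 0 -> b != 0 -> y != 0 ->
    - (a * (l * (a^-1 * b) - (a^-1 * b) * m) * y) != 0.
  move=> z1 z2 z3; rewrite oppr_eq0 !qmul_eq0 !negb_or z1 z3 andbT subr_eq0.
  by apply: hlm; apply: nz.
have nn (a b : quat R) : `|a| = `|b| -> b != 0 -> a != 0.
  by move=> ab; rewrite -(normr_eq0 a) ab normr_eq0.
have h01 : h 0 1 = - (g 0 0 * (l * ((g 0 0)^-1 * g 0 1)
    - ((g 0 0)^-1 * g 0 1) * m) * g' 1 1).
  by rewrite hE fact // e mxE.
have h10 : h 1 0 = - (g 1 0 * (l * ((g 1 0)^-1 * g 1 1)
    - ((g 1 0)^-1 * g 1 1) * m) * g' 1 0).
  by rewrite hE fact // e mxE.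
split.
- rewrite h01; split; first by apply: ne => //; apply: nn n11 _.
  by rewrite mulrAC; apply: bd.
- rewrite h10; split; first by apply: ne => //; apply: nn n10 _.
  exact: bd.
- rewrite hE; apply: le_trans (ler_normD _ _) _; rewrite !qnormM n00 n10.
  have -> : `|g 0 0| * `|l| * `|g 1 1| = `|l| * (`|g 0 0| * `|g 1 1|) by ring.
  by have -> : `|g 0 1| * `|m| * `|g 1 0| = `|m| * (`|g 0 1| * `|g 1 0|) by ring.
rewrite hE; apply: le_trans (ler_normD _ _) _; rewrite !qnormM n01 n11 addrC.
have -> : `|g 1 1| * `|m| * `|g 0 0| = `|m| * (`|g 0 0| * `|g 1 1|) by ring.
by have -> : `|g 1 0| * `|l| * `|g 0 1| = `|l| * (`|g 0 1| * `|g 1 0|) by ring.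
Qed.

(** The off-diagonal entries of conjugates of diag(l, m) are products with factors
    l q - q m: the bound makes them decrease, the last clause keeps them from
    vanishing. *)
Definition twist_lt l m (K : R) : Prop := [/\ `|l| * `|m| = 1,
  forall q, `|l * q - q * m| <= K * `|q| & forall q, q != 0 -> l * q != q * m].

Lemma twist_inv l m K : twist_lt l m K -> twist_lt l^-1 m^-1 K.
Proof.
move=> [lm hK hlm].
have l0 : l != 0.
  by apply/eqP => l0; move/eqP: lm; rewrite l0 normr0 mul0r eq_sym oner_eq0.
have m0 : m != 0.
  by apply/eqP => m0; move/eqP: lm; rewrite m0 normr0 mulr0 eq_sym oner_eq0.
have e q : l^-1 * q - q * m^-1 = - (l^-1 * (l * q - q * m) * m^-1).
  rewrite mulrBr mulrBl opprB !mulrA qmulVl // mul1r -!mulrA qmulV // mulr1 //.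
split=> [|q|q q0].
- by rewrite !qnormV -invfM lm invr1.
- rewrite e normrN !qnormM !qnormV mulrAC -invfM lm invr1 mul1r; exact: hK.
rewrite -subr_eq0 e oppr_eq0 !qmul_eq0 !negb_or subr_eq0 hlm //.
by rewrite !invr_eq0 l0 m0.
Qed.

(* The value of C absorbs the off-diagonal contributions |m| x and |l| x, because
   |m| = |l| |m|^2 and |l| = |m| |l|^2. *)
Let step_bounds l m (K C x s : R) H g : subgroup_SL2H H -> H (mx2 l 0 0 m) ->
  twist_lt l m K -> 0 <= K -> C = 1 + `|l| ^+ 2 + `|m| ^+ 2 -> 0 < x -> x <= 2^-1 ->
  s = 1 + C * x ->
  H g -> g 0 1 != 0 -> g 1 0 != 0 -> `|g 0 1| * `|g 1 0| <= x ->
  exists h, [/\ H h, h 0 1 != 0 /\ `|h 0 1| <= K * `|g 0 0| * `|g 0 1|,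
    h 1 0 != 0 /\ `|h 1 0| <= K * `|g 1 1| * `|g 1 0|,
    `|h 0 0| <= s * `|l| & `|h 1 1| <= s * `|m| ].
Proof.
move=> [HS _ HM HV] Hf [lm hK hlm] K0 CE x0 x1 sE Hg b0 c0 bc.
have [g' Hg' gg'] := HV _ Hg.
have g1 : sqdet g = 1 by apply/SL2H_sqdet; apply: HS.
have [] := sqdet_abs g1; rewrite ler_norml => /andP[_ h1] h2.
have ad0 : 0 < `|g 0 0| * `|g 1 1| by lra.
have a0 : g 0 0 != 0.
  by apply/eqP => a0; move: ad0; rewrite a0 normr0 mul0r ltxx.
have d0 : g 1 1 != 0.
  by apply/eqP => d0; move: ad0; rewrite d0 normr0 mulr0 ltxx.
have [h01 h10 h00 h11] := jorgensen_step gg' g1 hK hlm a0 b0 c0 d0.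
have ad1 : `|g 0 0| * `|g 1 1| <= 1 + x by lra.
exists (g * mx2 l 0 0 m * g'); split=> //.
- exact: HM _ _ (HM _ _ Hg Hf) Hg'.
- apply: le_trans h00 _.
  have i1 := ler_wpM2l (normr_ge0 l) ad1; have i2 := ler_wpM2l (normr_ge0 m) bc.
  apply: le_trans (lerD i1 i2) _; rewrite sE CE.
  have -> : (1 + (1 + `|l| ^+ 2 + `|m| ^+ 2) * x) * `|l| =
      `|l| * (1 + x) + `|m| * x * (`|l| * `|m|) + `|l| ^+ 3 * x by ring.
  by rewrite lm mulr1 lerDl mulr_ge0 ?exprn_ge0 // ltW.
apply: le_trans h11 _.
have i1 := ler_wpM2l (normr_ge0 m) ad1; have i2 := ler_wpM2l (normr_ge0 l) bc.
apply: le_trans (lerD i1 i2) _; rewrite sE CE.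
have -> : (1 + (1 + `|l| ^+ 2 + `|m| ^+ 2) * x) * `|m| =
    `|m| * (1 + x) + `|l| * x * (`|l| * `|m|) + `|m| ^+ 3 * x by ring.
by rewrite lm mulr1 lerDl mulr_ge0 ?exprn_ge0 // ltW.
Qed.

(** The common shape of the inequalities of Jorgensen and Shimizu. The bound does
    not depend on the group, since in the application the group is generated by
    f and g. *)
Definition expels_near_identity f : Prop :=
  exists2 e : R, 0 < e & forall H g, subgroup_SL2H H -> H f -> H g ->
    mxnorm (g - 1) < e -> g 0 1 != 0 -> g 1 0 != 0 -> ~ gap_at_identity H.

(** A quaternionic Jorgensen inequality. Conjugating alternately f^-1 and f
    keeps the diagonal entries at the sizes of those of f^-1 and f, so that the
    growth by |l| is compensated at the next step, and both off-diagonal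
    entries tend to zero without vanishing. *)
Lemma jorgensen l m K : twist_lt l m K -> 0 <= K -> K < 1 ->
  expels_near_identity (mx2 l 0 0 m).
Proof.
move=> tw K0 K1; have [lm _ _] := tw.
pose C := 1 + `|l| ^+ 2 + `|m| ^+ 2.
have C1 : 1 <= C.
  by rewrite /C -addrA lerDl addr_ge0 ?exprn_ge0.
have C0 : 0 < C by lra.
pose x := Num.min 2^-1 ((1 - K) / (2 * C)).
have x0 : 0 < x by rewrite lt_min invr_gt0 ltr0n divr_gt0 ?subr_gt0 ?mulr_gt0.
have x1 : x <= 2^-1 by rewrite ge_min lexx.
have xC : C * x <= (1 - K) / 2.
  have : x <= (1 - K) / (2 * C) by rewrite ge_min lexx orbT.
  rewrite ler_pdivlMr ?mulr_gt0 // ler_pdivlMr // => h.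
  by rewrite (_ : C * x * 2 = x * (2 * C)) //; ring.
pose s := 1 + C * x; pose r := (1 + K) / 2.
have s0 : 0 < s by rewrite /s ltr_wpDr // mulr_ge0 // ltW.
have Ks : K * s <= r.
  have : K * (C * x) <= 1 * (C * x) by rewrite ler_pM2r ?mulr_gt0 // ltW.
  by rewrite /s /r mulrDr mulr1 mul1r; lra.
have r0 : 0 < r by rewrite /r; lra.
have r1 : r < 1 by rewrite /r; lra.
have l0 : 0 < `|l|.
  rewrite lt_def normr_ge0 andbT; apply/eqP => l0.
  by move/eqP: lm; rewrite l0 mul0r eq_sym oner_eq0.
have m0 : 0 < `|m|.
  rewrite lt_def normr_ge0 andbT; apply/eqP => m0.
  by move/eqP: lm; rewrite m0 mulr0 eq_sym oner_eq0.
have li : `|l|^-1 = `|m| by rewrite -[LHS]mul1r -lm mulrC mulKf // gt_eqF.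
have mi : `|m|^-1 = `|l| by rewrite -[LHS]mul1r -lm mulfK // gt_eqF.
exists x => // H g sH Hf Hg hg b0 c0 gap; have [_ _ HM HV] := sH.
have Hf' : H (mx2 l^-1 0 0 m^-1).
  have [B HB gB] := HV _ Hf; rewrite (_ : mx2 _ _ _ _ = B) //.
  apply: mx_inverse_uniq gB; split; rewrite mx2_mul mx2_one;
    by rewrite !mulr0 !mul0r !addr0 !add0r ?qmulV ?qmulVl // -normr_gt0.
(* The factors |l| and |m| of the two steps cancel. *)
have double y : H y -> y 0 1 != 0 -> y 1 0 != 0 -> `|y 0 1| * `|y 1 0| <= x ->
    `|y 0 0| <= s * `|l| -> `|y 1 1| <= s * `|m| ->
    exists k, [/\ H k, k 0 1 != 0 /\ `|k 0 1| <= r ^+ 2 * `|y 0 1|,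
      k 1 0 != 0 /\ `|k 1 0| <= r ^+ 2 * `|y 1 0|,
      `|k 0 0| <= s * `|l| & `|k 1 1| <= s * `|m|].
  move=> Hy yb yc bc a1 d1.
  have CE' : C = 1 + `|l^-1| ^+ 2 + `|m^-1| ^+ 2.
    by rewrite !qnormV li mi /C addrAC.
  have [h [Hh [hb hb1] [hc hc1] ha hd]] :=
    step_bounds sH Hf' (twist_inv tw) K0 CE' x0 x1 erefl Hy yb yc bc.
  rewrite qnormV li in ha; rewrite qnormV mi in hd.
  have hb2 : `|h 0 1| <= r * `|l| * `|y 0 1|.
    apply: le_trans hb1 _; apply: ler_wpM2r => //.
    apply: le_trans (ler_wpM2l K0 a1) _; rewrite mulrA; exact: ler_wpM2r.
  have hc2 : `|h 1 0| <= r * `|m| * `|y 1 0|.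
    apply: le_trans hc1 _; apply: ler_wpM2r => //.
    apply: le_trans (ler_wpM2l K0 d1) _; rewrite mulrA; exact: ler_wpM2r.
  have hbc : `|h 0 1| * `|h 1 0| <= x.
    apply: le_trans bc; apply: le_trans (ler_pM _ _ hb2 hc2) _ => //.
    have -> : r * `|l| * `|y 0 1| * (r * `|m| * `|y 1 0|) =
      (`|l| * `|m|) * r ^+ 2 * (`|y 0 1| * `|y 1 0|) by ring.
    rewrite lm mul1r ler_piMl ?mulr_ge0 //.
    by rewrite expr_le1 // ltW.
  have [k [Hk [kb kb1] [kc kc1] ka kd]] :=
    step_bounds sH Hf tw K0 erefl x0 x1 erefl Hh hb hc hbc.
  exists k; split=> //; split=> //.
    apply: le_trans kb1 _.
    have i1 : K * `|h 0 0| <= r * `|m|.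
      apply: le_trans (ler_wpM2l K0 ha) _; rewrite mulrA; exact: ler_wpM2r.
    apply: le_trans (ler_pM _ _ i1 hb2) _ => //; first by rewrite mulr_ge0.
    have -> : r * `|m| * (r * `|l| * `|y 0 1|) =
      (`|l| * `|m|) * r ^+ 2 * `|y 0 1| by ring.
    by rewrite lm mul1r.
  apply: le_trans kc1 _.
  have i1 : K * `|h 1 1| <= r * `|l|.
    apply: le_trans (ler_wpM2l K0 hd) _; rewrite mulrA; exact: ler_wpM2r.
  apply: le_trans (ler_pM _ _ i1 hc2) _ => //; first by rewrite mulr_ge0.
  have -> : r * `|l| * (r * `|m| * `|y 1 0|) =
    (`|l| * `|m|) * r ^+ 2 * `|y 1 0| by ring.
  by rewrite lm mul1r.
have gb : `|g 0 1| <= x.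
  have := mxnorm_entry (g - 1) 0 1; rewrite !mxE /= subr0 => h.
  by apply: le_trans h (ltW hg).
have gc : `|g 1 0| <= x.
  have := mxnorm_entry (g - 1) 1 0; rewrite !mxE /= subr0 => h.
  by apply: le_trans h (ltW hg).
have gbc : `|g 0 1| * `|g 1 0| <= x.
  apply: le_trans (ler_pM _ _ gb gc) _ => //.
  by rewrite ler_piMl // ?ltW //; lra.
have [h [Hh [hb hb1] [hc hc1] ha hd]] :=
  step_bounds sH Hf tw K0 erefl x0 x1 erefl Hg b0 c0 gbc.
have hbc : `|h 0 1| * `|h 1 0| <= x.
  have g1 : sqdet g = 1 by case: sH => HS _ _ _; apply/SL2H_sqdet; apply: HS.
  have [] := sqdet_abs g1; rewrite ler_norml => /andP[_ i1] _.
  have ad : `|g 0 0| * `|g 1 1| <= 1 + x by lra.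
  apply: le_trans (ler_pM _ _ hb1 hc1) _ => //.
  have -> : K * `|g 0 0| * `|g 0 1| * (K * `|g 1 1| * `|g 1 0|) =
    (K ^+ 2 * (`|g 0 0| * `|g 1 1|)) * (`|g 0 1| * `|g 1 0|) by ring.
  apply: le_trans gbc; rewrite ler_piMl ?mulr_ge0 //.
  have sx : 1 + x <= s by rewrite /s lerD2l ler_peMl // ltW.
  apply: le_trans (ler_wpM2l _ (le_trans ad sx)) _; first exact: exprn_ge0.
  rewrite expr2 -mulrA; apply: le_trans (ler_pM _ _ (ltW K1) Ks) _ => //.
    by rewrite mulr_ge0 // ltW.
  by rewrite mul1r ltW.
pose B := `|h 0 1| + `|h 1 0|.
have iter n : exists k, [/\ H k, k 0 1 != 0 /\ `|k 0 1| <= (r ^+ 2) ^+ n * `|h 0 1|,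
    k 1 0 != 0 /\ `|k 1 0| <= (r ^+ 2) ^+ n * `|h 1 0|,
    `|k 0 0| <= s * `|l| & `|k 1 1| <= s * `|m|].
  elim: n => [|n [k [Hk [kb kb1] [kc kc1] ka kd]]].
    by exists h; split; rewrite // expr0 mul1r.
  have q1 : (r ^+ 2) ^+ n <= 1 by rewrite !exprn_ile1 // ?exprn_ge0 // ltW.
  have kbc : `|k 0 1| * `|k 1 0| <= x.
    apply: le_trans hbc; apply: ler_pM => //.
      by apply: le_trans kb1 _; rewrite ler_piMl.
    by apply: le_trans kc1 _; rewrite ler_piMl.
  have [k' [Hk' [kb' kb1'] [kc' kc1'] ka' kd']] := double k Hk kb kc kbc ka kd.
  have r20 : 0 <= r ^+ 2 by rewrite exprn_ge0 // ltW.
  exists k'; split=> //; split=> //; rewrite exprS -mulrA.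
    by apply: le_trans kb1' _; apply: ler_wpM2l.
  by apply: le_trans kc1' _; apply: ler_wpM2l.
have [d d0 hd'] := gap_entry (s * `|l| + s * `|m| + B) sH gap.
have rV : 1 < (r ^+ 2)^-1 by rewrite invf_gt1 ?exprn_gt0 // expr_lt1 // ltW.
have [n hn] := powers_unbounded (`|h 1 0| / d + 1) rV ltr01.
have [k [Hk [kb kb1] [kc kc1] ka kd]] := iter n.
have q0 : 0 < (r ^+ 2) ^+ n by rewrite !exprn_gt0.
have q1 : (r ^+ 2) ^+ n <= 1 by rewrite !exprn_ile1 // ?exprn_ge0 // ltW.
have kM : mxnorm k <= s * `|l| + s * `|m| + B.
  have j1 : `|k 0 1| <= `|h 0 1| by apply: le_trans kb1 _; rewrite ler_piMl.
  have j2 : `|k 1 0| <= `|h 1 0| by apply: le_trans kc1 _; rewrite ler_piMl.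
  rewrite /mxnorm /B; move: ka kd j1 j2.
  by move: (s * `|l|) (s * `|m|); clear=> *; lra.
have := hd' k Hk kM kc; rewrite leNgt => /negP; apply.
apply: le_lt_trans kc1 _; rewrite mulrC -ltr_pdivlMr //.
have : `|h 1 0| / d < ((r ^+ 2) ^+ n)^-1.
  by apply: lt_le_trans (_ : `|h 1 0| / d + 1 <= _); rewrite ?ltrDl // -exprVn -[leRHS]mul1r.
rewrite ltr_pdivrMr // => h1.
by rewrite ltr_pdivlMr // mulrC -ltr_pdivlMl // (mulrC _^-1).
Qed.

(** Shimizu's lemma: conjugating the translation by g squares the lower left
    entry. *)
Lemma shimizu (mu : quat R) : mu != 0 -> `|mu| <= 1 ->
  expels_near_identity (mx2 1 mu 0 1).
Proof.
move=> mu0 mu1; exists 4^-1; first by rewrite invr_gt0.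
move=> H g [HS H1 HM HV] Hf Hg hg _ c0 gap.
have step y : H y -> y 1 0 != 0 -> `|y 1 0| <= 4^-1 -> `|y 0 0| <= 2 ->
    `|y 1 1| <= 2 -> exists k, [/\ H k,
      k 1 0 != 0 /\ `|k 1 0| <= 4^-1 * `|y 1 0|,
      `|k 0 0| <= 2, `|k 1 1| <= 2 & `|k 0 1| <= 4].
  move=> Hy yc c1 a1 d1; have [y' Hy' yy'] := HV _ Hy.
  have y1 : sqdet y = 1 by apply/SL2H_sqdet; apply: HS.
  have [n00 n01 n10 n11] := inv_entry_norm yy' y1; have [yE _] := yy'.
  have e i j : y i 0 * y' 0 j + y i 1 * y' 1 j = (1 : M2) i j by rewrite -mul2E yE.
  have kE i j : (y * mx2 1 mu 0 1 * y') i j = (1 : M2) i j + y i 0 * mu * y' 1 j.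
    rewrite !mul2E !mx2e mulr1 mulr0 addr0 mulr1 mulrDl addrCA e addrC //.
  exists (y * mx2 1 mu 0 1 * y'); rewrite !kE !mxE /= !add0r; split.
  - exact: HM _ _ (HM _ _ Hy Hf) Hy'.
  - rewrite !qnormM n10; split.
      by rewrite !qmul_eq0 !negb_or yc mu0 -normr_eq0 n10 normr_eq0.
    apply: ler_wpM2r => //; apply: le_trans c1.
    by rewrite -[leRHS]mulr1; apply: ler_wpM2l.
  - apply: le_trans (ler_normD _ _) _; rewrite qnorm1 !qnormM n10.
    have : `|y 0 0| * `|mu| <= 2 * 1 by apply: ler_pM.
    move=> h; have : `|y 0 0| * `|mu| * `|y 1 0| <= 2 * 1 * 4^-1 by apply: ler_pM; rewrite ?mulr_ge0.
    lra.
  - apply: le_trans (ler_normD _ _) _; rewrite qnorm1 !qnormM n11.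
    have : `|y 1 0| * `|mu| <= 4^-1 * 1 by apply: ler_pM.
    move=> h; have : `|y 1 0| * `|mu| * `|y 0 0| <= 4^-1 * 1 * 2 by apply: ler_pM; rewrite ?mulr_ge0.
    lra.
  rewrite !qnormM n11; have : `|y 0 0| * `|mu| <= 2 * 1 by apply: ler_pM.
  move=> h; have : `|y 0 0| * `|mu| * `|y 0 0| <= 2 * 1 * 2 by apply: ler_pM; rewrite ?mulr_ge0.
  lra.
have gn i j := le_lt_trans (mxnorm_entry (g - 1) i j) hg.
have ga : `|g 0 0| <= 2.
  have := gn 0 0; rewrite !mxE /= => h; have := ler_normD (g 0 0 - 1) 1.
  by rewrite subrK qnorm1; lra.
have gd : `|g 1 1| <= 2.
  have := gn 1 1; rewrite !mxE /= => h; have := ler_normD (g 1 1 - 1) 1.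
  by rewrite subrK qnorm1; lra.
have gc : `|g 1 0| <= 4^-1 by have := gn 1 0; rewrite !mxE /= subr0 => /ltW.
have gb : `|g 0 1| <= 4.
  by have := gn 0 1; rewrite !mxE /= subr0; lra.
have iter n : exists k, [/\ H k, k 1 0 != 0 /\ `|k 1 0| <= 4^-1 ^+ n * 4^-1,
      `|k 0 0| <= 2, `|k 1 1| <= 2 & `|k 0 1| <= 4].
  elim: n => [|n [k [Hk [kc kc1] ka kd kb]]].
    by exists g; split; rewrite // expr0 mul1r.
  have q1 : 4^-1 ^+ n <= 1 :> R.
    by rewrite exprn_ile1 // ?invr_ge0 // invf_le1 // ler1n.
  have [|k' [Hk' [kc' kc1'] ka' kd' kb']] := step k Hk kc _ ka kd.
    by apply: le_trans kc1 _; rewrite ler_piMl // invr_ge0.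
  exists k'; split=> //; split=> //; apply: le_trans kc1' _.
  by rewrite exprS -mulrA; apply: ler_wpM2l; rewrite ?invr_ge0.
have [d d0 hd] := gap_entry 9 (And4 HS H1 HM HV) gap.
have four : 1 < 4 :> R by rewrite ltr1n.
have [n hn] := powers_unbounded d^-1 four ltr01.
have [k [Hk [kc kc1] ka kd kb]] := iter n.
have q0 : 0 < 4^-1 ^+ n :> R by rewrite exprn_gt0 // invr_gt0.
have q1 : 4^-1 ^+ n <= 1 :> R.
  by rewrite exprn_ile1 // ?invr_ge0 // invf_le1 // ler1n.
have kM : mxnorm k <= 9.
  rewrite /mxnorm; move: ka kd kb kc1 q1; move: (4^-1 ^+ n : R).
  by clear=> *; lra.
have := hd k Hk kM kc; rewrite leNgt => /negP; apply.
apply: le_lt_trans kc1 _.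
rewrite mul1r -[_ ^+ n]invrK -exprVn lef_pV2 ?posrE ?exprn_gt0 // in hn.
by apply: lt_le_trans hn; rewrite gtr_pMr // invf_lt1 // ltr1n.
Qed.

End Inequalities.
(** * Arguments, and the twist condition *)

Section Twist.
Variable R : realType.
Local Notation M2 := 'M[quat R]_2.
Implicit Types A B P Q f g : M2.
Implicit Types l m q : quat R.

Lemma similar_norm l m : similar l m -> `|l| = `|m|.
Proof.
move=> [c c0 ->]; rewrite !qnormM qnormV mulrAC mulVf ?mul1r //.
by rewrite normr_eq0.
Qed.

Lemma similar_re l m : similar l m -> qre l = qre m.
Proof.
by move=> [c c0 ->]; rewrite -mulrA qreMC -mulrA qmulV // mulr1.
Qed.

Lemma similar_intertwine l m q : q != 0 -> l * q = q * m -> similar l m.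
Proof. by move=> q0 e; exists q => //; rewrite -mulrA e mulrA qmulVl // mul1r. Qed.

Lemma similar_refl l : similar l l.
Proof. by apply: (@similar_intertwine _ _ 1); rewrite ?oner_neq0 ?mulr1 ?mul1r. Qed.

Lemma similar_sym l m : similar l m -> similar m l.
Proof.
move=> [c c0 ->]; apply: (@similar_intertwine _ _ c^-1); rewrite ?invr_eq0 //.
by rewrite -!mulrA qmulV // mulr1.
Qed.

Lemma similar_trans l m q : similar l m -> similar m q -> similar l q.
Proof.
move=> [c c0 ->] [d d0 ->]; apply: (@similar_intertwine _ _ (c * d)).
  by rewrite qmul_eq0 negb_or c0.
by rewrite !mulrA -(mulrA c d d^-1) qmulV // mulr1 qmulV // mul1r.
Qed.

Lemma polar l : complexq l -> l != 0 ->
  exists t, [/\ - pi < t, t <= pi & l = `|l| *: qexpi t].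
Proof.
case: l => x y z w [/= -> ->] l0; set n := `|_|.
have n0 : 0 < n by rewrite normr_gt0.
have n2 : n ^+ 2 = x ^+ 2 + y ^+ 2.
  by rewrite /n sqr_qnorm /qnormsq /= expr0n /= !addr0.
pose c := x / n.
have c2 : c ^+ 2 + (y / n) ^+ 2 = 1.
  by rewrite !expr_div_n -mulrDl -n2 mulfV // expf_neq0 // gt_eqF.
have c1 : -1 <= c <= 1.
  rewrite -ler_norml -(@ler_pXn2r _ 2) ?nnegrE // sqr_norm_re expr1n.
  by have := sqr_ge0 (y / n); lra.
have s2 : Num.sqrt (1 - c ^+ 2) = `|y / n|.
  by rewrite -sqrtr_sqr; congr Num.sqrt; lra.
have cE : cos (acos c) = c by apply: acosK; rewrite in_itv.
have sE : sin (acos c) = `|y / n| by rewrite sin_acos.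
have xE : x = n * c by rewrite /c mulrC divfK // gt_eqF.
have yE : y = n * (y / n) by rewrite mulrC divfK // gt_eqF.
have pi0 := pi_gt0 R.
have [y0|y0] := leP 0 (y / n).
  exists (acos c); split; first by have := acos_ge0 c1; lra.
    exact: acos_lepi.
  by rewrite /qexpi cE sE ger0_norm //; apply: quatP; rewrite /= ?mulr0.
have cn : -1 < c.
  rewrite lt_def; move: c1 => /andP[-> _]; rewrite andbT; apply/eqP => cm.
  have : (y / n) ^+ 2 = 0 by move: c2; rewrite cm sqrrN expr1n; lra.
  by move/eqP; rewrite sqrf_eq0 => /eqP h; move: y0; rewrite h ltxx.
exists (- acos c); split.
- by rewrite ltrN2; apply: acos_ltpi; rewrite cn; case/andP: c1.
- by have := acos_ge0 c1; lra.
by rewrite /qexpi cosN sinN cE sE ltr0_norm // opprK; apply: quatP; rewrite /= ?mulr0.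
Qed.

Lemma qargP l : complexq l -> l != 0 ->
  [/\ 0 <= qarg l, qarg l <= pi & qre l = `|l| * cos (qarg l)].
Proof.
move=> cl l0; have [t [t1 t2 lE]] := polar cl l0.
have : [set x | exists t, [/\ - pi < t, t <= pi, similar l (`|l| *: qexpi t)
    & x = `|t|]] (qarg l).
  apply: (@xgetPex _ 0); exists `|t|; exists t; split=> //; rewrite -lE.
  exact: similar_refl.
move=> [u [u1 u2 su ->]]; split=> //.
  by rewrite ler_norml u2 ltW.
rewrite (similar_re su) /=; have [h|h] := leP 0 u; first by rewrite ger0_norm.
by rewrite ltr0_norm // cosN.
Qed.

(** The inner product of l and q m q^-1 in R^4 is least when their imaginary parts
    point in opposite directions. *)
Lemma twist_norm l m q : complexq l -> complexq m -> l != 0 -> m != 0 ->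
  `|l * q - q * m| ^+ 2 <=
  (`|l| ^+ 2 + `|m| ^+ 2 - 2 * (`|l| * `|m| * cos (qarg l + qarg m))) * `|q| ^+ 2.
Proof.
move=> cl cm l0 m0.
have [a0 api aE] := qargP cl l0; have [b0 bpi bE] := qargP cm m0.
have im (x : quat R) : complexq x -> 0 <= qarg x -> qarg x <= pi ->
    qre x = `|x| * cos (qarg x) -> `|qi x| = `|x| * sin (qarg x).
  move=> [xj xk] x0 x1 xE.
  have s0 : 0 <= sin (qarg x) by apply: sin_ge0_pi; rewrite x0.
  apply: (@pexpIrn _ 2) => //; rewrite ?nnegrE ?mulr_ge0 //.
  have : `|x| ^+ 2 = qre x ^+ 2 + qi x ^+ 2.
    by rewrite sqr_qnorm /qnormsq xj xk expr0n /= !addr0.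
  rewrite exprMn sin2cos2 mulrBr mulr1 -exprMn -xE sqr_norm_re; lra.
have aI := im l cl a0 api aE; have bI := im m cm b0 bpi bE.
rewrite cosD.
have -> : `|l| * `|m| * (cos (qarg l) * cos (qarg m) - sin (qarg l) * sin (qarg m))
    = qre l * qre m - `|qi l * qi m|.
  by rewrite normrM aI bI aE bE; ring.
rewrite !sqr_qnorm.
have h1 := ler_norm (qi l * qi m); have h2 := ler_norm (- (qi l * qi m)).
rewrite normrN in h2.
move: `|qi l * qi m| h1 h2 => w.
move: l m q cl cm {a0 api aE b0 bpi bE l0 m0 aI bI}.
move=> [x u l2 l3] [y v m2 m3] [q0 q1 q2 q3] [/= -> ->] [/= -> ->] h1 h2.
rewrite /= in h1 h2; rewrite /qnormsq /= -subr_ge0.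
set D := (X in 0 <= X).
have -> : D = 2 * ((w + u * v) * (q0 ^+ 2 + q1 ^+ 2) + (w - u * v) * (q2 ^+ 2 + q3 ^+ 2)).
  by rewrite /D; ring.
have p1 : 0 <= w + u * v by lra.
have p2 : 0 <= w - u * v by lra.
by rewrite mulr_ge0 //; apply: addr_ge0; apply: mulr_ge0 => //; rewrite ?addr_ge0 ?sqr_ge0.
Qed.

Lemma twist_lt_of l m : complexq l -> complexq m -> `|l| * `|m| = 1 ->
  `|l| ^+ 2 + `|m| ^+ 2 - 2 * cos (qarg l + qarg m) < 1 -> ~ similar l m ->
  exists K, [/\ 0 <= K, K < 1 & twist_lt l m K].
Proof.
move=> cl cm lm; set D := (X in X < 1) => D1 ns.
have l0 : l != 0.
  by apply/eqP => l0; move/eqP: lm; rewrite l0 normr0 mul0r eq_sym oner_eq0.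
have m0 : m != 0.
  by apply/eqP => m0; move/eqP: lm; rewrite m0 normr0 mulr0 eq_sym oner_eq0.
have tw q : `|l * q - q * m| ^+ 2 <= D * `|q| ^+ 2.
  by have := twist_norm q cl cm l0 m0; rewrite lm mul1r.
have D0 : 0 <= D.
  by have := le_trans (sqr_ge0 _) (tw 1); rewrite qnorm1 expr1n mulr1.
exists (Num.sqrt D); split; first exact: sqrtr_ge0.
  by rewrite -sqrtr1 ltr_sqrt.
split=> // q => [|q0].
  rewrite -(@ler_pXn2r _ 2) ?nnegrE ?mulr_ge0 ?sqrtr_ge0 //.
  by rewrite exprMn (sqr_sqrtr D0); apply: tw.
by apply/eqP => e; apply: ns; apply: similar_intertwine e.
Qed.

(** The triple angle formula at pi gives (c + 1) (2 c - 1)^2 = 0. *)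
Lemma cos_pi_div3 : cos (pi / 3) = 2^-1 :> R.
Proof.
set t := pi / 3; have pi0 := pi_gt0 R.
have c0 : 0 < cos t.
  apply: cos_gt0_pihalf; rewrite /t; apply/andP; split; lra.
have : cos (t + t + t) = -1 by rewrite (_ : t + t + t = pi) ?cospi // /t; field.
rewrite !cosD sinD; have := sin2cos2 t; rewrite expr2 => s2.
move=> h.
have : (cos t + 1) * (2 * cos t - 1) ^+ 2 = 0.
  have e : sin t * cos t * sin t = cos t * (1 - cos t ^+ 2) by rewrite -s2; ring.
  have e' : cos t * sin t * sin t = cos t * (1 - cos t ^+ 2) by rewrite -s2; ring.
  have e'' : sin t * sin t * cos t = cos t * (1 - cos t ^+ 2) by rewrite -s2; ring.
  move: h; rewrite mulrBl mulrDl e e' e'' => h; nra.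
move/eqP; rewrite mulf_eq0 sqrf_eq0 => /orP[/eqP|/eqP]; lra.
Qed.

(** A matrix intertwining two diagonal forms is invertible, so that it has nonzero
    entries either on the diagonal or off it. *)
Lemma diagonal_form_uniq f l m l' m' : diagonal_form f l m ->
  diagonal_form f l' m' ->
  (similar l l' /\ similar m m') \/ (similar l m' /\ similar m l').
Proof.
move=> [_ _ _ [P [Q [SP SQ [PQ QP] fE]]]] [_ _ _ [P' [Q' [SP' SQ' [PQ' QP'] fE']]]].
pose S := Q' * P.
have S1 : sqdet S = 1.
  move: SP SQ' => /SL2H_sqdet P1 /SL2H_sqdet Q1.
  by rewrite sqdetM P1 Q1 mulr1.
have e : S * mx2 l 0 0 m = mx2 l' 0 0 m' * S.
  have : Q' * f * P = Q' * f * P by [].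
  rewrite {1}fE fE' !mulrA -(mulrA _ Q P) QP mulr1 QP' mul1r => h.
  by rewrite /S h ?mulrA.
clearbody S; have h i j := congr1 (fun A : M2 => A i j) e.
have := (h 0 0, h 0 1, h 1 0, h 1 1).
rewrite !mul2E !mx2e !mulr0 !mul0r !addr0 !add0r => -[[[e1 e2] e3] e4].
have [_ nd] := sqdet_abs S1.
have sim (a b x : quat R) : x != 0 -> x * a = b * x -> similar a b.
  by move=> x0 /esym /(similar_intertwine x0) /similar_sym.
have [a0|a0] := eqVneq (S 0 0) 0.
  move: nd; rewrite a0 normr0 mul0r add0r => nd.
  have b0 : S 0 1 != 0.
    by apply/eqP => b0; move: nd; rewrite b0 normr0 mul0r ler10.
  have c0 : S 1 0 != 0.
    by apply/eqP => c0; move: nd; rewrite c0 normr0 mulr0 ler10.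
  by right; split; [exact: (sim _ _ _ c0 e3)|exact: (sim _ _ _ b0 e2)].
have [d0|d0] := eqVneq (S 1 1) 0; last first.
  by left; split; [exact: (sim _ _ _ a0 e1)|exact: (sim _ _ _ d0 e4)].
move: nd; rewrite d0 normr0 mulr0 add0r => nd.
have b0 : S 0 1 != 0.
  by apply/eqP => b0; move: nd; rewrite b0 normr0 mul0r ler10.
have c0 : S 1 0 != 0.
  by apply/eqP => c0; move: nd; rewrite c0 normr0 mulr0 ler10.
by right; split; [exact: (sim _ _ _ c0 e3)|exact: (sim _ _ _ b0 e2)].
Qed.

Lemma argtr_form f l m : diagonal_form f l m ->
  exists l' m', diagonal_form f l' m' /\ argtr f = qarg l' + qarg m'.
Proof.
move=> h; have : [set x | exists l m, diagonal_form f l m /\ x = qarg l + qarg m]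
    (argtr f).
  by apply: (@xgetPex _ 0); exists (qarg l + qarg m), l, m.
by move=> [l' [m' ?]]; exists l', m'.
Qed.

Lemma abstr_form f l m : diagonal_form f l m -> abstr f = `|l| + `|m|.
Proof.
move=> h; have : [set x | exists l m, diagonal_form f l m /\ x = `|l| + `|m|]
    (abstr f).
  by apply: (@xgetPex _ 0); exists (`|l| + `|m|), l, m.
move=> [l' [m' [h' ->]]].
case: (diagonal_form_uniq h h') => -[/similar_norm -> /similar_norm ->] //.
by rewrite addrC.
Qed.

(** For imaginary v of norm r, v (v + r i) = (v + r i) r i. *)
Lemma similar_complex l : exists c : quat R, `|c| = 1 /\ complexq (c^-1 * l * c).
Proof.
case: l => x y z w.
pose r := Num.sqrt (y ^+ 2 + z ^+ 2 + w ^+ 2).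
have r2 : r ^+ 2 = y ^+ 2 + z ^+ 2 + w ^+ 2.
  by rewrite sqr_sqrtr // !addr_ge0 ?sqr_ge0.
pose c := Quat 0 (y + r) z w.
have [c0|c0] := eqVneq c 0.
  exists 1; rewrite qnorm1 invr1 mul1r mulr1; split=> //.
  by move/eqP: c0 => /eqP[_ z0 w0]; split=> /=.
have n0 : `|c| != 0 by rewrite normr_eq0.
pose c' := `|c|^-1 *: c.
have c'0 : c' != 0 by rewrite scaler_eq0 negb_or invr_eq0 n0.
exists c'; split.
  by rewrite normrZ ger0_norm ?invr_ge0 // mulVf.
rewrite -mulrA; have -> : Quat x y z w * c' = c' * Quat x r 0 0.
  have e : Quat x y z w * c = c * Quat x r 0 0.
    have {r2}r2 : r * r = y * y + z * z + w * w by rewrite -!expr2.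
    apply: quatP; rewrite /c /=; nra.
  by rewrite /c' -scalerAr e scalerAl.
by rewrite mulrA qmulVl // mul1r.
Qed.

(** The two fixed points at infinity are the columns of a diagonalizing frame;
    each diagonal entry is then made complex separately. *)
Lemma hyperbolic_diagonal_form f : hyperbolic f ->
  exists l m, diagonal_form f l m.
Proof.
move=> [/SL2H_sqdet f1 _ [z1 [z2 [z12 fz]]]].
have fix1 z : z = z1 \/ z = z2 -> eigvec f (homog z).
  move=> hz; apply/(mobius_fixed _ f1).
  by have : [set z1; z2] z by []; rewrite -fz.
have nz : ~ exists k : 'M[quat R]_1, homog z2 = homog z1 *m k.
  by move=> [k /homog_inj e]; apply: z12.
have [P [Q [k [P1 PQ k0 E1 E2]]]] := frame_exists (homog_neq0 z1) nz.
pose B := Q * f * P.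
have Q1 := mx_inverse_sqdet PQ P1.
have B1 : sqdet B = 1 by rewrite !sqdetM P1 Q1 f1 !mulr1.
have B10 : B 1 0 = 0.
  apply/eigvec_e0; apply/(eigvec_conj _ _ PQ); rewrite E1.
  by apply/(eigvec_scale _ _ k0); apply: fix1; left.
have B01 : B 0 1 = 0.
  have : eigvec B (colq 0 1).
    apply/(eigvec_conj _ _ PQ); rewrite E2.
    by apply/(eigvec_scale _ _ k0); apply: fix1; right.
  by move/eigvec_colq => [c []]; rewrite !mulr0 add0r mulr1 mul0r.
have BE : B = mx2 (B 0 0) 0 0 (B 1 1) by rewrite {1}(mx2_eta B) B10 B01.
have [c [c1 cc]] := similar_complex (B 0 0).
have [d [d1 dc]] := similar_complex (B 1 1).
have c0 : c != 0 by rewrite -normr_eq0 c1 oner_neq0.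
have d0 : d != 0 by rewrite -normr_eq0 d1 oner_neq0.
pose U := mx2 c 0 0 d; pose V := mx2 c^-1 0 0 d^-1.
have UV : mx_inverse U V.
  by split; rewrite mx2_mul mx2_one !mulr0 !mul0r !addr0 !add0r ?qmulV ?qmulVl.
have U1 : sqdet U = 1 by rewrite sqdet_diag c1 d1 mulr1 expr1n.
have D : V * B * U = mx2 (c^-1 * B 0 0 * c) 0 0 (d^-1 * B 1 1 * d).
  by rewrite {1}BE !mx2_mul !mulr0 !mul0r !addr0 !add0r !mul0r.
have iPU := mx_inverseM PQ UV.
have PU1 : sqdet (P * U) = 1 by rewrite sqdetM P1 U1 mulr1.
exists (c^-1 * B 0 0 * c), (d^-1 * B 1 1 * d); split=> //.
  have : sqdet (V * B * U) = 1.
    by rewrite (sqdetM (V * B)) (sqdetM V) U1 B1 (mx_inverse_sqdet UV U1) !mulr1.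
  rewrite D sqdet_diag => /eqP; rewrite sqrp_eq1 ?mulr_ge0 //; exact: eqP.
exists (P * U), (V * Q); split=> //.
- exact/SL2H_sqdet.
- by apply/SL2H_sqdet; apply: mx_inverse_sqdet iPU PU1.
rewrite -D /B (_ : V * (Q * f * P) * U = V * Q * f * (P * U)); last first.
  by rewrite !mulrA.
by rewrite conjsetK //; apply: mx_inverse_sym.
Qed.

(** If P diagonalizes f to a unitary matrix, f fixes the Hermitian matrix P times
    its conjugate transpose. *)
Lemma unitary_diagonal_fixes f l m : SL2H f -> diagonal_form f l m ->
  `|l| = 1 -> `|m| = 1 -> exists2 p, H5 p & poincare f p = p.
Proof.
move=> /SL2H_sqdet f1 [_ _ _ [P [Q [/SL2H_sqdet P1 _ [PQ QP] fE]]]] l1 m1.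
have pX : positive (P * star P).
  by rewrite -[P in P * _]mulr1; apply: positive_conj; rewrite ?P1 ?oner_neq0 //;
    exact: positive1.
have [p hp [r r0 XE]] := positive_normalize pX.
exists p => //; apply/(fixed_embed f1 hp); apply: (rscale_inj (lt0r_neq0 r0)).
rewrite -rscaleAl -rscaleAr -XE fE !starM !mulrA.
have QPs : star P * star Q = 1 by rewrite -starM QP star1.
rewrite -(mulrA _ Q P) QP mulr1 -(mulrA _ (star P)) QPs mulr1.
congr (_ * _); rewrite -mulrA (_ : _ * star _ = 1) ?mulr1 //.
have q0 : qconj (0 : quat R) = 0 by apply: quatP; rewrite //= oppr0.
rewrite mx2_one; apply: mx2_ext; rewrite mul2E !starE !mx2e ?q0;
  rewrite ?mulr0 ?mul0r ?addr0 ?add0r // qmul_conj -sqr_qnorm ?l1 ?m1 expr1n;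
  exact: quatP.
Qed.

End Twist.

(** * The discreteness criterion *)

Section Criterion.
Variable R : realType.
Local Notation M2 := 'M[quat R]_2.
Implicit Types A B P Q f g : M2.
Implicit Type G : set M2.

Lemma subgroup_generated2 f g : SL2H f -> SL2H g ->
  subgroup_SL2H (generated2 f g).
Proof.
move=> Sf Sg.
have SS : subgroup_SL2H (SL2H (R := R)).
  split=> //.
  - exact/SL2H_sqdet/sqdet1.
  - move=> A B /SL2H_sqdet A1 /SL2H_sqdet B1; apply/SL2H_sqdet.
    by rewrite sqdetM A1 B1 mulr1.
  by move=> A /SL2H_sqdet /sqdet1_inv[B AB /SL2H_sqdet]; exists B.
split.
- by move=> A; apply; split.
- by move=> H [[_ ? _ _] _ _].
- move=> A B hA hB H [sH Hf Hg]; have [_ _ HM _] := sH.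
  by apply: HM; [apply: hA|apply: hB].
move=> A hA; have [_ _ _ SV] := SS.
have [B SB AB] := SV A (hA _ (And3 SS Sf Sg)).
exists B => // H [sH Hf Hg]; have [_ _ _ HV] := sH.
have [C HC AC] := HV A (hA H (And3 sH Hf Hg)).
by rewrite (mx_inverse_uniq AB AC).
Qed.

Lemma gap_conjset P Q G : mx_inverse P Q -> gap_at_identity G ->
  gap_at_identity (conjset P Q G).
Proof.
move=> PQ [e e0 he]; have [d d0 hd] := conj_near (mx_inverse_sym PQ) e0.
exists d => // k Gk hk; have := he _ Gk (hd k hk) => e1.
by rewrite -(conjsetK k PQ) e1 mulr1; case: PQ.
Qed.

(** If G is indiscrete, it contains loxodromic elements that are near the identity
    and move 0 and infinity in the frame where f is in normal form; together with
    f they generate an indiscrete group. *)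
Lemma discrete_of_test G f : subgroup_SL2H G -> zariski_dense G -> SL2H f ->
  (exists P Q F, [/\ SL2H P, mx_inverse P Q, f = P * F * Q
    & expels_near_identity F]) ->
  (forall g, G g -> hyperbolic g -> discrete_subset (generated2 f g)) ->
  discrete_subset G.
Proof.
move=> sG zG Sf [P [Q [F [/SL2H_sqdet P1 PQ fE [e e0 he]]]]] test.
apply/(discreteP sG); apply: contrapT => nG.
have iG := zariski_dense_irreducible sG zG.
have dG : indiscrete G.
  move=> r r0; apply: contrapT => h; apply: nG; exists r => // k Gk hk.
  by apply: contrapT => /eqP k1; apply: h; exists k.
have [g [Gg hg tg b0 c0]] := near_loxodromic_generic
  (subgroup_conjset P1 PQ sG) (irreducible_conjset P1 PQ iG)
  (indiscrete_conjset PQ dG) e0.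
have [GS _ _ _] := sG.
have Sg : SL2H (P * g * Q) by apply: GS.
have hypg : hyperbolic (P * g * Q).
  apply: loxodromic_hyperbolic; first exact/SL2H_sqdet.
  rewrite retr_conj; last exact: mx_inverse_sym.
  exact: lt_le_trans (ler_norm _).
have sH := subgroup_generated2 Sf Sg.
have /(discreteP sH) gH := test _ Gg hypg.
apply: (he (conjset P Q (generated2 f (P * g * Q))) g) => //.
- exact: subgroup_conjset.
- by rewrite /conjset /= -fE => H [].
- by move=> H [].
exact: gap_conjset.
Qed.

End Criterion.

Theorem theorem1p1 (R : realType) (G : set 'M[quat R]_2)
    (G_subgroup : subgroup_SL2H G) (G_dense : zariski_dense G) :
  [/\ forall f : 'M[quat R]_2, rotatory2_elliptic f ->
        0 < argtr f -> argtr f < pi / 3 ->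
        (forall g, G g -> hyperbolic g -> discrete_subset (generated2 f g)) ->
        discrete_subset G,
      forall f : 'M[quat R]_2, hyperbolic f ->
        2^-1 * (abstr f ^+ 2 - 3) < cos (argtr f) ->
        (forall g, G g -> hyperbolic g -> discrete_subset (generated2 f g)) ->
        discrete_subset G
    & forall f : 'M[quat R]_2, parabolic f ->
        (exists2 mu : quat R, `|mu| <= 1 & conjugate_SL2H f (mx2 1 mu 0 1)) ->
        (forall g, G g -> hyperbolic g -> discrete_subset (generated2 f g)) ->
        discrete_subset G].
Proof.
split.
- move=> f [[Sf _] [l0 [m0 [d0 l01 m01 ns0]]]] a0 a1; apply: discrete_of_test => //.
  have [l [m [dlm E]]] := argtr_form d0.
  have [l1 m1 ns] : [/\ `|l| = 1, `|m| = 1 & ~ similar l m].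
    case: (diagonal_form_uniq d0 dlm) => -[s1 s2].
      rewrite -(similar_norm s1) -(similar_norm s2); split=> // s.
      apply: ns0; apply: similar_trans s1 _; apply: similar_trans s _.
      exact: similar_sym.
    rewrite -(similar_norm s1) -(similar_norm s2); split=> // s.
    apply: ns0; apply: similar_trans s1 _; apply: similar_trans (similar_sym s) _.
    exact: similar_sym.
  have [cl cm lm [P [Q [SP SQ PQ fE]]]] := dlm.
  have [|K [K0 K1 tw]] := twist_lt_of cl cm lm _ ns.
    have : cos (pi / 3) < cos (argtr f).
      have pi0 := pi_gt0 R.
      by rewrite ltr_cos // in_itv /=; apply/andP; split; lra.
    by rewrite cos_pi_div3 E l1 m1 !expr1n; lra.
  by exists P, Q, (mx2 l 0 0 m); split=> //; apply: jorgensen tw K0 K1.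
- move=> f hf hc; have [Sf nf _] := hf; apply: discrete_of_test => //.
  have [l0 [m0 d0]] := hyperbolic_diagonal_form hf.
  have [l [m [dlm E]]] := argtr_form d0.
  have [cl cm lm [P [Q [SP SQ PQ fE]]]] := dlm.
  have ns : ~ similar l m.
    move=> /similar_norm e; apply: nf; move/eqP: lm; rewrite -e -expr2.
    rewrite sqrp_eq1 // => /eqP l1.
    by apply: (unitary_diagonal_fixes Sf dlm); rewrite -?e.
  have [|K [K0 K1 tw]] := twist_lt_of cl cm lm _ ns.
    move: hc; rewrite (abstr_form dlm) E sqrrD lm; lra.
  by exists P, Q, (mx2 l 0 0 m); split=> //; apply: jorgensen tw K0 K1.
move=> f [Sf nf _] [mu mu1 [P [Q [SP SQ PQ fE]]]]; apply: discrete_of_test => //.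
exists P, Q, (mx2 1 mu 0 1); split=> //; apply: shimizu => //.
apply/eqP => mu0; apply: nf.
have f1 : f = 1 by rewrite fE mu0 -mx2_one mulr1; case: PQ.
have h : H5 (0 : quat R, 1 : R) by rewrite /H5 /=.
exists (0, 1) => //; apply/fixed_embed => //; first by rewrite f1 sqdet1.
by rewrite f1 star1 mulr1 mul1r.
Qed.
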